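(* Let $m\ge 2$, let $M$ be an $m$-dimensional connected complete smooth Finsler manifold, and let $N\subset M$ be a nonempty closed subset. Then $$\Sigma(N)=\bigcup_{j=1}^\infty S_j\cup R,$$ where $\{S_j\}_{j=1}^\infty$ is an (at most) countable family of delta-convex hypersurfaces $S_j\subset M$, and $R\subset M$ is a subset contained in a countable union of $(m-2)$-dimensional delta-convex submanifolds of $M$.
   Context: **Finsler manifolds.** A (smooth) Finsler manifold is a $C^\infty$ manifold $M$ with a function $F:TM\to[0,\infty)$, $C^\infty$ away from the zero section, whose restriction to each $T_pM$ is a Minkowski norm: $F(p,y)=0$ iff $y=0$; $F(p,\lambda y)=\lambda F(p,y)$ for $\lambda\ge0$; and for each $y\in T_pM\setminus\{0\}$ the symmetric bilinear form $g_y(u,v)=\frac{\partial^2}{\partial s\partial t}\big|_{s=t=0}\frac12F^2(p,y+su+tv)$ is an inner product. The distance $d(p,q)$ is the infimum of $\int_a^bF(\gamma,\gamma')\,dt$ over piecewise $C^1$ curves $\gamma$ from $p$ to $q$ (it need not be symmetric). ''Complete'' means both forward and backward complete: every sequence $(p_i)$ which is forward Cauchy (for every $\varepsilon>0$, $d(p_i,p_j)<\varepsilon$ for all sufficiently large $i\le j$) or backward Cauchy (the same with $d(p_j,p_i)<\varepsilon$) converges. **Singular set.** $d_N:M\setminus N\to(0,\infty)$ is $d_N(p)=\inf_{q\in N}d(q,p)$, and $\Sigma(N)$ is the set of all $p\in M\setminus N$ at which $d_N$ is not differentiable. **DC functions and submanifolds.** A continuous function $u:\Omega\to\mathbf R$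 on an open set $\Omega\subset\mathbf R^k$ is (locally) delta-convex (DC) if on every open convex set $\Omega'$ with compact closure in $\Omega$ it is the difference of two convex functions; a vector-valued map is DC if each component is; for maps defined on an open subset of an affine subspace, identify the affine subspace with a Euclidean space by an isometry. For $1\le d\le m-1$, a subset $S\subset\mathbf R^m$ is a $d$-dimensional DC submanifold of $\mathbf R^m$ if for every $p\in S$ there are an open neighborhood $U$ of $p$ in $\mathbf R^m$ and a $d$-dimensional affine subspace $P\subset\mathbf R^m$ such that, with $\pi$ the orthogonal projection onto $P$, the set $\pi(S\cap U)$ is open in $P$, $\pi|_{S\cap U}$ is bi-Lipschitz, and $(\pi|_{S\cap U})^{-1}:\pi(S\cap U)\to S\cap U$ is a DC map. A subset $S$ of a smooth $m$-manifold $M$ is a $d$-dimensional DC submanifold of $M$ if for every local chart $(U,\varphi)$ the set $\varphi(S\cap U)$ is a $d$-dimensional DC submanifold of $\mathbf R^m$. (The empty set satisfies the definition.) A DC hypersurface is a DC submanifold of dimension $m-1$. A $0$-dimensional DC submanifold means a point. *)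

(* Defs.v *)
From HB Require Import structures.
From mathcomp Require Import all_boot all_order all_algebra.
From mathcomp Require Import all_classical all_reals all_analysis.

Set Implicit Arguments.
Unset Strict Implicit.
Unset Printing Implicit Defensive.
Import Order.TTheory GRing.Theory Num.Theory.
Import numFieldNormedType.Exports.
Local Open Scope classical_set_scope.
Local Open Scope ring_scope.

(* C^k and C^oo maps.  The set A is always open where these are used, so that
   derivatives and continuity at the points of A only depend on f on A. *)
Fixpoint Ck (R : realType) (V W : normedModType R) (k : nat)
    (A : set V) (f : V -> W) : Prop :=
  {in A, continuous f} /\
  if k is k'.+1
  then forall v : V, (forall x, A x -> derivable f x v) /\ Ck k' A ('D_v f)
  else True.

Definition smooth_on (R : realType) (V W : normedModType R)
    (A : set V) (f : V -> W) : Prop := forall k, Ck k A f.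

(* [phi] and [psi] are total functions, but only matter on the domain
   and on its image respectively. *)
Record chart (R : realType) (m : nat) (M : topologicalType) := Chart {
  dom : set M;
  phi : M -> 'rV[R]_m;
  psi : 'rV[R]_m -> M;
  dom_open : open dom;
  cod_open : open (phi @` dom);
  phiK : {in dom, cancel phi psi};
  phi_continuous : {within dom, continuous phi};
  psi_continuous : {within phi @` dom, continuous psi} }.

Definition compatible (R : realType) (m : nat) (M : topologicalType)
    (c c' : chart R m M) : Prop :=
  smooth_on (phi c @` (dom c `&` dom c')) (phi c' \o psi c) /\
  smooth_on (phi c' @` (dom c' `&` dom c)) (phi c \o psi c').

Record smoothManifold (R : realType) (m : nat) := SmoothManifold {
  carrier :> topologicalType;
  manifold_hausdorff : hausdorff_space carrier;
  manifold_second_countable : @second_countable carrier;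
  atlas : set (chart R m carrier);
  atlas_cover : forall p : carrier, exists2 c, atlas c & dom c p;
  atlas_compatible : forall c c', atlas c -> atlas c' -> compatible c c';
  atlas_maximal : forall c, (forall c', atlas c' -> compatible c c') ->
    atlas c }.

Definition chart_at (R : realType) (m : nat) (M : smoothManifold R m)
    (p : M) : set (chart R m M) := [set c | atlas c /\ dom c p].

(* A tangent vector at p is the family of its coordinate vectors in all the
   charts at p, related by the differentials of the transition maps.  The
   family is set to 0 at the other charts, so that distinct families are
   distinct vectors. *)
Section Tangent.
Variables (R : realType) (m : nat) (M : smoothManifold R m) (p : M).

Definition is_tangent : {pred chart R m M -> 'rV[R]_m} :=
  fun v => `[< (forall c, ~ chart_at p c -> v c = 0) /\
    (forall c c', chart_at p c -> chart_at p c' ->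
       v c' = 'd (phi c' \o psi c) (phi c p) (v c)) >].

Fact is_tangent_submod : submod_closed is_tangent.
Proof.
split.
  by apply/asboolP; split=> [c _|c c' _ _]; rewrite ?linear0.
move=> a u v /asboolP[u0 uT] /asboolP[v0 vT]; apply/asboolP; split.
  move=> c pc; change (a *: u c + v c = 0).
  by rewrite u0 // v0 // scaler0 addr0.
move=> c c' pc pc'.
change (a *: u c' + v c' =
  'd (phi c' \o psi c) (phi c p) (a *: u c + v c)).
by rewrite linearP -uT // -vT.
Qed.

HB.instance Definition _ :=
  GRing.isSubmodClosed.Build R (chart R m M -> 'rV[R]_m) is_tangent
    is_tangent_submod.

Record tangent := Tangent {
  coord :> chart R m M -> 'rV[R]_m;
  _ : coord \in is_tangent }.

HB.instance Definition _ := [isSub for coord].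
HB.instance Definition _ := [Choice of tangent by <:].
HB.instance Definition _ := [SubChoice_isSubLmodule of tangent by <:].

End Tangent.

Section Minkowski.
Variables (R : realType) (V : lmodType R).

Definition is_inner_product (g : V -> V -> R) : Prop :=
  [/\ forall u v, g u v = g v u,
      forall a u v w, g (a *: u + v) w = a * g u w + g v w &
      forall u, u != 0 -> 0 < g u u].

Definition fundamental_tensor (F : V -> R) (y u v : V) : R :=
  derive1 (fun s : R =>
    derive1 (fun t : R => 2^-1 * F (y + s *: u + t *: v) ^+ 2) 0) 0.

Definition is_minkowski_norm (F : V -> R) : Prop :=
  [/\ forall y, 0 <= F y,
      forall y, F y = 0 <-> y = 0,
      forall (l : R) y, 0 <= l -> F (l *: y) = l * F y &
      forall y, y != 0 -> is_inner_product (fundamental_tensor F y)].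

End Minkowski.

(* Smoothness away from the zero section is expressed in the charts of the
   tangent bundle induced by the charts of M. *)
Record finsler (R : realType) (m : nat) (M : smoothManifold R m) := Finsler {
  finsler_fun :> forall p : M, tangent p -> R;
  finsler_smooth : forall c, atlas c ->
    exists2 G : 'rV[R]_m * 'rV[R]_m -> R,
      smooth_on [set xy | (phi c @` dom c) xy.1 /\ xy.2 != 0] G &
      forall (p : M) (v : tangent p), dom c p ->
        finsler_fun v = G (phi c p, v c);
  finsler_norm : forall p : M, is_minkowski_norm (@finsler_fun p) }.

Arguments finsler_fun {R m M} f p v.

Section Distance.
Variables (R : realType) (m : nat) (M : smoothManifold R m) (F : finsler M).

Definition C1_curve_on (O : set R) (g : R -> M) : Prop :=
  {in O, continuous g} /\
  forall c, atlas c -> Ck 1 (O `&` g @^-1` dom c) (phi c \o g).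

(* C^1 on a compact interval: some C^1 extension to an open neighbourhood. *)
Definition C1_curve_segment (a b : R) (g : R -> M) : Prop :=
  exists (O : set R) (h : R -> M),
    [/\ open O, `[a, b] `<=` O, C1_curve_on O h &
        {in `[a, b], forall t, h t = g t}].

Definition piecewise_C1 (a b : R) (g : R -> M) : Prop :=
  exists2 s : seq R, itv_partition a b s &
    forall i, (i < size s)%N ->
      C1_curve_segment (nth b (a :: s) i) (nth b (a :: s) i.+1) g.

(* The velocity is only meaningful where the curve is differentiable, that
   is, off finitely many parameters for a piecewise C^1 curve. *)
Definition velocity (g : R -> M) (t : R) : tangent (g t) :=
  xget 0 [set v : tangent (g t) |
    forall c, chart_at (g t) c -> is_derive t 1 (phi c \o g) (v c)].

Definition curve_length (a b : R) (g : R -> M) : R :=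
  \int[lebesgue_measure]_(t in `[a, b]) F (g t) (velocity g t).

(* The infimum is over a nonempty set when M is connected. *)
Definition finsler_dist (p q : M) : R :=
  inf [set l | exists (a b : R) (g : R -> M),
    [/\ a < b, piecewise_C1 a b g, g a = p, g b = q &
        l = curve_length a b g]].

Definition forward_cauchy (u : nat -> M) : Prop :=
  forall e : R, 0 < e -> exists K : nat, forall i j : nat,
    (K <= i)%N -> (i <= j)%N -> finsler_dist (u i) (u j) < e.

Definition backward_cauchy (u : nat -> M) : Prop :=
  forall e : R, 0 < e -> exists K : nat, forall i j : nat,
    (K <= i)%N -> (i <= j)%N -> finsler_dist (u j) (u i) < e.

Definition finsler_complete : Prop :=
  forall u : nat -> M, forward_cauchy u \/ backward_cauchy u ->
    exists l : M, u @ \oo --> l.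

Definition dist_from (N : set M) (p : M) : R :=
  inf [set finsler_dist q p | q in N].

Definition differentiable_at (f : M -> R) (p : M) : Prop :=
  forall c, chart_at p c -> differentiable (f \o psi c) (phi c p).

Definition singular_set (N : set M) : set M :=
  [set p | ~ N p /\ ~ differentiable_at (dist_from N) p].

End Distance.

Section DC.
Variable R : realType.

(* The Euclidean norm; the library norm on row vectors is the sup norm. *)
Definition euclid_norm (n : nat) (x : 'rV[R]_n) : R :=
  Num.sqrt (\sum_(i < n) x 0 i ^+ 2).

Definition DC_fun (k : nat) (W : set 'rV[R]_k) (u : 'rV[R]_k -> R) : Prop :=
  {in W, continuous u} /\
  forall W' : set 'rV[R]_k,
    open W' -> convex_set W' -> compact (closure W') -> closure W' `<=` W ->
    exists f g : 'rV[R]_k -> R,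
      [/\ convex_function W' f, convex_function W' g &
          {in W', forall x, u x = f x - g x}].

Definition DC_map (k n : nat) (W : set 'rV[R]_k)
    (h : 'rV[R]_k -> 'rV[R]_n) : Prop :=
  forall i : 'I_n, DC_fun W (fun x => h x 0 i).

(* A d-dimensional affine subspace P of R^m, given by a point q of P and an
   orthonormal basis of its direction, the rows of B.  This determines an
   isometry [affine_isom] from R^d onto P. *)
Record affine_subspace (d m : nat) := AffineSubspace {
  affine_point : 'rV[R]_m;
  affine_basis : 'M[R]_(d, m);
  affine_orthonormal : affine_basis *m affine_basis^T = 1%:M }.

Definition affine_isom (d m : nat) (P : affine_subspace d m)
    (x : 'rV[R]_d) : 'rV[R]_m := affine_point P + x *m affine_basis P.

Definition affine_proj (d m : nat) (P : affine_subspace d m)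
    (z : 'rV[R]_m) : 'rV[R]_m :=
  affine_point P +
    (z - affine_point P) *m (affine_basis P)^T *m affine_basis P.

Definition bilipschitz_on (n n' : nat) (A : set 'rV[R]_n)
    (f : 'rV[R]_n -> 'rV[R]_n') : Prop :=
  exists2 L : R, 0 < L & forall x y, A x -> A y ->
    L^-1 * euclid_norm (x - y) <= euclid_norm (f x - f y) /\
    euclid_norm (f x - f y) <= L * euclid_norm (x - y).

(* [h] is the inverse of the projection restricted to [S `&` U], and [W] is
   the image [pi (S `&` U)], both read in R^d through [affine_isom P]. *)
Definition DC_submanifold_Rm (m d : nat) (S : set 'rV[R]_m) : Prop :=
  forall p, S p -> exists (U : set 'rV[R]_m) (P : affine_subspace d m),
    let W := affine_isom P @^-1` (affine_proj P @` (S `&` U)) in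
    [/\ open U, U p, open W, bilipschitz_on (S `&` U) (affine_proj P) &
        exists2 h : 'rV[R]_d -> 'rV[R]_m, DC_map W h &
          forall x, W x -> (S `&` U) (h x) /\
            affine_proj P (h x) = affine_isom P x].

Definition DC_submanifold (m : nat) (M : smoothManifold R m) (d : nat)
    (S : set M) : Prop :=
  if d is 0%N then exists p, S = [set p]
  else forall c, atlas c -> DC_submanifold_Rm d (phi c @` (S `&` dom c)).

Definition DC_hypersurface (m : nat) (M : smoothManifold R m)
    (S : set M) : Prop := DC_submanifold m.-1 S.

End DC.

(* Main.v *)
(* Let u be the distance from N.  In a chart, u is locally semiconcave: the
   almost minimizing curves ending at w are moved by diffeomorphisms that fix N
   and take w to the points w - t k and w + (1 - t) k, and the lengths of the
   moved curves are compared by Taylor's formula; no minimizing geodesic is used.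

   At each point x let D(x) be the set of the supergradients p of u with
   p.v >= F(x, v) for some v <> 0.  Supergradients satisfy p <= F(x, .), hence
   the elements of D(x) are dual to unit vectors and, F being differentiable
   off 0, no three of them are collinear.  D(x) is nonempty because u is touched
   from below by paraboloids at a dense set of points, where D is nonempty by
   the fundamental theorem of calculus along almost minimizing curves; D has
   closed graph, and u is differentiable where D(x) is a singleton.  So D(x) has
   at least two elements at the singular points.

   For a covector V, let f_V be the infimum of the paraboloids above u given by
   the supergradients close to V, near a given point.  It is semiconcave and has
   a slope close to V.  Where D(x) = {p0, p1}, u = min(f_V0, f_V1) with Vi close
   to pi, and {f_V0 = f_V1} is a DC hypersurface of singular points.  Where D(x)
   has three elements, they are affinely independent and
   {f_V0 = f_V1 = f_V2} is a DC submanifold of codimension 2.  Rational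
   parameters leave countably many such sets.

   The DC implicit function theorem rests on one convex function controlling
   the concavity defects of all the components of the implicit function. *)
From HB Require Import structures.
Require Import Defs.
From mathcomp Require Import all_boot all_order all_algebra.
From mathcomp Require Import all_classical all_reals all_analysis.
From mathcomp Require Import measurable_realfun ring lra zify.
Set Implicit Arguments.
Unset Strict Implicit.
Unset Printing Implicit Defensive.
Import Order.TTheory GRing.Theory Num.Theory.
Import numFieldNormedType.Exports.
Local Open Scope classical_set_scope.
Local Open Scope ring_scope.

(** * Linear algebra and topology of row vectors *)

(** Semiconcavity is quantitative: on a fixed ball the defect is at most n t (1 - t) |x - y|^2. With
    n and the ball fixed, being a supergradient is a closed condition in (x, p), and the paraboloids
    entering an envelope all have the same opening.

    Sigma(N) must contain the hypersurfaces, whereas R is only covered. So in the two-element case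
    the supergradients at all nearby points must be close to p0 or p1: then, all along {f_V0 =
    f_V1}, both envelopes agree with u and touch it from above with incompatible slopes. With a
    third element, only membership of the given point is required.

    A DC submanifold is tested in every chart, while the envelopes live in one chart and need not be
    differentiable. The implicit function theorem therefore assumes no derivative, only functions
    that are affine up to a small Lipschitz error, a property that survives a transition map. The
    error comes from the radius rho of the covector balls and from n times the radius r. The
    parameters are chosen in the order n, rho, V, r, because r must also fit in the neighbourhood
    that semicontinuity of D attaches to rho. *)

Definition dot (R : realType) n (p v : 'rV[R]_n) : R :=
  \sum_i p 0 i * v 0 i.

(** The norm on row vectors is the sup norm. Quadratic terms use this Euclidean square, which is
    polynomial; passing between the two costs the dimension factors of [dot_le] and [sq_le]. *)
Definition sq (R : realType) n (x : 'rV[R]_n) : R := dot x x.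

Section Dot.
Variables (R : realType) (n : nat).
Implicit Types (p v w x y : 'rV[R]_n).

Lemma dotC p v : dot p v = dot v p.
Proof. by apply: eq_bigr => i _; rewrite mulrC. Qed.

Lemma dotDr p v w : dot p (v + w) = dot p v + dot p w.
Proof.
by rewrite -big_split; apply: eq_bigr => i _; rewrite mxE mulrDr.
Qed.

Lemma dotZr p a v : dot p (a *: v) = a * dot p v.
Proof. by rewrite mulr_sumr; apply: eq_bigr => i _; rewrite mxE mulrCA. Qed.

Lemma dotDl p v w : dot (v + w) p = dot v p + dot w p.
Proof. by rewrite !(dotC _ p) dotDr. Qed.

Lemma dotZl p a v : dot (a *: v) p = a * dot v p.
Proof. by rewrite !(dotC _ p) dotZr. Qed.

Lemma dotNr p v : dot p (- v) = - dot p v.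
Proof. by rewrite -scaleN1r dotZr mulN1r. Qed.

Lemma dotNl p v : dot (- v) p = - dot v p.
Proof. by rewrite !(dotC _ p) dotNr. Qed.

Lemma dotBr p v w : dot p (v - w) = dot p v - dot p w.
Proof. by rewrite dotDr dotNr. Qed.

Lemma dotBl p v w : dot (v - w) p = dot v p - dot w p.
Proof. by rewrite dotDl dotNl. Qed.

Lemma dot0r p : dot p 0 = 0.
Proof. by rewrite -(scale0r (0 : 'rV[R]_n)) dotZr mul0r. Qed.

Lemma dot_delta p i : dot p (delta_mx 0 i) = p 0 i.
Proof.
rewrite /dot (bigD1 i)//= mxE !eqxx mulr1 big1 ?addr0// => j ji.
by rewrite mxE (negPf ji) andbF mulr0.
Qed.

Lemma normr_coord x i : `|x 0 i| <= `|x|.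
Proof.
rewrite [leRHS]/Num.norm/= mx_normrE.
exact: (le_bigmax _ (fun ij : 'I_1 * 'I_n => `|x ij.1 ij.2|) (0, i)).
Qed.

Lemma rV_norm_le x (e : R) : 0 <= e -> (forall i, `|x 0 i| <= e) -> `|x| <= e.
Proof.
move=> e0 xe; rewrite [leLHS]/Num.norm/= mx_normrE; apply/bigmax_leP; split=> //.
by move=> [i j] _ /=; rewrite ord1.
Qed.

Lemma rV_norm_lt x (e : R) : 0 < e -> (forall i, `|x 0 i| < e) -> `|x| < e.
Proof.
move=> e0 xe; rewrite [ltLHS]/Num.norm/= mx_normrE; apply/bigmax_ltP; split=> //.
by move=> [i j] _ /=; rewrite ord1.
Qed.

Lemma dot_le p v : `|dot p v| <= n%:R * `|p| * `|v|.
Proof.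
apply: (le_trans (ler_norm_sum _ _ _)).
rewrite -mulrA mulr_natl -[X in _ *+ X]card_ord -sumr_const.
by apply: ler_sum => i _; rewrite normrM ler_pM ?normr_ge0 ?normr_coord.
Qed.

Lemma sq_ge0 x : 0 <= sq x.
Proof. by apply: sumr_ge0 => i _; rewrite -expr2 sqr_ge0. Qed.

Lemma normr_sq x : `|x| ^+ 2 <= sq x.
Proof.
have x0 := sq_ge0 x.
rewrite -[leRHS](sqr_sqrtr x0) ler_sqr ?nnegrE ?normr_ge0 ?sqrtr_ge0//.
apply: rV_norm_le => [|i]; first exact: sqrtr_ge0.
rewrite -ler_sqr ?nnegrE ?normr_ge0 ?sqrtr_ge0// sqr_sqrtr// real_normK ?num_real//.
rewrite /sq /dot (bigD1 i)//= -expr2 lerDl.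
by apply: sumr_ge0 => j _; rewrite -expr2 sqr_ge0.
Qed.

Lemma sq_le x : sq x <= n%:R * `|x| ^+ 2.
Proof. by rewrite expr2 mulrA (le_trans _ (dot_le x x))// ler_norm. Qed.

Lemma sqD x y : sq (x + y) = sq x + 2 * dot x y + sq y.
Proof. rewrite /sq dotDr !dotDl (dotC y x); ring. Qed.

Lemma sqZ a x : sq (a *: x) = a ^+ 2 * sq x.
Proof. by rewrite /sq dotZr dotZl mulrA expr2. Qed.

Lemma sqN x : sq (- x) = sq x.
Proof. by rewrite /sq dotNr dotNl opprK. Qed.

Lemma sqB x y : sq (x - y) = sq x - 2 * dot x y + sq y.
Proof. by rewrite sqD sqN dotNr mulrN. Qed.

Lemma sq0 : sq (0 : 'rV[R]_n) = 0.
Proof. exact: dot0r. Qed.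

(** An exact value rather than a bound; it dictates the shape [t * (1 - t) * sq (x - y)] of all the
    defect estimates below. *)
Lemma sq_avg (t : R) x y :
  (1 - t) * sq x + t * sq y - sq ((1 - t) *: x + t *: y) =
  t * (1 - t) * sq (x - y).
Proof. rewrite sqB sqD !sqZ dotZl dotZr; ring. Qed.

Lemma sq_eq0 x : sq x <= 0 -> x = 0.
Proof.
move=> x0; apply/eqP; rewrite -normr_eq0 -sqrf_eq0 eq_le sqr_ge0 andbT.
exact: le_trans (normr_sq x) x0.
Qed.

End Dot.

Section Topology.
Variable R : realType.

Lemma cts_cst (T U : topologicalType) (a : U) (x : T) :
  continuous_at x (fun=> a).
Proof. exact: cvg_cst. Qed.

Lemma cts_id (T : topologicalType) (x : T) : continuous_at x id.
Proof. exact: cvg_id. Qed.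

Lemma coord_cts m n (M : 'M[R]_(m, n)) i j :
  continuous_at M (fun M : 'M[R]_(m, n) => M i j).
Proof. exact: coord_continuous. Qed.

Lemma cts_sum (T : topologicalType) (V : normedModType R) (I : Type)
    (r : seq I) (F : I -> T -> V) x :
  (forall i, continuous_at x (F i)) ->
  continuous_at x (fun y => \sum_(i <- r) F i y).
Proof.
move=> cF; elim: r => [|i r IH].
  have -> : (fun y => \sum_(i <- [::]) F i y) = cst 0.
    by apply/funext => y; rewrite big_nil.
  exact: cvg_cst.
have -> : (fun y => \sum_(j <- i :: r) F j y) =
    (fun y => F i y + \sum_(j <- r) F j y).
  by apply/funext => y; rewrite big_cons.
by apply: cvgD; [exact: cF|exact: IH].
Qed.

Lemma cts_dot (T : topologicalType) n (f g : T -> 'rV[R]_n) x :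
  continuous_at x f -> continuous_at x g ->
  continuous_at x (fun y => dot (f y) (g y)).
Proof.
move=> cf cg; rewrite /dot.
apply: (@cts_sum _ R^o) => i; apply: cvgM.
- exact: (continuous_comp cf (@coord_cts _ _ (f x) 0 i)).
- exact: (continuous_comp cg (@coord_cts _ _ (g x) 0 i)).
Qed.

Lemma ctsP (V W : normedModType R) (f : V -> W) x :
  continuous_at x f <-> forall e, 0 < e -> exists2 d, 0 < d &
    forall y, `|y - x| < d -> `|f y - f x| < e.
Proof.
split=> [/cvgrPdist_lt cf e e0|cf].
  have /nbhs_ballP[d d0 H] := cf e e0.
  exists d => // y yx; rewrite distrC; apply: H.
  by rewrite -ball_normE /ball_/= distrC.
apply/cvgrPdist_lt => e /cf[d d0 H].
apply/nbhs_ballP; exists d => // y; rewrite -ball_normE /ball_/= => yx.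
by rewrite distrC; apply: H; rewrite distrC.
Qed.

Lemma openP (V : normedModType R) (A : set V) x : open A -> A x ->
  exists2 r, 0 < r & forall y, `|y - x| < r -> A y.
Proof.
move=> oA Ax; have /nbhs_ballP[r r0 H] := open_nbhs_nbhs (conj oA Ax).
exists r => // y yx; apply: H.
by rewrite -ball_normE /ball_/= distrC.
Qed.

Lemma nbhsPd (V : normedModType R) (A : set V) x : nbhs x A ->
  exists2 r, 0 < r & forall y, `|y - x| < r -> A y.
Proof.
move=> /nbhs_ballP[r r0 H].
exists r => // y yx; apply: H.
by rewrite -ball_normE /ball_/= distrC.
Qed.

Lemma nbhsdP (V : normedModType R) (A : set V) x r : 0 < r ->
  (forall y, `|y - x| < r -> A y) -> nbhs x A.
Proof.
move=> r0 H; apply/nbhs_ballP; exists r => // y.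
by rewrite -ball_normE /ball_/= distrC => /H.
Qed.

Lemma openPd (V : normedModType R) (A : set V) :
  (forall x, A x -> exists2 r, 0 < r & forall y, `|y - x| < r -> A y) -> open A.
Proof.
move=> H; rewrite openE => x /H[r r0 xr]; exact: nbhsdP r0 xr.
Qed.

Lemma near_eq_cts (T U : topologicalType) (f g : T -> U) x :
  (\forall y \near x, f y = g y) -> continuous_at x f -> continuous_at x g.
Proof.
move=> fg cf; have fgx : f x = g x by exact: nbhs_singleton fg.
rewrite /continuous_at -fgx; apply: cvg_trans cf; apply: near_eq_cvg.
by apply: filterS fg => y ->.
Qed.

Lemma within_eps (V W : normedModType R) (A : set V) (f : V -> W) :
  (forall x, A x -> forall e, 0 < e -> exists2 d, 0 < d &
    forall y, A y -> `|y - x| < d -> `|f y - f x| < e) ->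
  {within A, continuous f}.
Proof.
move=> H; apply/subspace_continuousP => x Ax; apply/cvgrPdist_lt => e e0.
have [d d0 K] := H x Ax e e0.
rewrite /prop_near1 /within/=; apply: (nbhsdP d0) => y yx Ay.
by rewrite distrC; exact: K.
Qed.

Lemma closed_le_norm (V : normedModType R) (x : V) r :
  closed [set y | `|y - x| <= r].
Proof.
have -> : [set y | `|y - x| <= r] = (fun y => `|y - x|) @^-1` [set z | z <= r].
  by [].
apply: preimage_closed; last exact: closed_le.
move=> y _.
apply: (@continuous_comp _ _ _ (fun y : V => y - x) (fun z => `|z|) y);
  last exact: norm_continuous.
exact: (@continuousB _ _ _ id (cst x) y cvg_id (cvg_cst _)).
Qed.

Lemma ball_avg (V : normedModType R) (z0 x y : V) (t r : R) :
  0 <= t <= 1 -> `|x - z0| < r -> `|y - z0| < r ->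
  `|(1 - t) *: x + t *: y - z0| < r.
Proof.
move=> /andP[t0 t1] xs ys.
have -> : (1 - t) *: x + t *: y - z0 = (1 - t) *: (x - z0) + t *: (y - z0).
  by rewrite !scalerBr addrACA -opprD -scalerDl addrNK scale1r.
rewrite (le_lt_trans (ler_normD _ _))// !normrZ.
rewrite (ger0_norm t0) ger0_norm ?subr_ge0//.
have [->|tn0] := eqVneq t 0; first by rewrite subr0 mul1r mul0r addr0.
have tp : 0 < t by rewrite lt_neqAle eq_sym tn0.
have : t * `|y - z0| < t * r by rewrite ltr_pM2l.
have : (1 - t) * `|x - z0| <= (1 - t) * r by rewrite ler_wpM2l ?subr_ge0// ltW.
by lra.
Qed.

Lemma closed_ge_norm (V : normedModType R) (x : V) r :
  closed [set y | r <= `|y - x|].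
Proof.
have -> : [set y | r <= `|y - x|] = (fun y => `|y - x|) @^-1` [set z | r <= z].
  by [].
apply: preimage_closed; last exact: closed_ge.
move=> y _.
apply: (@continuous_comp _ _ _ (fun y : V => y - x) (fun z => `|z|) y);
  last exact: norm_continuous.
exact: (@continuousB _ _ _ id (cst x) y cvg_id (cvg_cst _)).
Qed.

Lemma closed_ballP_compact n (x : 'rV[R]_n) r : compact [set y | `|y - x| <= r].
Proof.
apply: bounded_closed_compact.
  exists (r + `|x|); split; first exact: num_real.
  move=> M rM y /= yx; rewrite -[y](subrK x).
  by rewrite (le_trans (ler_normD _ _))// ltW// (le_lt_trans _ rM)// lerD2r.
exact: closed_le_norm.
Qed.

End Topology.

(** * Differential calculus *)

Section Calculus.
Variable R : realType.

Lemma CkW (V W : normedModType R) k (A : set V) (f : V -> W) x :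
  Ck k A f -> A x -> continuous_at x f.
Proof. by case: k => [|k] [cf _] Ax; exact: (cf x (mem_set Ax)). Qed.

Lemma CkS (V W : normedModType R) k (A : set V) (f : V -> W) :
  Ck k.+1 A f -> Ck k A f.
Proof.
elim: k f => [|k IH] f /= [cf Df]; split=> // v.
by have [df Dfv] := Df v; split=> //; exact: IH.
Qed.

Lemma Ck_derivable (V W : normedModType R) k (A : set V) (f : V -> W) x v :
  Ck k.+1 A f -> A x -> derivable f x v.
Proof. by move=> [_ /(_ v)[df _]] /df. Qed.

Lemma Ck_derive (V W : normedModType R) k (A : set V) (f : V -> W) v :
  Ck k.+1 A f -> Ck k A ('D_v f).
Proof. by move=> [_ /(_ v)[]]. Qed.

(** The difference quotients coincide as functions, so derivability and value transfer together; the
    pair serves as a rewriting rule. *)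
Lemma derive_lineE (V W : normedModType R) (f : V -> W) (x v : V) (s : R) :
  (derivable (fun t : R => f (x + t *: v)) s 1 = derivable f (x + s *: v) v) *
  ('D_1 (fun t : R => f (x + t *: v)) s = 'D_v f (x + s *: v)).
Proof.
have E : (fun h : R => h^-1 *: (((fun t : R => f (x + t *: v)) \o shift s)
     (h *: (1 : R)) - f (x + s *: v))) =
  (fun h : R => h^-1 *: ((f \o shift (x + s *: v)) (h *: v) - f (x + s *: v))).
  apply/funext => h /=; congr (_ *: (f _ - _)).
  by rewrite [_ *: 1]mulr1 scalerDl addrCA.
by split; rewrite /derivable /derive E.
Qed.

Lemma is_derive_line (V W : normedModType R) (f : V -> W) (x v : V) (s : R) :
  derivable f (x + s *: v) v ->
  is_derive s 1 (fun t : R => f (x + t *: v)) ('D_v f (x + s *: v)).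
Proof. by move=> df; split; rewrite derive_lineE. Qed.

Lemma is_derive_line0 (V W : normedModType R) (f : V -> W) (x v : V) :
  derivable f x v -> is_derive (0 : R) 1 (fun t : R => f (x + t *: v)) ('D_v f x).
Proof.
by move=> df; have := @is_derive_line _ _ f x v 0; rewrite scale0r addr0; apply.
Qed.

Lemma derive_scale (V : normedModType R) (f : V -> R) x v (a : R) :
  derivable f x v -> derivable f x (a *: v) /\ 'D_(a *: v) f x = a * 'D_v f x.
Proof.
move=> df.
have H : is_derive (0 : R) 1 ((fun t : R => f (x + t *: v)) \o ( *%R a))
    ('D_v f x * a).
  apply: is_derive1_comp; first by rewrite mulr0; exact: is_derive_line0.
  by apply: is_derive_eq; rewrite [LHS]mulr1.
have E : (fun t : R => f (x + t *: v)) \o ( *%R a) =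
    (fun t : R => f (x + t *: (a *: v))).
  by apply/funext => t /=; rewrite scalerA mulrC.
rewrite E in H; case: H.
by rewrite !derive_lineE !scale0r !addr0 mulrC.
Qed.

Lemma derive_eps (V W : normedModType R) (f : V -> W) x v :
  derivable f x v -> forall e, 0 < e -> exists2 d, 0 < d & forall h : R,
    `|h| < d -> `|f (x + h *: v) - f x - h *: 'D_v f x| <= e * `|h|.
Proof.
move=> df e e0.
have /cvgrPdist_le /(_ e e0) : (fun h => h^-1 *: ((f \o shift x) (h *: v) - f x))
    @ 0^' --> 'D_v f x by exact: df.
rewrite /dnbhs /within /prop_near1/= => /nbhsPd[d d0 H].
exists d => // h hd; have [->|h0] := eqVneq h 0.
  by rewrite !scale0r addr0 subrr subr0 !normr0 mulr0.
have /= := H h; rewrite subr0 => /(_ hd h0).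
have -> : f (x + h *: v) - f x - h *: 'D_v f x =
    - h *: ('D_v f x - h^-1 *: (f (h *: v + x) - f x)).
  rewrite scaleNr scalerBr opprB addrC scalerA divff// scale1r addrC.
  by rewrite (addrC x).
by rewrite normrZ normrN mulrC => K; rewrite ler_wpM2r.
Qed.

Lemma derive_epsR (V : normedModType R) (f : V -> R) x v :
  derivable f x v -> forall e, 0 < e -> exists2 d, 0 < d & forall h : R,
    `|h| < d -> `|f (x + h *: v) - f x - h * 'D_v f x| <= e * `|h|.
Proof. exact: derive_eps. Qed.

Lemma MVT_line (V : normedModType R) (f : V -> R) (x v : V) :
  (forall s, 0 <= s <= 1 -> derivable f (x + s *: v) v) ->
  exists2 s : R, 0 < s < 1 & f (x + v) - f x = 'D_v f (x + s *: v).
Proof.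
move=> df.
have [||c] := @MVT R (fun s => f (x + s *: v)) (fun s => 'D_v f (x + s *: v)) 0 1 ltr01.
- move=> s; rewrite in_itv/= => /andP[s0 s1].
  by apply: is_derive_line; apply: df; rewrite !ltW.
- apply: derivable_within_continuous => s; rewrite in_itv/= => s01.
  by have [] := is_derive_line (df s s01).
rewrite in_itv/= => c01; rewrite scale1r scale0r addr0 subr0 mulr1.
by exists c.
Qed.

(** [Ck] only speaks of directional derivatives, so additivity in the direction has to be derived.
    On the path x, x + h v, x + h v + h w, the second leg is handled by the mean value theorem and
    the continuity of ['D_w f]. *)
Lemma derive_add (V : normedModType R) (A : set V) (f : V -> R) x v w :
  open A -> Ck 1 A f -> A x -> 'D_(v + w) f x = 'D_v f x + 'D_w f x.
Proof.
move=> oA Cf Ax; apply/eqP; rewrite -subr_eq0 -normr_le0.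
apply/ler_addgt0Pl => e e0; rewrite addr0.
have e3 : 0 < e / 3 by rewrite divr_gt0.
have [d1 d10 H1] := derive_epsR (Ck_derivable (v:=v + w) Cf Ax) e3.
have [d2 d20 H2] := derive_epsR (Ck_derivable (v:=v) Cf Ax) e3.
have [d3 d30 H3] := (ctsP _ _).1 (CkW (Ck_derive w Cf) Ax) _ e3.
have [r r0 Ar] := openP oA Ax.
pose N := `|v| + `|w| + 1.
have N0 : 0 < N by rewrite /N; have := normr_ge0 v; have := normr_ge0 w; lra.
pose m : R := Num.min (Num.min d1 d2) (Num.min (d3 / N) (r / N)).
have m0 : 0 < m by rewrite !lt_min d10 d20 !divr_gt0.
have [h [h0 hm]] : exists h : R, 0 < h /\ h < m by exists (m / 2); lra.
have hn : `|h| = h by rewrite gtr0_norm.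
have hd : [/\ h < d1, h < d2, h * N < d3 & h * N < r].
  by move: hm; rewrite !lt_min => /andP[/andP[-> ->]] /andP[];
    rewrite -!ltr_pdivlMr.
have [hd1 hd2 hd3 hr] := hd.
have nr s : 0 <= s <= 1 -> `|(x + h *: v) + s *: (h *: w) - x| <= h * N.
  move=> /andP[s0 s1]; rewrite addrAC [x + _]addrC addrK.
  apply: (le_trans (ler_normD _ _)).
  rewrite !normrZ (ger0_norm s0).
  rewrite hn.
  rewrite mulrCA -mulrDr ler_pM2l// /N.
  have : s * `|w| <= `|w| by rewrite ler_piMl.
  by lra.
have [s /andP[s0 s1]] : exists2 s : R, 0 < s < 1 &
    f (x + h *: v + h *: w) - f (x + h *: v) =
    'D_(h *: w) f (x + h *: v + s *: (h *: w)).
  apply: MVT_line => s /nr K.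
  by apply: (derive_scale h _).1; apply: (Ck_derivable (v:=w) Cf); apply: Ar;
    exact: le_lt_trans K hr.
have {}nr := nr s; rewrite (ltW s0) (ltW s1) in nr; have {}nr := nr isT.
rewrite (derive_scale h _).2; last first.
  by apply: (Ck_derivable (v:=w) Cf); apply: Ar; exact: le_lt_trans nr hr.
have K3 := H3 _ (le_lt_trans nr hd3).
have := H1 h; have := H2 h; rewrite hn => /(_ hd2) K2 /(_ hd1) K1 K.
move: K1 K2 K3; rewrite scalerDr addrA.
set a := 'D_w f (x + _ + _) in K *; move: K.
set L := 'D_(v + w) f x; set Dv := 'D_v f x; set Dw := 'D_w f x.
move=> K.
move=> /ler_normlP[K1 K1'] /ler_normlP[K2 K2'] /ltr_normlP[K3 K3'].
have Ka : h * (- (e / 3)) <= h * (a - Dw) by rewrite ler_pM2l//; lra.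
have Kb : h * (a - Dw) <= h * (e / 3) by rewrite ler_pM2l//; lra.
rewrite -(ler_pM2l h0) -[X in X * _](gtr0_norm h0) -normrM.
by apply/ler_normlP; split; lra.
Qed.

End Calculus.

Section Calculus2.
Variable R : realType.

Lemma compact_bound (T : topologicalType) (K : set T) (f : T -> R) :
  compact K -> (forall x, K x -> continuous_at x f) ->
  exists2 M, 0 <= M & forall x, K x -> `|f x| <= M.
Proof.
move=> cK cf; have [->|/set0P K0] := eqVneq K set0; first by exists 0.
have [|c _ H] := @compact_EVT_max _ R (fun x => `|f x|) K K0 cK.
  apply: continuous_in_subspaceT => x /set_mem Kx.
  by apply: continuous_comp; [exact: cf|exact: norm_continuous].
by exists `|f c| => // x Kx; apply: H; exact: mem_set.
Qed.

Lemma derive_lin (V : normedModType R) (A : set V) (f : V -> R) x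
    (I : Type) (r : seq I) (a : I -> R) (b : I -> V) :
  open A -> Ck 1 A f -> A x ->
  'D_(\sum_(i <- r) a i *: b i) f x = \sum_(i <- r) a i * 'D_(b i) f x.
Proof.
move=> oA Cf Ax; elim: r => [|i r IH]; first by rewrite !big_nil derive0.
rewrite !big_cons (derive_add _ _ oA Cf Ax) IH; congr (_ + _).
exact: (derive_scale _ (Ck_derivable Cf Ax)).2.
Qed.

(** Abstract, so that the derivative bounds apply to row vectors and to pairs (position, velocity)
    alike. *)
Definition basis_of_normed (V : normedModType R) N (b : 'I_N -> V)
    (k : 'I_N -> V -> R) :=
  forall w, w = \sum_(i < N) k i w *: b i /\ forall i, `|k i w| <= `|w|.

Lemma grad_bound (V : normedModType R) N (b : 'I_N -> V) k (A K : set V)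
    (f : V -> R) :
  basis_of_normed b k -> open A -> Ck 1 A f -> compact K -> K `<=` A ->
  exists2 M, 0 <= M & forall x w, K x -> `|'D_w f x| <= M * `|w|.
Proof.
move=> bk oA Cf cK KA.
have /choice[M HM] : forall i, exists M, 0 <= M /\
    forall x, K x -> `|'D_(b i) f x| <= M.
  move=> i; have [|M M0 HM] := @compact_bound _ K ('D_(b i) f) cK.
    by move=> x /KA; apply: CkW; exact: Ck_derive Cf.
  by exists M.
exists (\sum_i M i).
  by apply: sumr_ge0 => i _; case: (HM i).
move=> x w Kx; rewrite {1}(bk w).1 (derive_lin _ _ _ oA Cf (KA _ Kx)).
apply: (le_trans (ler_norm_sum _ _ _)); rewrite mulr_suml.
apply: ler_sum => i _; rewrite normrM mulrC ler_pM ?normr_ge0//.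
  by case: (HM i) => _; apply.
exact: (bk w).2.
Qed.

Lemma hess_bound (V : normedModType R) N (b : 'I_N -> V) k (A K : set V)
    (f : V -> R) :
  basis_of_normed b k -> open A -> Ck 2 A f -> compact K -> K `<=` A ->
  exists2 M, 0 <= M &
    forall x w, K x -> `|'D_w ('D_w f) x| <= M * `|w| ^+ 2.
Proof.
move=> bk oA Cf cK KA.
have /choice[M HM] : forall i, exists M, 0 <= M /\
    forall x w, K x -> `|'D_w ('D_(b i) f) x| <= M * `|w|.
  by move=> i; have [M M0 HM] := grad_bound bk oA (Ck_derive (b i) Cf) cK KA;
    exists M.
exists (\sum_i M i).
  by apply: sumr_ge0 => i _; case: (HM i).
move=> x w Kx.
have -> : 'D_w ('D_w f) x =
    'D_w (\sum_i (fun y => k i w * 'D_(b i) f y)) x.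
  apply: near_eq_derive.
  have : \forall y \near x, A y by apply: open_nbhs_nbhs; split => //; exact: KA.
  apply: filterS => y Ay.
  rewrite {1}(bk w).1 (derive_lin _ _ _ oA (CkS Cf) Ay).
  by rewrite fct_sumE.
have dD i : derivable ('D_(b i) f) x w.
  exact: Ck_derivable (Ck_derive (b i) Cf) (KA _ Kx).
rewrite derive_sum; last by move=> i; exact: derivableZ.
apply: (le_trans (ler_norm_sum _ _ _)); rewrite mulr_suml.
apply: ler_sum => i _; rewrite (@deriveZ _ _ R^o)//.
rewrite normrM mulrC expr2 mulrA ler_pM ?normr_ge0//.
  by case: (HM i) => _; apply.
exact: (bk w).2.
Qed.

(** The mean value theorem is applied on both sides of [t], then to the first derivative between the
    two intermediate points. *)
Lemma taylor2 (V : normedModType R) (A : set V) (f : V -> R) X w M t :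
  Ck 2 A f -> (forall s : R, 0 <= s <= 1 -> A (X + s *: w)) ->
  (forall s : R, 0 <= s <= 1 -> `|'D_w ('D_w f) (X + s *: w)| <= M) ->
  0 <= t <= 1 ->
  `|(1 - t) * f X + t * f (X + w) - f (X + t *: w)| <= t * (1 - t) * M.
Proof.
move=> Cf XA HM /andP[t0 t1].
pose phi (s : R) : R := f (X + s *: w).
pose dphi (s : R) : R := 'D_w f (X + s *: w).
have d1 (s : R) : 0 <= s <= 1 -> is_derive s 1 phi (dphi s).
  by move=> /XA As; apply: is_derive_line; exact: Ck_derivable Cf As.
have d2 (s : R) : 0 <= s <= 1 -> is_derive s 1 dphi ('D_w ('D_w f) (X + s *: w)).
  move=> /XA As; apply: is_derive_line.
  exact: Ck_derivable (Ck_derive w Cf) As.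
have mvt (g dg : R -> R) (a b : R) : 0 <= a -> a <= b -> b <= 1 ->
    (forall s : R, 0 <= s <= 1 -> is_derive s 1 g (dg s)) ->
    exists2 c, a <= c <= b & g b - g a = dg c * (b - a).
  move=> a0 ab b1 dg'.
  have sub (s : R) : a <= s <= b -> 0 <= s <= 1.
    by move=> /andP[sa sb]; rewrite (le_trans a0)//= (le_trans sb).
  have [||c] := @MVT_segment R g dg a b ab.
  - by move=> s; rewrite in_itv/= => /andP[sa sb]; apply/dg'/sub; rewrite !ltW.
  - apply: derivable_within_continuous => s; rewrite in_itv/= => /sub/dg'.
    by case.
  by rewrite in_itv/= => cab cE; exists c.
have [x1 /andP[x1t x11] E1] := mvt phi dphi t 1 t0 t1 (lexx _) d1.
have [x0 /andP[x00 x0t] E0] := mvt phi dphi 0 t (lexx _) t0 t1 d1.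
have [z /andP[z0 z1] Ez] := mvt dphi _ x0 x1 x00 (le_trans x0t x1t) x11 d2.
have -> : (1 - t) * f X + t * f (X + w) - f (X + t *: w) =
    t * (1 - t) * ((x1 - x0) * 'D_w ('D_w f) (X + z *: w)).
  have {}E1 : f (X + w) = phi t + dphi x1 * (1 - t).
    by rewrite -E1 [RHS]addrC subrK /phi scale1r.
  have {}E0 : f X = phi t - dphi x0 * (t - 0).
    by rewrite -E0 /phi scale0r addr0; ring.
  rewrite E1 E0 -/(phi t) [(x1 - x0) * _]mulrC -Ez; ring.
have z01 : 0 <= z <= 1 by rewrite (le_trans x00 z0) (le_trans z1 x11).
have tt : 0 <= t * (1 - t) by rewrite mulr_ge0 ?subr_ge0.
rewrite normrM (ger0_norm tt) ler_wpM2l// normrM.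
have M0 := le_trans (normr_ge0 _) (HM _ z01).
rewrite -[leRHS]mul1r ler_pM ?HM// ger0_norm; lra.
Qed.

Lemma coordP n k (f : 'rV[R]_n -> 'rV[R]_k) x v j :
  derivable f x v -> derivable (fun y => f y 0 j) x v /\
  'D_v (fun y => f y 0 j) x = ('D_v f x) 0 j.
Proof.
move=> df; split; first by have /derivable_mxP := df; apply.
by rewrite derive_mx// mxE.
Qed.

Lemma near_eq_Ck (V W : normedModType R) k (A : set V) (f g : V -> W) :
  open A -> (forall x, A x -> f x = g x) -> Ck k A f -> Ck k A g.
Proof.
move=> oA; have nA x : A x -> \forall y \near x, A y.
  by move=> Ax; exact: open_nbhs_nbhs.
elim: k f g => [|k IH] f g fg [cf Df].
  split=> // x /set_mem Ax; apply: near_eq_cts (cf x (mem_set Ax)).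
  by apply: filterS (nA x Ax) => y /fg.
split.
  move=> x /set_mem Ax; apply: near_eq_cts (cf x (mem_set Ax)).
  by apply: filterS (nA x Ax) => y /fg.
move=> v; have [df Cf] := Df v; split.
  move=> x Ax; apply: near_eq_derivable (df x Ax).
  by apply: filterS (nA x Ax) => y /fg.
apply: IH Cf => x Ax; apply: near_eq_derive.
by apply: filterS (nA x Ax) => y /fg.
Qed.

Lemma Ck_coord n k l (A : set 'rV[R]_n) (f : 'rV[R]_n -> 'rV[R]_k) j :
  open A -> Ck l A f -> Ck l A (fun y => f y 0 j).
Proof.
move=> oA; have cc (g : 'rV[R]_n -> 'rV[R]_k) : {in A, continuous g} ->
    {in A, continuous (fun y => g y 0 j)}.
  move=> cg x /cg cx.
  exact: (continuous_comp cx (@coord_cts _ _ _ (g x) 0 j)).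
elim: l f => [|l IH] f [cf Df]; first by split=> //; exact: cc.
split; first exact: cc.
move=> v; have [df Cf] := Df v; split.
  by move=> x Ax; exact: (coordP j (df x Ax)).1.
apply: (near_eq_Ck oA) (IH _ Cf) => x Ax.
by rewrite (coordP j (df x Ax)).2.
Qed.

Lemma row_basis n : @basis_of_normed 'rV[R]_n n (fun i => delta_mx 0 i)
  (fun i w => w 0 i).
Proof. by move=> w; split=> [|i]; [exact: row_sum_delta|exact: normr_coord]. Qed.

End Calculus2.

(** * Strict differentiability and C^1 curves in coordinates *)

Section Differentiability.
Variable R : realType.

Lemma dot_is_linear n (p : 'rV[R]_n) : linear (dot p : 'rV[R]_n -> R).
Proof. by move=> a u v; rewrite dotDr dotZr. Qed.

HB.instance Definition _ n (p : 'rV[R]_n) :=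
  GRing.isLinear.Build R 'rV[R]_n R _ (dot p) (@dot_is_linear n p).

Lemma dot_continuous n (p : 'rV[R]_n) : continuous (dot p).
Proof. by move=> v; apply: cts_dot; [exact: cts_cst|exact: cts_id]. Qed.

Lemma differentiable_dot n (f : 'rV[R]_n -> R) x p :
  (forall e, 0 < e -> exists2 d, 0 < d & forall y, `|y - x| < d ->
    `|f y - f x - dot p (y - x)| <= e * `|y - x|) ->
  differentiable f x /\ forall v, 'd f x v = dot p v.
Proof.
move=> H.
pose L : {linear 'rV[R]_n -> R} := dot p.
have K e : 0 < e -> \forall h \near (0 : 'rV[R]_n),
    `|f (h + x) - (f x + dot p h)| <= e * `|h|.
  move=> e0; have [d d0 K] := H e e0.
  apply: (nbhsdP d0) => h; rewrite subr0 => hd.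
  by have := K (h + x); rewrite addrK opprD addrA; apply.
have H2 : 'd f x = dot p :> ('rV[R]_n -> R).
  apply: (@diff_unique R 'rV[R]_n R f L x (@dot_continuous n p)).
  by apply/eqaddoP => e /K.
split; last by move=> v; rewrite H2.
apply/diff_locallyP; rewrite H2; split; first exact: dot_continuous.
by apply/eqaddoP => e /K.
Qed.

Lemma linear_dot n (l : {linear 'rV[R]_n -> R}) :
  exists p, forall v, l v = dot p v.
Proof.
exists (\row_i l (delta_mx 0 i)) => v.
rewrite [in LHS](row_sum_delta v) linear_sum; apply: eq_bigr => i _.
by rewrite linearZ mxE mulrC.
Qed.

Lemma differentiable_eps n (f : 'rV[R]_n -> R) x : differentiable f x ->
  exists p, forall e, 0 < e -> exists2 d, 0 < d & forall y, `|y - x| < d ->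
    `|f y - f x - dot p (y - x)| <= e * `|y - x|.
Proof.
move=> df; have [p pE] := linear_dot ('d f x); exists p => e e0.
have /diff_locally/eqaddoP/(_ e e0)/nbhsPd[d d0 K] := df.
exists d => // y yx; have := K (y - x); rewrite subr0 => /(_ yx).
by rewrite !fctE /= subrK pE opprD addrA.
Qed.

(** Strict differentiability: both points move. This two-point form is what combines with Lipschitz
    estimates when coordinates are changed. *)
Lemma Ck1_strictR n (f : 'rV[R]_n -> R) A x :
  open A -> Ck 1 A f -> A x -> exists p, forall e, 0 < e ->
    exists2 d, 0 < d & forall y z, `|y - x| < d -> `|z - x| < d ->
    `|f z - f y - dot p (z - y)| <= e * `|z - y|.
Proof.
move=> oA Cf Ax; exists (\row_i 'D_(delta_mx 0 i) f x).
move=> e e0; have [r r0 Ar] := openP oA Ax.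
have n0 : 0 < n%:R + 1 :> R by rewrite ltr_wpDl.
have e1 : 0 < e / (n%:R + 1) by rewrite divr_gt0.
have /choice[d Hd] : forall i, exists d, 0 < d /\ forall y, `|y - x| < d ->
    `|'D_(delta_mx 0 i) f y - 'D_(delta_mx 0 i) f x| < e / (n%:R + 1).
  move=> i; have [d d0 H] := (ctsP _ _).1 (CkW (Ck_derive (delta_mx 0 i) Cf) Ax) _ e1.
  by exists d.
pose m : R := \big[Num.min/r]_i d i.
have m0 : 0 < m by apply/bigmin_gtP; split=> // i _; case: (Hd i).
exists m => // y z yx zx.
have ms s : 0 <= s <= 1 -> `|y + s *: (z - y) - x| < m.
  move=> s01; have -> : y + s *: (z - y) = (1 - s) *: y + s *: z.
    by apply/rowP => j; rewrite !mxE; ring.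
  exact: ball_avg.
have Am w : `|w - x| < m -> A w.
  by move=> wm; apply: Ar; rewrite (lt_le_trans wm)// bigmin_le_id.
have [s /andP[s0 s1]] : exists2 s : R, 0 < s < 1 &
    f (y + (z - y)) - f y = 'D_(z - y) f (y + s *: (z - y)).
  by apply: MVT_line => s /ms/Am As; exact: Ck_derivable Cf As.
have -> : y + (z - y) = z by rewrite addrC subrK.
move=> ->.
have s01 : 0 <= s <= 1 by rewrite !ltW.
rewrite {2}(row_sum_delta (z - y)) (derive_lin _ _ _ oA Cf (Am _ (ms _ s01))).
rewrite /dot -sumrB.
apply: (le_trans (ler_norm_sum _ _ _)).
have -> : e * `|z - y| = (n%:R + 1) * (e / (n%:R + 1) * `|z - y|).
  by field; rewrite gt_eqF.
rewrite mulrDl (le_trans (y := n%:R * (e / (n%:R + 1) * `|z - y|)))//; last first.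
  by rewrite lerDl mul1r mulr_ge0// ltW.
rewrite mulr_natl -[X in _ *+ X]card_ord -sumr_const.
apply: ler_sum => i _; rewrite [(\row_i _) 0 i]mxE mulrC -mulrBl.
rewrite normrM ler_pM ?normr_ge0 ?normr_coord//.
apply/ltW; case: (Hd i) => _; apply.
by rewrite (lt_le_trans (ms _ s01))//; exact: bigmin_le.
Qed.

Lemma Ck1_differentiableR n (f : 'rV[R]_n -> R) A x :
  open A -> Ck 1 A f -> A x -> differentiable f x.
Proof.
move=> oA Cf Ax; have [p Hp] := Ck1_strictR oA Cf Ax.
suff H : forall e, 0 < e -> exists2 d, 0 < d & forall y, `|y - x| < d ->
    `|f y - f x - dot p (y - x)| <= e * `|y - x| by case: (differentiable_dot H).
move=> e /Hp[d d0 H]; exists d => // y; apply: H.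
by rewrite subrr normr0.
Qed.

Lemma rowfunE n k (f : 'rV[R]_n -> 'rV[R]_k) :
  f = \sum_j (fun y => f y 0 j *: delta_mx 0 j).
Proof.
by apply/funext => y; rewrite fct_sumE [LHS]row_sum_delta.
Qed.

Lemma Ck1_differentiable n k (f : 'rV[R]_n -> 'rV[R]_k) A x :
  open A -> Ck 1 A f -> A x -> differentiable f x.
Proof.
move=> oA Cf Ax; rewrite [f]rowfunE; apply: differentiable_sum => j.
apply: (differentiableZl (k := fun y => f y 0 j)).
exact: (Ck1_differentiableR oA (Ck_coord j oA Cf) Ax).
Qed.

(** A pointwise version of [Ck 1] for curves, which avoids carrying open domains through
    compositions; [Ck1_curveP] is the equivalence. *)
Definition C1at (W : normedModType R) (g : R -> W) t :=
  (\forall s \near t, derivable g s 1) /\ continuous_at t ('D_1 g).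

Lemma C1at_derivable (W : normedModType R) (g : R -> W) t :
  C1at g t -> derivable g t 1.
Proof. by move=> [/nbhs_singleton]. Qed.

Lemma C1at_near (W : normedModType R) (f g : R -> W) t :
  (\forall s \near t, f s = g s) -> C1at f t -> C1at g t /\ 'D_1 f t = 'D_1 g t.
Proof.
move=> fg [df cf]; have /nbhs_interior fg' := fg.
split; last exact: near_eq_derive.
split.
  by apply: filterS2 df fg' => s ds fgs; exact: near_eq_derivable ds.
apply: near_eq_cts cf; apply: filterS fg' => s fgs; exact: near_eq_derive.
Qed.

Lemma derive_curve (W : normedModType R) (g : R -> W) t v :
  derivable g t 1 -> derivable g t v /\ 'D_v g t = v *: 'D_1 g t.
Proof.
move=> dg; have dg' := (derivable1_diffP _ _).1 dg.
split; first exact: diff_derivable.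
by rewrite deriveE// deriv1E// derive1E.
Qed.

Lemma Ck1_curveP (W : normedModType R) (O : set R) (g : R -> W) :
  open O -> Ck 1 O g <-> forall t, O t -> C1at g t.
Proof.
move=> oO; split=> [[cg Dg] t Ot|H].
  have [dg [cDg _]] := Dg 1; split; last exact: cDg (mem_set Ot).
  by have := open_nbhs_nbhs (conj oO Ot); apply: filterS.
split.
  move=> t /set_mem/H/C1at_derivable/derivable1_diffP.
  exact: differentiable_continuous.
move=> v; split=> [t /H/C1at_derivable dg|]; first by have [] := derive_curve v dg.
split=> // t /set_mem Ot; have [ng cg] := H t Ot.
apply: (@near_eq_cts _ _ (fun s => v *: 'D_1 g s)).
  by apply: filterS ng => s ds; rewrite (derive_curve v ds).2.
by apply: cvgZr.
Qed.

Lemma derive_comp_curve n (W : normedModType R) (f : 'rV[R]_n -> W) (g : R -> 'rV[R]_n) t :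
  derivable g t 1 -> differentiable f (g t) ->
  derivable (f \o g) t 1 /\ 'D_1 (f \o g) t = 'd f (g t) ('D_1 g t).
Proof.
move=> /derivable1_diffP dg df.
have dfg : differentiable (f \o g) t by exact: differentiable_comp.
split; first exact/derivable1_diffP.
by rewrite [LHS]deriveE// [in RHS]deriveE// diff_comp.
Qed.

Lemma C1at_comp_diff n (W : normedModType R) (f : 'rV[R]_n -> W) A (g : R -> 'rV[R]_n) t :
  open A -> Ck 1 A f -> (forall x, A x -> differentiable f x) ->
  A (g t) -> C1at g t ->
  C1at (f \o g) t /\ 'D_1 (f \o g) t = 'D_('D_1 g t) f (g t).
Proof.
move=> oA Cf dfA Agt Cg; have dg := C1at_derivable Cg; have [ng cg] := Cg.
have DE s : derivable g s 1 -> A (g s) ->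
    derivable (f \o g) s 1 /\ 'D_1 (f \o g) s = 'D_('D_1 g s) f (g s).
  move=> ds As; have [d1 d2] := derive_comp_curve ds (dfA _ As).
  by split=> //; rewrite d2 (deriveE _ (dfA _ As)).
split; last exact: (DE t dg Agt).2.
have gc : continuous_at t g.
  by apply: differentiable_continuous; exact/derivable1_diffP.
have nA : \forall s \near t, A (g s).
  by apply: gc; exact: open_nbhs_nbhs.
split; first by apply: filterS2 ng nA => s ds /(DE s ds)[].
apply: (@near_eq_cts _ _ (fun s => \sum_i 'D_1 g s 0 i *: 'D_(delta_mx 0 i) f (g s))).
  apply: filterS2 ng nA => s ds As.
  rewrite (DE s ds As).2 (deriveE _ (dfA _ As)) [in RHS](row_sum_delta ('D_1 g s)).
  rewrite linear_sum; apply: eq_bigr => i _.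
  by rewrite linearZ -(deriveE _ (dfA _ As)).
apply: cts_sum => i; apply: cvgZ.
  exact: (continuous_comp cg (@coord_cts _ _ _ ('D_1 g t) 0 i)).
apply: (continuous_comp gc (g := 'D_(delta_mx 0 i) f)).
exact: CkW (Ck_derive _ Cf) Agt.
Qed.

Lemma C1at_comp n k (f : 'rV[R]_n -> 'rV[R]_k) A (g : R -> 'rV[R]_n) t :
  open A -> Ck 1 A f -> A (g t) -> C1at g t ->
  C1at (f \o g) t /\ 'D_1 (f \o g) t = 'D_('D_1 g t) f (g t).
Proof.
move=> oA Cf; apply: C1at_comp_diff (Cf) _ => // x; exact: Ck1_differentiable.
Qed.

Lemma C1at_compR n (f : 'rV[R]_n -> R) A (g : R -> 'rV[R]_n) t :
  open A -> Ck 1 A f -> A (g t) -> C1at g t ->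
  C1at (f \o g) t /\ 'D_1 (f \o g) t = 'D_('D_1 g t) f (g t).
Proof.
move=> oA Cf; apply: C1at_comp_diff (Cf) _ => // x; exact: Ck1_differentiableR.
Qed.

End Differentiability.

(** * Orthonormal families, complements and matrix norms *)

Section LinearAlgebra.
Variable R : realType.

Lemma mulmx_tr n (x y : 'rV[R]_n) : x *m y^T = (dot x y)%:M.
Proof.
apply/matrixP => i j; rewrite !ord1 !mxE mulr1n; apply: eq_bigr => l _.
by rewrite mxE.
Qed.

(** Gram-Schmidt by induction: normalize a nonzero row [b] and continue in [U :&: kermx b^T], whose
    rank is smaller by at most one. *)
Lemma orthonormal_rows r n q (U : 'M[R]_(q, n)) : (r <= \rank U)%N ->
  exists B : 'M[R]_(r, n), B *m B^T = 1%:M /\ (B <= U)%MS.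
Proof.
elim: r q U => [|r IH] q U rU.
  by exists 0; split; [rewrite [LHS]flatmx0 [RHS]flatmx0|exact: sub0mx].
pose v := nz_row U.
have v0 : v != 0.
  by rewrite nz_row_eq0 -mxrank_eq0 -lt0n (leq_trans _ rU).
have sv : 0 < sq v.
  by rewrite lt_neqAle sq_ge0 andbT eq_sym; apply: contraNneq v0 => sv;
    apply/eqP/sq_eq0; rewrite sv.
pose b := (Num.sqrt (sq v))^-1 *: v.
have bb : b *m b^T = 1%:M.
  rewrite mulmx_tr -/(sq b) sqZ exprVn sqr_sqrtr ?sq_ge0// mulVf//.
  by rewrite gt_eqF.
have bU : (b <= U)%MS by rewrite scalemx_sub// nz_row_sub.
have [|B [BB BU]] := IH _ (U :&: kermx b^T)%MS.
  have := mxrank_sum_cap U (kermx b^T).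
  have := rank_leq_col (U + kermx b^T)%MS.
  have := mxrank_ker b^T; have := rank_leq_col b^T.
  move: rU; move: (\rank U) (\rank b^T) (\rank (kermx b^T)).
  move: (\rank (U + kermx b^T)%MS) (\rank (U :&: kermx b^T)%MS); lia.
exists (col_mx b B); rewrite -[r.+1]/(1 + r)%N; split; last first.
  by rewrite col_mx_sub bU (submx_trans BU (capmxSl _ _)).
have Bb : B *m b^T = 0 by apply/sub_kermxP; exact: submx_trans BU (capmxSr _ _).
rewrite tr_col_mx mul_col_row bb BB Bb.
have -> : b *m B^T = 0 by rewrite -[LHS]trmxK trmx_mul trmxK Bb trmx0.
by rewrite -scalar_mx_block.
Qed.

(** Splits a vector into a horizontal part along [B], an orthonormal basis of the complement of the
    rows of [E], and a vertical part along [E]. [B^T] and the pseudo-inverse [Ep] read off the two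
    sets of coordinates. *)
Lemma complement_basis d k (E : 'M[R]_(k, d + k)) : row_free E ->
  exists (B : 'M[R]_(d, d + k)) (Ep : 'M[R]_(d + k, k)),
    [/\ B *m B^T = 1%:M, B *m Ep = 0, E *m B^T = 0, E *m Ep = 1%:M &
        B^T *m B + Ep *m E = 1%:M].
Proof.
move=> rE.
have [|B [BB BE]] := @orthonormal_rows d _ _ (kermx E^T).
  rewrite mxrank_ker mxrank_tr; move/eqP: rE => ->; lia.
have BE0 : B *m E^T = 0 by exact/sub_kermxP.
have EB0 : E *m B^T = 0 by rewrite -[LHS]trmxK trmx_mul trmxK BE0 trmx0.
have uE : E *m E^T \in unitmx.
  rewrite -row_free_unit; apply: inj_row_free => v vE.
  have : sq (v *m E) <= 0.
    have -> : sq (v *m E) = ((v *m E) *m (v *m E)^T) 0 0.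
      by rewrite mulmx_tr mxE mulr1n.
    by rewrite trmx_mul mulmxA -(mulmxA v) vE mul0mx mxE.
  move=> /sq_eq0 vE0; apply: (row_free_inj rE).
  by rewrite vE0 mul0mx.
pose Ep := E^T *m invmx (E *m E^T).
have BEp : B *m Ep = 0 by rewrite mulmxA BE0 mul0mx.
have EEp : E *m Ep = 1%:M by rewrite mulmxA mulmxV.
exists B, Ep; split=> //.
rewrite -mul_row_col; apply: mulmx1C.
by rewrite mul_col_row BB BEp EB0 EEp -scalar_mx_block.
Qed.

Lemma mulmx_bound n k (A : 'M[R]_(n, k)) :
  exists2 K, 0 < K & forall v : 'rV[R]_n, `|v *m A| <= K * `|v|.
Proof.
pose K := \sum_j \sum_i `|A i j|.
have K0 : 0 <= K by apply: sumr_ge0 => j _; apply: sumr_ge0.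
exists (K + 1); first by rewrite ltr_wpDl.
move=> v; apply: (le_trans (y := K * `|v|)); last first.
  by rewrite ler_wpM2r// lerDl.
apply: rV_norm_le => [|j]; first by rewrite mulr_ge0.
rewrite mxE (le_trans (ler_norm_sum _ _ _))//.
rewrite /K (bigD1 j)//= mulrDl.
rewrite ler_wpDr//.
  by rewrite mulr_ge0//; apply: sumr_ge0 => l _; apply: sumr_ge0.
rewrite mulr_suml; apply: ler_sum => i _.
by rewrite normrM mulrC ler_wpM2l ?normr_coord.
Qed.

Lemma euclid_normE n (x : 'rV[R]_n) : euclid_norm x = Num.sqrt (sq x).
Proof. by congr (Num.sqrt _); apply: eq_bigr => i _; rewrite expr2. Qed.

Lemma normr_euclid n (x : 'rV[R]_n) : `|x| <= euclid_norm x.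
Proof.
rewrite euclid_normE -[leLHS](ger0_norm (normr_ge0 x)) -sqrtr_sqr.
by rewrite ler_sqrt ?sq_ge0 ?normr_sq.
Qed.

Lemma euclid_normr n (x : 'rV[R]_n) : euclid_norm x <= n.+1%:R * `|x|.
Proof.
have nx : 0 <= n.+1%:R * `|x| by rewrite mulr_ge0.
rewrite euclid_normE -[leRHS](ger0_norm nx) -sqrtr_sqr ler_sqrt ?sqr_ge0//.
rewrite (le_trans (sq_le x))// exprMn ler_wpM2r ?sqr_ge0// -natrX ler_nat.
by rewrite (leq_trans (leqnSn n))// leq_pmulr.
Qed.

End LinearAlgebra.

(** * Level sets of semiconcave functions *)

Definition dc_at (R : realType) (m d : nat) (S : set 'rV[R]_m) (p : 'rV[R]_m) :=
  exists (U : set 'rV[R]_m) (P : affine_subspace R d m),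
    let W := affine_isom P @^-1` (affine_proj P @` (S `&` U)) in
    [/\ open U, U p, open W, bilipschitz_on (S `&` U) (affine_proj P) &
        exists2 h : 'rV[R]_d -> 'rV[R]_m, DC_map W h &
          forall x, W x -> (S `&` U) (h x) /\
            affine_proj P (h x) = affine_isom P x].

(** Compactness replaces iteration: if y minimizes |y - T y| and is not fixed, then T y does
    strictly better. *)
Lemma contraction_fixpoint (R : realType) k (T : 'rV[R]_k -> 'rV[R]_k) (r q : R) :
  0 <= r -> 0 <= q < 1 -> (forall y, `|y| <= r -> `|T y| <= r) ->
  (forall y y', `|y| <= r -> `|y'| <= r -> `|T y - T y'| <= q * `|y - y'|) ->
  exists2 y, `|y| <= r & T y = y.
Proof.
move=> r0 /andP[q0 q1] Tr Tq.
pose K := [set y : 'rV[R]_k | `|y - 0| <= r].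
have K0 : K !=set0 by exists 0; rewrite /K /= subrr normr0.
pose g (y : 'rV[R]_k) : R := `|y - T y|.
have cg : {within K, continuous g}.
  apply: within_eps => y; rewrite /K/= subr0 => yr e e0.
  exists (e / 2); first by rewrite divr_gt0.
  move=> z; rewrite subr0 => zr zy.
  rewrite /g (le_lt_trans (ler_dist_dist _ _))//.
  have -> : z - T z - (y - T y) = (z - y) - (T z - T y).
    by rewrite !opprB addrACA [in RHS]addrACA; congr (_ + _); rewrite addrC.
  rewrite (le_lt_trans (ler_normB _ _))//.
  have := Tq _ _ zr yr; have := normr_ge0 (z - y); nra.
have [y /set_mem /= + ymin] := compact_EVT_min K0 (@closed_ballP_compact _ _ 0 r) cg.
rewrite /K /= subr0 => yr; exists y => //.
apply/eqP; rewrite eq_sym -subr_eq0 -normr_eq0 eq_le normr_ge0 andbT leNgt.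
apply/negP => y0; have := ymin (T y); rewrite inE/K/= subr0 => /(_ (Tr _ yr)).
apply/negP; rewrite -ltNge (le_lt_trans (Tq _ _ yr (Tr _ yr)))//.
by rewrite gtr_pMl.
Qed.

Section DCLevelSet.
Variables (R : realType) (d k : nat).
Notation m := (d + k)%N.
Variables (f : 'I_k.+1 -> 'rV[R]_m -> R) (z0 : 'rV[R]_m) (r C Lp th : R).
Variables (E : 'M[R]_(k, m)) (p : 'I_k.+1 -> 'rV[R]_m) (S : set 'rV[R]_m).
Hypotheses (r0 : 0 < r) (C0 : 0 <= C) (Lp0 : 0 <= Lp) (th0 : 0 <= th).
Hypothesis f_sc : forall i x y t, `|x - z0| < r -> `|y - z0| < r ->
  0 <= t <= 1 -> (1 - t) * f i x + t * f i y - f i ((1 - t) *: x + t *: y) <=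
  C * (t * (1 - t) * sq (x - y)).
Hypothesis f_lip : forall i x y, `|x - z0| < r -> `|y - z0| < r ->
  `|f i x - f i y| <= Lp * `|x - y|.
Hypothesis f_vert : forall i x (y : 'rV[R]_k), `|x - z0| < r ->
  `|x + y *m E - z0| < r ->
  `|f i (x + y *m E) - f i x - dot (p i) (y *m E)| <= th * `|y|.
Hypothesis p_dual : forall (y : 'rV[R]_k) j,
  dot (p ord0 - p (lift ord0 j)) (y *m E) = y 0 j.
Hypothesis th_small : 8 * (k.+1%:R * th) <= 1.
Hypothesis S_level : forall x, `|x - z0| < r ->
  S x <-> forall j, f ord0 x = f (lift ord0 j) x.
Hypothesis S_z0 : S z0.

(** [S] is the zero set of [G]. By [p_dual] and [f_vert], [G] is close to the identity in the
    vertical directions [y *m E], so its zero set is a graph over the orthogonal complement of the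
    rows of [E]. *)
Let G (x : 'rV[R]_m) : 'rV[R]_k := \row_j (f ord0 x - f (lift ord0 j) x).

Lemma level_row_free : row_free E.
Proof.
apply: inj_row_free => y yE; apply/rowP => j.
by rewrite -(p_dual y j) yE dot0r mxE.
Qed.

Lemma level_S x : `|x - z0| < r -> S x <-> G x = 0.
Proof.
move=> xr; rewrite S_level//; split=> [H|/rowP H j].
  by apply/rowP => j; rewrite !mxE -H subrr.
by have := H j; rewrite !mxE => /eqP; rewrite subr_eq0 => /eqP.
Qed.

Lemma th_quarter : 2 * th <= 4^-1.
Proof.
have : th <= k.+1%:R * th by rewrite ler_peMl// ler1n.
have := th_small; lra.
Qed.

Lemma G_vert x y : `|x - z0| < r -> `|x + y *m E - z0| < r ->
  `|G (x + y *m E) - G x - y| <= 4^-1 * `|y|.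
Proof.
move=> xr xyr; apply: (le_trans (y := 2 * th * `|y|)); last first.
  by rewrite ler_wpM2r// th_quarter.
apply: rV_norm_le => [|j]; first by rewrite !mulr_ge0.
rewrite !mxE -(p_dual y j) dotBl.
have := f_vert ord0 xr xyr; have := f_vert (lift ord0 j) xr xyr.
move=> /ler_normlP[a1 a2] /ler_normlP[b1 b2].
by apply/ler_normlP; split; lra.
Qed.

Lemma G_inj x y : `|x - z0| < r -> `|x + y *m E - z0| < r ->
  `|y| <= 2 * `|G (x + y *m E) - G x|.
Proof.
move=> xr xyr; have := G_vert xr xyr.
have := ler_normB (G (x + y *m E) - G x) (G (x + y *m E) - G x - y).
rewrite subKr; have := normr_ge0 y; lra.
Qed.

Lemma G_lip x y : `|x - z0| < r -> `|y - z0| < r ->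
  `|G x - G y| <= 2 * Lp * `|x - y|.
Proof.
move=> xr yr; apply: rV_norm_le => [|j]; first by rewrite !mulr_ge0.
rewrite !mxE.
have := f_lip ord0 xr yr; have := f_lip (lift ord0 j) xr yr.
move=> /ler_normlP[a1 a2] /ler_normlP[b1 b2].
by apply/ler_normlP; split; lra.
Qed.

(** The factor 2 makes the defect [2 * sg - dl i] of a summand dominate the absolute value of
    [dl i], given only [dl i <= sg]. The linear terms leave the defect unchanged and cancel the
    vertical slope of [f i], so that [Q] varies little vertically. *)
Let Q (x : 'rV[R]_m) : R :=
  \sum_i (2 * C * sq (x - z0) - f i x + dot (p i) x).

Let avgm (t : R) (x y : 'rV[R]_m) := (1 - t) *: x + t *: y.

(* The concavity defects of the semiconcave [f i] are controlled by the one
   convex function [Q], on the zero set of [G] as well. *)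
Lemma G_defect t x y : 0 <= t <= 1 -> `|x - z0| < r -> `|y - z0| < r ->
  G x = 0 -> G y = 0 ->
  `|G (avgm t x y)| <= (1 - t) * Q x + t * Q y - Q (avgm t x y).
Proof.
move=> t01 xr yr Gx Gy.
pose dl i := (1 - t) * f i x + t * f i y - f i (avgm t x y).
pose sg : R := C * (t * (1 - t) * sq (x - y)).
have sg0 : 0 <= sg.
  by move/andP: t01 => [? ?]; rewrite !mulr_ge0 ?subr_ge0 ?sq_ge0.
have dl_le i : dl i <= sg by exact: f_sc.
have -> : (1 - t) * Q x + t * Q y - Q (avgm t x y) = \sum_i (2 * sg - dl i).
  rewrite /Q [X in X + _ - _]mulr_sumr [X in _ + X - _]mulr_sumr.
  rewrite -big_split -sumrB; apply: eq_bigr => i _ /=.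
  rewrite /dl /sg; have := sq_avg t (x - z0) (y - z0).
  have -> : (1 - t) *: (x - z0) + t *: (y - z0) = avgm t x y - z0.
    rewrite /avgm !scalerBr addrACA -opprD -scalerDl.
    by rewrite addrNK scale1r.
  rewrite opprB addrA subrK => <-.
  have -> : dot (p i) (avgm t x y) = (1 - t) * dot (p i) x + t * dot (p i) y.
    by rewrite /avgm dotDr !dotZr.
  ring.
have dl0 i : `|dl i| <= 2 * sg - dl i.
  by apply/ler_normlP; split; have := dl_le i; lra.
apply: rV_norm_le => [|j].
  by apply: sumr_ge0 => i _; exact: le_trans (normr_ge0 _) (dl0 i).
have Gxj := congr1 (fun v : 'rV[R]_k => v 0 j) Gx.
have Gyj := congr1 (fun v : 'rV[R]_k => v 0 j) Gy.
rewrite !mxE in Gxj Gyj *.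
have -> : f ord0 (avgm t x y) - f (lift ord0 j) (avgm t x y) =
    dl (lift ord0 j) - dl ord0.
  by rewrite /dl; have -> : f ord0 x = f (lift ord0 j) x; [lra|];
    have -> : f ord0 y = f (lift ord0 j) y; [lra|]; ring.
rewrite (bigD1 ord0)//= (bigD1 (lift ord0 j))//=.
rewrite (le_trans (ler_normB _ _))//.
have : 0 <= \sum_(i < k.+1 | (i != ord0) && (i != lift ord0 j)) (2 * sg - dl i).
  by apply: sumr_ge0 => i _; exact: le_trans (normr_ge0 _) (dl0 i).
have := dl0 ord0; have := dl0 (lift ord0 j); lra.
Qed.

Lemma level_radius : exists2 s, 0 < s <= r &
  forall x (y : 'rV[R]_k), `|x - z0| < s -> `|x + y *m E - z0| < s ->
  `|Q (x + y *m E) - Q x| <= 4^-1 * `|y|.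
Proof.
have [KE KE0 HKE] := mulmx_bound E.
(* The bound 1/4 is split in two: [s * M <= 1] leaves 1/8 for the squares, and [th_small] leaves 1/8
   for the slopes. *)
pose M := k.+1%:R * (2 * C * (m%:R * 2 * KE)) * 8.
have M0 : 0 <= M by rewrite !mulr_ge0// ltW.
pose s := Num.min r (M + 1)^-1.
have M1 : 0 < M + 1 by rewrite ltr_wpDl.
have s0 : 0 < s by rewrite lt_min r0 invr_gt0.
have sM : s * M <= 1.
  apply: (le_trans (y := (M + 1)^-1 * (M + 1))); last by rewrite mulVf ?gt_eqF.
  by rewrite ler_pM ?lerDl//; [exact: ltW|rewrite ge_min lexx orbT].
exists s; first by rewrite s0 ge_min lexx.
move=> x y xs xys.
have sr z : `|z - z0| < s -> `|z - z0| < r.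
  by move=> zs; rewrite (lt_le_trans zs)// ge_min lexx.
rewrite /Q -sumrB (le_trans (ler_norm_sum _ _ _))//.
pose A : R := 2 * C * (m%:R * 2 * s * KE) * `|y| + th * `|y|.
apply: (le_trans (y := \sum_(i < k.+1) A)).
  apply: ler_sum => i _; rewrite /A.
  have F := f_vert i (sr _ xs) (sr _ xys).
  have -> : 2 * C * sq (x + y *m E - z0) - f i (x + y *m E) +
      dot (p i) (x + y *m E) - (2 * C * sq (x - z0) - f i x + dot (p i) x) =
      2 * C * (sq (x + y *m E - z0) - sq (x - z0)) -
      (f i (x + y *m E) - f i x - dot (p i) (y *m E)).
    by rewrite dotDr; ring.
  rewrite (le_trans (ler_normB _ _))// lerD// normrM ger0_norm ?mulr_ge0//.
  rewrite -mulrA ler_wpM2l ?mulr_ge0//.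
  have -> : sq (x + y *m E - z0) - sq (x - z0) =
      dot ((x + y *m E - z0) + (x - z0)) (y *m E).
    have -> : x + y *m E - z0 = (x - z0) + y *m E by rewrite addrAC.
    rewrite sqD !dotDl -/(sq (y *m E)); ring.
  rewrite (le_trans (dot_le _ _))//.
  apply: (le_trans (y := m%:R * (2 * s) * (KE * `|y|))); last first.
    by rewrite !mulrA.
  rewrite ler_pM ?mulr_ge0// ler_wpM2l// (le_trans (ler_normD _ _))//; lra.
rewrite sumr_const card_ord -[_ *+ k.+1]mulr_natl /A mulrDr.
have -> : k.+1%:R * (2 * C * (m%:R * 2 * s * KE) * `|y|) = s * M / 8 * `|y|.
  by rewrite /M; field.
rewrite mulrA -mulrDl ler_wpM2r//.
by have := th_small; lra.
Qed.

Lemma add3K (V : zmodType) (a b c : V) : a + b + c - a = b + c.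
Proof. by rewrite -[a + b + c]addrA [a + _]addrC addrK. Qed.

(** Solving [G = 0] vertically gives the graph map [h]. Averaging two points of the graph leaves the
    graph by a vertical vector, which is bounded by the convexity defect of the single function
    [Q \o h]; all coordinates of [h] are then differences of convex functions. *)
Lemma dc_level : dc_at d S z0.
Proof.
have [B [Ep [BB BEp EB EEp BE1]]] := complement_basis level_row_free.
have [s /andP[s0 sr] Qs] := level_radius.
have [KE KE0 HKE] := mulmx_bound E.
have [KB KB0 HKB] := mulmx_bound B.
have [KP KP0 HKP] := mulmx_bound (B^T *m B).
have split_xy x : x = z0 + (x - z0) *m B^T *m B + (x - z0) *m Ep *m E.
  by rewrite -addrA -!mulmxA -mulmxDr BE1 mulmx1 addrC subrK.
have coordx x y : (z0 + x *m B + y *m E - z0) *m B^T = x.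
  rewrite add3K mulmxDl -!mulmxA BB EB mulmx1 mulmx0.
  exact: addr0.
have coordy x y : (z0 + x *m B + y *m E - z0) *m Ep = y.
  rewrite add3K mulmxDl -!mulmxA BEp EEp mulmx1 mulmx0.
  exact: add0r.
(* Vertical radius [r2] and horizontal radius [r1] of a box in the ball of radius [s]. With [r1]
   this small, |G| is at most [r2 / 8] on the slice y = 0, so the map [T] below preserves the ball
   of radius [r2 / 2]. *)
pose r2 : R := s / (2 * KE).
have r20 : 0 < r2 by rewrite divr_gt0// mulr_gt0.
pose r1 : R := Num.min (s / (2 * KB)) (r2 / (16 * (Lp + 1) * KB)).
have Lp1 : 0 < Lp + 1 by rewrite ltr_wpDl.
have r10 : 0 < r1 by rewrite lt_min !divr_gt0 ?mulr_gt0.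
have r1s : r1 * KB <= s / 2.
  rewrite -ler_pdivlMr// (le_trans (y := s / (2 * KB)))// ?ge_min ?lexx//.
  by rewrite invfM mulrA.
have r12 : 2 * Lp * (r1 * KB) <= r2 / 8.
  have : r1 * KB <= r2 / (16 * (Lp + 1)).
    rewrite -ler_pdivlMr// (le_trans (y := r2 / (16 * (Lp + 1) * KB)))//.
      by rewrite ge_min lexx orbT.
    by rewrite [(_ * KB)^-1]invfM mulrA.
  move=> H; apply: (le_trans (y := 2 * Lp * (r2 / (16 * (Lp + 1))))).
    by rewrite ler_wpM2l// mulr_ge0.
  have -> : 2 * Lp * (r2 / (16 * (Lp + 1))) = r2 / 8 * (Lp / (Lp + 1)).
    by field; rewrite gt_eqF.
  have r28 : 0 <= r2 / 8 by lra.
  rewrite ler_piMr// ler_pdivrMr//; lra.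
have box x y : `|x| < r1 -> `|y| < r2 -> `|z0 + x *m B + y *m E - z0| < s.
  move=> xr yr; rewrite add3K.
  rewrite (le_lt_trans (ler_normD _ _))//.
  have a1 : `|x *m B| <= s / 2.
    rewrite (le_trans (HKB x))// (le_trans _ r1s)// mulrC ler_wpM2r//; exact: ltW.
  have a2 : `|y *m E| < s / 2.
    rewrite (le_lt_trans (HKE y))//.
    have -> : s / 2 = KE * r2 by rewrite /r2; field; rewrite gt_eqF.
    by rewrite ltr_pM2l.
  by lra.
have boxr x y : `|x| < r1 -> `|y| < r2 -> `|z0 + x *m B + y *m E - z0| < r.
  by move=> xr yr; rewrite (lt_le_trans (box _ _ xr yr)).
have norm0 n : `|0 : 'rV[R]_n| = 0 by exact: normr0.
have z0r : `|z0 - z0| < r by rewrite subrr norm0.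
have Gz0 : G z0 = 0 by apply/level_S.
(* The height over [x] is a fixed point of y - G, a contraction of ratio 1/4 by [G_vert]. *)
have /choice[Y HY] : forall x : 'rV[R]_d, exists y : 'rV[R]_k,
    `|x| < r1 -> `|y| <= r2 / 2 /\ G (z0 + x *m B + y *m E) = 0.
  move=> x; have [xr|] := ltP `|x| r1; last by exists 0.
  have sub y : `|y| <= r2 / 2 -> `|y| < r2 by move=> yr; lra.
  pose T (y : 'rV[R]_k) := y - G (z0 + x *m B + y *m E).
  have Tq y y' : `|y| <= r2 / 2 -> `|y'| <= r2 / 2 ->
      `|T y - T y'| <= 4^-1 * `|y - y'|.
    move=> /sub yr /sub y'r.
    have E1 : z0 + x *m B + y *m E = z0 + x *m B + y' *m E + (y - y') *m E.
      by rewrite mulmxBl -[RHS]addrA [y' *m E + _]addrC subrK.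
    have := @G_vert (z0 + x *m B + y' *m E) (y - y').
    rewrite -E1 => /(_ (boxr _ _ xr y'r) (boxr _ _ xr yr)).
    rewrite /T -normrN; congr (`|_| <= _).
    by move: (G _) (G _) => u v; apply/rowP => j; rewrite !mxE; ring.
  have r22 : 0 <= r2 / 2 by lra.
  have T0 : `|T 0| <= r2 / 8.
    rewrite /T sub0r normrN mul0mx addr0 -[G _]subr0 -Gz0.
    have xB : `|z0 + x *m B - z0| < r.
      by have := boxr _ 0 xr; rewrite mul0mx addr0 norm0; apply.
    rewrite (le_trans (G_lip xB z0r))// (le_trans _ r12)//.
    rewrite ler_wpM2l ?mulr_ge0// [z0 + _]addrC addrK (le_trans (HKB x))//.
    by rewrite mulrC ler_wpM2r// ltW.
  have [||y yr Ty] := @contraction_fixpoint R k T (r2 / 2) 4^-1 r22 _ _ Tq.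
  - by lra.
  - move=> y yr; rewrite -[T y](subrK (T 0)) (le_trans (ler_normD _ _))//.
    have n0 : `|0 : 'rV[R]_k| <= r2 / 2 by rewrite norm0.
    have := Tq _ _ yr n0; rewrite subr0; lra.
  exists y => _; split=> //; apply/eqP; rewrite -oppr_eq0; apply/eqP.
  by apply: (addrI y); rewrite addr0.
pose h x := z0 + x *m B + Y x *m E.
have hY x : `|x| < r1 -> `|Y x| < r2.
  by move=> /HY[Yx _]; lra.
have hG x : `|x| < r1 -> G (h x) = 0 by move=> /HY[].
have hs x : `|x| < r1 -> `|h x - z0| < s by move=> xr; apply: box => //; exact: hY.
have hr x : `|x| < r1 -> `|h x - z0| < r by move=> /hs xs; exact: lt_le_trans sr.
(* A box in the split coordinates rather than a ball, so that the projection of [S] within [U] is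
   exactly |x| < r1. *)
pose U := [set X | `|(X - z0) *m B^T| < r1 /\ `|(X - z0) *m Ep| < r2].
pose P := AffineSubspace z0 BB.
have Us X : U X -> `|X - z0| < s.
  by case=> xr yr; have := box _ _ xr yr; rewrite -split_xy.
have projE X : affine_proj P X = z0 + (X - z0) *m B^T *m B by [].
have isomE x : affine_isom P x = z0 + x *m B by [].
have isom_inj x x' : z0 + x *m B = z0 + x' *m B -> x = x'.
  move=> /addrI/(congr1 (mulmx^~ B^T)).
  by rewrite -!mulmxA BB !mulmx1.
have WE x : (affine_isom P @^-1` (affine_proj P @` (S `&` U))) x <-> `|x| < r1.
  split=> [[X [SX [xr yr]]]|xr].
    by rewrite projE isomE => /isom_inj <-.
  exists (h x).
    split; first by apply/level_S; [exact: hr|exact: hG].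
    by rewrite /U/= /h coordx coordy; split=> //; exact: hY.
  by rewrite projE isomE /h coordx.
(* The corner [Z] has the base point of one and the height of the other: [G_inj] bounds the vertical
   side by the change of [G], and [G_lip] bounds that by the horizontal side. *)
have lipxy x y x' y' : `|x| < r1 -> `|y| < r2 -> `|x'| < r1 -> `|y'| < r2 ->
    G (z0 + x *m B + y *m E) = 0 -> G (z0 + x' *m B + y' *m E) = 0 ->
    `|z0 + x *m B + y *m E - (z0 + x' *m B + y' *m E)| <=
    (1 + 4 * Lp * KE) * `|z0 + x *m B - (z0 + x' *m B)|.
  move=> xr yr x'r y'r GX GX'.
  pose Z := z0 + x *m B + y' *m E.
  have dy : `|y - y'| <= 4 * Lp * `|x *m B - x' *m B|.
    have E1 : z0 + x *m B + y *m E = Z + (y - y') *m E.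
      by rewrite mulmxBl /Z -[RHS]addrA [y' *m E + _]addrC subrK.
    have := @G_inj Z (y - y'); rewrite -E1.
    move=> /(_ (boxr _ _ xr y'r) (boxr _ _ xr yr)); rewrite GX sub0r normrN.
    rewrite -[G Z]subr0 -GX'.
    have := G_lip (boxr _ _ xr y'r) (boxr _ _ x'r y'r).
    have -> : z0 + x *m B + y' *m E - (z0 + x' *m B + y' *m E) =
        x *m B - x' *m B.
      by rewrite opprD addrACA subrr addr0 opprD addrACA subrr add0r.
    by rewrite -/Z; lra.
  have -> : z0 + x *m B + y *m E - (z0 + x' *m B + y' *m E) =
        (x *m B - x' *m B) + (y - y') *m E.
    rewrite mulmxBl; move: (x *m B) (x' *m B) (y *m E) (y' *m E) => a b u v.
    by apply/rowP => j; rewrite !mxE; ring.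
  have -> : z0 + x *m B - (z0 + x' *m B) = x *m B - x' *m B.
    by rewrite opprD addrACA subrr add0r.
  rewrite (le_trans (ler_normD _ _))// mulrDl mul1r lerD2l.
  rewrite (le_trans (HKE _))// mulrC -mulrA [KE * _]mulrC mulrA.
  by rewrite ler_wpM2r// ltW.
have lipSU X X' : S X -> U X -> S X' -> U X' ->
    `|X - X'| <= (1 + 4 * Lp * KE) * `|affine_proj P X - affine_proj P X'|.
  move=> SX UX SX' UX'.
  have GX : G X = 0 by apply/level_S => //; exact: lt_le_trans (Us _ UX) sr.
  have GX' : G X' = 0 by apply/level_S => //; exact: lt_le_trans (Us _ UX') sr.
  case: UX UX' => xr yr [x'r y'r]; rewrite !projE.
  have := lipxy _ _ _ _ xr yr x'r y'r; rewrite -!split_xy; exact.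
have openU : open U.
  apply: openPd => X [X1 X2].
  have [K1 K10 HK1] := mulmx_bound B^T.
  have [K2 K20 HK2] := mulmx_bound Ep.
  exists (Num.min ((r1 - `|(X - z0) *m B^T|) / K1) ((r2 - `|(X - z0) *m Ep|) / K2)).
    by rewrite lt_min !divr_gt0 ?subr_gt0.
  move=> X'; rewrite lt_min !ltr_pdivlMr// => /andP[XX1 XX2].
  have XE : X' - z0 = (X - z0) + (X' - X) by rewrite [RHS]addrC addrA subrK.
  by split; rewrite XE mulmxDl (le_lt_trans (ler_normD _ _))//;
    [have := HK1 (X' - X)|have := HK2 (X' - X)]; lra.
exists U, P; split=> //.
- by rewrite /U/= subrr !mul0mx !norm0.
- apply: openPd => x /WE xr; exists (r1 - `|x|); first by rewrite subr_gt0.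
  move=> y yx; apply/WE; rewrite -[y](subrK x) (le_lt_trans (ler_normD _ _))//.
  by lra.
- pose L := m.+1%:R * (1 + 4 * Lp * KE) + m.+1%:R * KP.
  have a0 : 0 < m.+1%:R * KP by rewrite mulr_gt0.
  have a1 : 0 <= m.+1%:R * (1 + 4 * Lp * KE).
    by rewrite mulr_ge0// addr_ge0// !mulr_ge0// ltW.
  exists L; first by rewrite ltr_wpDl.
  move=> X X' [SX UX] [SX' UX']; split.
    rewrite mulrC ler_pdivrMr ?ltr_wpDl//.
    rewrite (le_trans (euclid_normr _))//.
    apply: (le_trans (y := m.+1%:R * ((1 + 4 * Lp * KE) *
       `|affine_proj P X - affine_proj P X'|))).
      by rewrite ler_wpM2l// lipSU.
    rewrite mulrA mulrC ler_pM ?normr_ge0 ?normr_euclid//.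
    by rewrite lerDl ltW.
  rewrite (le_trans (euclid_normr _))//.
  have -> : affine_proj P X - affine_proj P X' = (X - X') *m (B^T *m B).
    rewrite !projE opprD addrACA subrr add0r -mulmxBl -mulmxBl.
    by rewrite opprB addrA subrK mulmxA.
  apply: (le_trans (y := m.+1%:R * (KP * `|X - X'|))).
    by rewrite ler_wpM2l// HKP.
  rewrite mulrA ler_pM ?normr_ge0 ?normr_euclid//; first exact: ltW.
  by rewrite lerDr.
exists h; last first.
  move=> x /WE xr; split; last by rewrite projE isomE /h coordx.
  split; first by apply/level_S; [exact: hr|exact: hG].
  by rewrite /U/= /h coordx coordy; split=> //; exact: hY.
have hlip x x' : `|x| < r1 -> `|x'| < r1 ->
    `|h x - h x'| <= (1 + 4 * Lp * KE) * KB * `|x - x'|.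
  move=> xr x'r.
  have hSU z : `|z| < r1 -> S (h z) /\ U (h z).
    move=> zr; split; first by apply/level_S; [exact: hr|exact: hG].
    by rewrite /U/= /h coordx coordy; split=> //; exact: hY.
  have [[Sx Ux] [Sx' Ux']] := (hSU _ xr, hSU _ x'r).
  rewrite (le_trans (lipSU _ _ Sx Ux Sx' Ux'))//.
  rewrite !projE /h !coordx opprD addrACA subrr add0r -mulmxBl -[leRHS]mulrA.
  rewrite ler_wpM2l//.
  by rewrite addr_ge0// !mulr_ge0// ltW.
move=> i; split.
  move=> x /set_mem /WE xr; apply/ctsP => e e0.
  pose K := (1 + 4 * Lp * KE) * KB + 1.
  have K0 : 0 < K.
    by rewrite ltr_wpDl// mulr_ge0 ?(ltW KB0)// addr_ge0// !mulr_ge0// ltW.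
  exists (Num.min (r1 - `|x|) (e / K)).
    by rewrite lt_min subr_gt0 xr divr_gt0.
  move=> y; rewrite lt_min ltr_pdivlMr// => /andP[yx ye].
  have yr : `|y| < r1.
    by rewrite -[y](subrK x) (le_lt_trans (ler_normD _ _))//; lra.
  apply: (le_lt_trans (y := `|h y - h x|)).
    by have := normr_coord (h y - h x) i; rewrite !mxE.
  rewrite (le_lt_trans (hlip _ _ yr xr))// (le_lt_trans _ ye)// mulrC.
  by rewrite ler_wpM2l// lerDl.
move=> W' oW' cW' _ clW'.
have W'r x : x \in W' -> `|x| < r1.
  by move=> /set_mem W'x; apply/WE/clW'; exact: subset_closure.
pose H x := Q (h x).
(* [X] is the average on the chord and [h w] the graph point below or above it. [G_inj] and
   [G_defect] give |y| <= 2 |G X| <= 2 (defect of [Q] along the chord). Replacing [Q X] by [H w]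
   there costs |y| / 2, which is absorbed: hence the factor 4. *)
have key x x' (t : R) : `|x| < r1 -> `|x'| < r1 -> 0 <= t <= 1 ->
    `|(1 - t) * h x 0 i + t * h x' 0 i - h ((1 - t) *: x + t *: x') 0 i| <=
    4 * KE * ((1 - t) * H x + t * H x' - H ((1 - t) *: x + t *: x')).
  move=> xr x'r t01; set w := (1 - t) *: x + t *: x'.
  have wr : `|w| < r1.
    move: t01 => /andP[t0 t1].
    rewrite (le_lt_trans (ler_normD _ _))// !normrZ ger0_norm ?subr_ge0//.
    rewrite ger0_norm//.
    have [->|tn0] := eqVneq t 0; first by rewrite subr0 mul1r mul0r addr0.
    have tp : 0 < t by rewrite lt_neqAle eq_sym tn0.
    have : t * `|x'| < t * r1 by rewrite ltr_pM2l.
    have : (1 - t) * `|x| <= (1 - t) * r1 by rewrite ler_wpM2l ?subr_ge0// ltW.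
    by lra.
  pose X := avgm t (h x) (h x').
  pose y := (1 - t) *: Y x + t *: Y x' - Y w.
  have Xw : X = h w + y *m E.
    rewrite /X /avgm /h /w /y !scalerDr mulmxBl !mulmxDl -!scalemxAl.
    move: (x *m B) (x' *m B) (Y x *m E) (Y x' *m E) (Y w *m E) => a b a' b' c.
    by apply/rowP => j; rewrite !mxE; ring.
  have Xs : `|X - z0| < s by apply: (ball_avg t01); exact: hs.
  have Xr : `|X - z0| < r by exact: lt_le_trans sr.
  have D := G_defect t01 (hr _ xr) (hr _ x'r) (hG _ xr) (hG _ x'r).
  have I : `|y| <= 2 * `|G X - G (h w)| by rewrite Xw G_inj -?Xw//; exact: hr.
  have J : `|Q X - Q (h w)| <= 4^-1 * `|y| by rewrite Xw Qs -?Xw//; exact: hs.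
  have -> : (1 - t) * h x 0 i + t * h x' 0 i - h w 0 i = (y *m E) 0 i.
    have -> : (1 - t) * h x 0 i + t * h x' 0 i = X 0 i by rewrite !mxE.
    by rewrite Xw [(h w + _) 0 i]mxE [LHS]addrC addKr.
  rewrite (le_trans (normr_coord _ _))// (le_trans (HKE _))//.
  rewrite [4 * KE]mulrC -[leRHS]mulrA ler_pM2l//.
  rewrite hG// subr0 in I.
  move: D J; rewrite -/X /H => D /ler_normlP[J1 J2].
  by lra.
have conv01 (t : {i01 R}) : 0 <= t%:num <= 1 by rewrite ge0 le1.
(* By [key], [4 * KE * H] is convex and remains so after adding a coordinate of [h]. The arguments
   are swapped below because [conv t x x'] gives weight [t] to its first point. *)
exists (fun x => h x 0 i + 4 * KE * H x), (fun x => 4 * KE * H x); split.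
- move=> t x x' /W'r xr /W'r x'r; rewrite convRE /unstable.onem.
  have := key _ _ _ x'r xr (conv01 t).
  have -> : conv t x x' = (1 - t%:num) *: x' + t%:num *: x by rewrite addrC.
  by move=> /ler_normlP[a1 a2]; lra.
- move=> t x x' /W'r xr /W'r x'r; rewrite convRE /unstable.onem.
  have := key _ _ _ x'r xr (conv01 t).
  have -> : conv t x x' = (1 - t%:num) *: x' + t%:num *: x by rewrite addrC.
  by move=> /(le_trans (normr_ge0 _)); lra.
- by move=> x _; rewrite addrK.
Qed.

End DCLevelSet.

(** * Charts and tangent vectors *)

Section Charts.
Variables (R : realType) (m : nat) (M : smoothManifold R m).
Implicit Types (c : chart R m M) (p : M).

Definition cod c := phi c @` dom c.

Lemma cod_phi c p : dom c p -> cod c (phi c p).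
Proof. by move=> cp; exists p. Qed.

Lemma phiKd c p : dom c p -> psi c (phi c p) = p.
Proof. by move=> /mem_set; exact: phiK. Qed.

Lemma psiKd c x : cod c x -> phi c (psi c x) = x.
Proof. by case=> p cp <-; rewrite phiKd. Qed.

Lemma dom_psi c x : cod c x -> dom c (psi c x).
Proof. by case=> p cp <-; rewrite phiKd. Qed.

Lemma within_cts (T U : topologicalType) (A : set T) (f : T -> U) x :
  open A -> A x -> {within A, continuous f} -> continuous_at x f.
Proof.
move=> oA Ax; rewrite continuous_open_subspace// => cf.
exact: (cf x (mem_set Ax)).
Qed.

Lemma phi_cts c p : dom c p -> continuous_at p (phi c).
Proof. by move=> cp; apply: within_cts (phi_continuous (c:=c)) => //; exact: dom_open. Qed.

Lemma psi_cts c x : cod c x -> continuous_at x (psi c).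
Proof. by move=> cx; apply: within_cts (psi_continuous (c:=c)) => //; exact: cod_open. Qed.

Lemma near_dom c p : dom c p -> \forall q \near p, dom c q.
Proof. by move=> cp; apply: open_nbhs_nbhs; split=> //; exact: dom_open. Qed.

Lemma near_cod c x : cod c x -> \forall y \near x, cod c y.
Proof. by move=> cx; apply: open_nbhs_nbhs; split=> //; exact: cod_open. Qed.

Lemma trans_dom c c' x :
  (phi c @` (dom c `&` dom c')) x <-> cod c x /\ dom c' (psi c x).
Proof.
split=> [[p [cp c'p] <-]|[cx c'x]]; first by rewrite phiKd//; split=> //; exists p.
by exists (psi c x); [split=> //; exact: dom_psi|exact: psiKd].
Qed.

Lemma trans_open c c' : open (phi c @` (dom c `&` dom c')).
Proof.
rewrite openE => x /trans_dom[cx c'x].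
have n1 := near_cod cx.
have n2 : \forall y \near x, dom c' (psi c y) by apply: (psi_cts cx); exact: near_dom.
by apply: filterS2 n1 n2 => y y1 y2; apply/trans_dom.
Qed.

Lemma trans_Ck c c' k : atlas c -> atlas c' ->
  Ck k (phi c @` (dom c `&` dom c')) (phi c' \o psi c).
Proof. by move=> Ac Ac'; have [H _] := atlas_compatible Ac Ac'; exact: H. Qed.

Lemma trans_diff c c' p : atlas c -> atlas c' -> dom c p -> dom c' p ->
  differentiable (phi c' \o psi c) (phi c p).
Proof.
move=> Ac Ac' cp c'p.
apply: (@Ck1_differentiable R m m (phi c' \o psi c) (phi c @` (dom c `&` dom c'))).
- exact: trans_open.
- exact: trans_Ck.
by apply/trans_dom; rewrite phiKd//; split=> //; exact: cod_phi.
Qed.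

Lemma near_phi_psi c x : cod c x -> \forall y \near x, phi c (psi c y) = y.
Proof. by move=> /near_cod; apply: filterS => y; exact: psiKd. Qed.

Lemma derive_near_diff n k (f g : 'rV[R]_n -> 'rV[R]_k) x :
  (\forall y \near x, f y = g y) -> differentiable f x -> differentiable g x ->
  'd f x = 'd g x :> ('rV[R]_n -> 'rV[R]_k).
Proof.
move=> fg df dg; apply/funext => v.
have e1 := deriveE v df; have e2 := deriveE v dg.
apply: etrans (esym e1) _; apply: etrans _ e2; exact: near_eq_derive.
Qed.

Definition mk_coord p c (v : 'rV[R]_m) : chart R m M -> 'rV[R]_m :=
  fun c' => if `[< chart_at p c' >] then 'd (phi c' \o psi c) (phi c p) v else 0.

Lemma mk_coord_in p c v : chart_at p c -> mk_coord p c v \in is_tangent p.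
Proof.
move=> [Ac cp]; rewrite unfold_in; apply/asboolP; split.
  by move=> c' nc'; rewrite /mk_coord; case: asboolP.
move=> c1 c2 /[dup] pc1 [A1 c1p] /[dup] pc2 [A2 c2p].
rewrite /mk_coord !asboolT//.
have E : phi c1 p = (phi c1 \o psi c) (phi c p) by rewrite /= phiKd.
have d1 := trans_diff Ac A1 cp c1p; have d2 := trans_diff A1 A2 c1p c2p.
rewrite E in d2 *.
rewrite -[RHS](congr1 (fun l => l v) (diff_comp d1 d2)).
have dd := differentiable_comp d1 d2.
refine (congr1 (fun l => l v) (derive_near_diff _ (trans_diff Ac A2 cp c2p) dd)).
have : (phi c @` (dom c `&` dom c1)) (phi c p).
  by apply/trans_dom; rewrite phiKd//; split=> //; exact: cod_phi.
move=> H; have := open_nbhs_nbhs (conj (@trans_open c c1) H).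
by apply: filterS => y /trans_dom[cy c1y] /=; rewrite phiKd.
Qed.

Definition mk_tan p c (v : 'rV[R]_m) : tangent p :=
  if pselect (chart_at p c) is left pc then Tangent (mk_coord_in v pc) else 0.

Lemma mk_tanE p c c' v : chart_at p c -> chart_at p c' ->
  mk_tan p c v c' = 'd (phi c' \o psi c) (phi c p) v.
Proof.
by move=> pc pc'; rewrite /mk_tan; case: pselect => // pc0 /=; rewrite /mk_coord asboolT.
Qed.

Lemma mk_tanEc p c v : chart_at p c -> mk_tan p c v c = v.
Proof.
move=> pc; have [Ac cp] := pc; rewrite (mk_tanE _ pc pc).
have e1 := deriveE v (trans_diff Ac Ac cp cp).
apply: etrans (esym e1) _; apply: etrans (derive_id (phi c p) v).
by apply: near_eq_derive; exact: (near_phi_psi (cod_phi cp)).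
Qed.

Lemma coord0 p c : (0 : tangent p) c = 0.
Proof. by []. Qed.

(** [velocity] is a choice constrained by all charts at once. The vector with the right coordinates
    in [c] meets the other constraints by the chain rule, so the choice succeeds and its value in
    [c] is forced. *)
Lemma velocityE (g : R -> M) t c : chart_at (g t) c -> continuous_at t g ->
  derivable (phi c \o g) t 1 -> velocity g t c = 'D_1 (phi c \o g) t.
Proof.
move=> pc cg dg; have [Ac cp] := pc.
suff : forall c', chart_at (g t) c' ->
    is_derive t 1 (phi c' \o g) (velocity g t c').
  by move=> /(_ c pc) H; rewrite (@derive_val _ _ _ _ _ _ _ H).
apply: (@xgetPex _ 0 [set v : tangent (g t) |
    forall c, chart_at (g t) c -> is_derive t 1 (phi c \o g) (v c)]).
exists (mk_tan (g t) c ('D_1 (phi c \o g) t)) => c' pc'; have [Ac' c'p] := pc'.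
rewrite (mk_tanE _ pc pc').
have dT := trans_diff Ac Ac' cp c'p.
have [d1 d2] := derive_comp_curve (g := phi c \o g) dg dT.
have : is_derive t 1 ((phi c' \o psi c) \o (phi c \o g))
    ('d (phi c' \o psi c) ((phi c \o g) t) ('D_1 (phi c \o g) t)).
  by rewrite -d2; exact: derivableP.
apply: near_eq_is_derive.
have : \forall s \near t, dom c (g s) by apply: cg; exact: near_dom.
by apply: filterS => s cs /=; rewrite phiKd.
Qed.

End Charts.

(** * The Finsler norm read in charts *)

Section FinslerCharts.
Variables (R : realType) (m : nat) (M : smoothManifold R m) (F : finsler M).
Implicit Types (c : chart R m M) (p : M) (x v : 'rV[R]_m).

Definition Fc c (xv : 'rV[R]_m * 'rV[R]_m) : R :=
  F (psi c xv.1) (mk_tan (psi c xv.1) c xv.2).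

Lemma chart_psi c x : atlas c -> cod c x -> chart_at (psi c x) c.
Proof. by move=> Ac cx; split=> //; exact: dom_psi. Qed.

Lemma Fc_spec c : atlas c -> exists2 G : 'rV[R]_m * 'rV[R]_m -> R,
  smooth_on [set xy | cod c xy.1 /\ xy.2 != 0] G &
  (forall p (v : tangent p), dom c p -> F p v = G (phi c p, v c)) /\
  (forall xv, cod c xv.1 -> Fc c xv = G xv).
Proof.
move=> Ac; have [G sG GE] := finsler_smooth F Ac; exists G => //; split=> //.
move=> [x v] /= cx; rewrite /Fc /= GE; last exact: dom_psi.
by rewrite psiKd// (mk_tanEc _ (chart_psi Ac cx)).
Qed.

Lemma FcE c p (v : tangent p) : atlas c -> dom c p -> F p v = Fc c (phi c p, v c).
Proof.
by move=> Ac cp; have [G _ [H1 H2]] := Fc_spec Ac; rewrite H1// H2//; exact: cod_phi.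
Qed.

Lemma Fc_open c : open [set xy : 'rV[R]_m * 'rV[R]_m | cod c xy.1 /\ xy.2 != 0].
Proof.
apply: openPd => -[x v] [/= cx v0].
have [r r0 cr] := openP (@cod_open _ _ _ c) cx.
exists (Num.min r `|v|); first by rewrite lt_min r0 normr_gt0.
move=> [y w]; rewrite /Num.norm/= lt_min !gt_max => /andP[/andP[yr _] /andP[_ wv]].
split=> /=; first exact: cr.
have {wv} : `|w - v| < `|v| by exact: wv.
by apply: contraTneq => ->; rewrite sub0r normrN ltxx.
Qed.

Lemma Fc_Ck c k : atlas c ->
  Ck k [set xy : 'rV[R]_m * 'rV[R]_m | cod c xy.1 /\ xy.2 != 0] (Fc c).
Proof.
move=> Ac; have [G sG [_ H]] := Fc_spec Ac.
apply: (near_eq_Ck (@Fc_open c) _ (sG k)) => xv [cx _].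
by rewrite H.
Qed.

Lemma Fc_hom c x v l : atlas c -> cod c x -> 0 <= l ->
  Fc c (x, l *: v) = l * Fc c (x, v).
Proof.
move=> Ac cx l0; have pc := chart_psi Ac cx.
have [_ _ hom _] := finsler_norm F (psi c x).
have := hom l (mk_tan (psi c x) c v) l0.
rewrite !(FcE _ Ac (dom_psi cx)) psiKd//.
have -> : (l *: mk_tan (psi c x) c v) c = l *: (mk_tan (psi c x) c v) c by [].
by rewrite (mk_tanEc _ pc).
Qed.

Lemma Fc_ge0 c xv : 0 <= Fc c xv.
Proof. by have [H _ _ _] := finsler_norm F (psi c xv.1); exact: H. Qed.

Lemma Fc0 c x : atlas c -> cod c x -> Fc c (x, 0) = 0.
Proof.
by move=> Ac cx; rewrite -[X in (_, X)](scale0r 0) Fc_hom// mul0r.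
Qed.

Lemma Fc_gt0 c x v : atlas c -> cod c x -> v != 0 -> 0 < Fc c (x, v).
Proof.
move=> Ac cx v0; rewrite lt_neqAle Fc_ge0 andbT eq_sym.
apply/eqP => Fc0; have [_ H _ _] := finsler_norm F (psi c x).
have pc := chart_psi Ac cx.
have /H : F _ (mk_tan (psi c x) c v) = 0 by exact: Fc0.
move=> /(congr1 (fun w : tangent _ => w c)); rewrite (mk_tanEc _ pc) => v00.
by rewrite v00 coord0 eqxx in v0.
Qed.

Definition sphere : set 'rV[R]_m := [set v | `|v| = 1].

Lemma sphere_compact : compact sphere.
Proof.
have -> : sphere = [set v : 'rV[R]_m | `|v - 0| <= 1] `&` [set v : 'rV[R]_m | 1 <= `|v|].
  apply/seteqP; split=> v /=; rewrite /sphere/= subr0.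
    by move=> ->.
  by move=> [a b]; apply/le_anti; rewrite a b.
apply: compact_closedI; first exact: closed_ballP_compact.
have -> : [set v : 'rV[R]_m | 1 <= `|v|] = (fun v => `|v|) @^-1` [set z | 1 <= z] by [].
apply: preimage_closed; last exact: closed_ge.
by move=> y _; exact: norm_continuous.
Qed.

Lemma sphere_scale v : v != 0 -> sphere (`|v|^-1 *: v).
Proof.
move=> v0; rewrite /sphere/= normrZ normfV normr_id mulVf//.
by rewrite normr_eq0.
Qed.

Lemma sphere_neq0 v : sphere v -> v != 0.
Proof. by apply: contraPneq => ->; rewrite /sphere/= normr0 => /esym/eqP; rewrite oner_eq0. Qed.

(** Extreme values on the compact set [K] times the unit sphere, extended to all vectors by
    homogeneity. *)
Lemma Fc_bounds c (K : set 'rV[R]_m) : atlas c -> compact K -> K `<=` cod c ->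
  exists a b, [/\ 0 < a, 0 < b & forall x v, K x ->
    a * `|v| <= Fc c (x, v) <= b * `|v|].
Proof.
move=> Ac cK Kc.
have cKS : compact (K `*` sphere) by apply: compact_setX => //; exact: sphere_compact.
(* The sphere itself is empty in dimension 0. *)
have [KS0|/set0P KS0] := eqVneq (K `*` sphere) set0.
  exists 1, 1; split=> // x v Kx; have [->|v0] := eqVneq v 0.
    by rewrite Fc0 ?normr0 ?mulr0 ?lexx//; exact: Kc.
  have : (K `*` sphere) (x, `|v|^-1 *: v) by split=> //=; exact: sphere_scale.
  by rewrite KS0.
have cF : {within K `*` sphere, continuous (Fc c)}.
  apply: continuous_in_subspaceT => -[x v] /set_mem[/= Kx Sv].
  apply: (CkW (Fc_Ck 0 Ac)); split=> /=; first exact: Kc.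
  exact: sphere_neq0.
have [[x0 v0] /set_mem[/= Kx0 Sv0] Fmin] := compact_EVT_min KS0 cKS cF.
have [[x1 v1] /set_mem[/= Kx1 Sv1] Fmax] := compact_EVT_max KS0 cKS cF.
exists (Fc c (x0, v0)), (Fc c (x1, v1)); split.
- by apply: Fc_gt0 => //; [exact: Kc|exact: sphere_neq0].
- by apply: Fc_gt0 => //; [exact: Kc|exact: sphere_neq0].
move=> x v Kx; have [->|vn0] := eqVneq v 0.
  by rewrite Fc0 ?normr0 ?mulr0 ?lexx//; exact: Kc.
have KSv : (x, `|v|^-1 *: v) \in K `*` sphere.
  by apply/mem_set; split=> //=; exact: sphere_scale.
have -> : Fc c (x, v) = Fc c (x, `|v|^-1 *: v) * `|v|.
  rewrite Fc_hom ?invr_ge0//; last exact: Kc.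
  by rewrite mulrAC mulVf ?mul1r ?normr_eq0.
by rewrite !ler_wpM2r//; [exact: Fmax|exact: Fmin].
Qed.

Lemma cod_ball c x : cod c x -> exists2 r, 0 < r &
  [set y | `|y - x| <= r] `<=` cod c.
Proof.
move=> cx; have [r r0 H] := openP (@cod_open _ _ _ c) cx.
exists (r / 2); first by rewrite divr_gt0.
by move=> y /= yr; apply: H; lra.
Qed.

(** Smoothness says nothing on the zero section; there, continuity comes from the locally uniform
    bound F(x, v) <= b |v|. *)
Lemma Fc_cts c x v : atlas c -> cod c x -> continuous_at (x, v) (Fc c).
Proof.
move=> Ac cx; have [->|v0] := eqVneq v 0; last by apply: (CkW (Fc_Ck 0 Ac)).
have [r r0 rc] := cod_ball cx.
have [a [b [a0 b0 ab]]] := Fc_bounds Ac (@closed_ballP_compact _ _ x r) rc.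
apply/ctsP => e e0; exists (Num.min r (e / b)).
  by rewrite lt_min r0 divr_gt0.
move=> [y w]; rewrite {1}/Num.norm/= !lt_min !gt_max => /andP[/andP[yr _] /andP[_ wb]].
rewrite Fc0// subr0 ger0_norm ?Fc_ge0//.
have /andP[_ H] := ab y w (ltW yr).
rewrite (le_lt_trans H)// mulrC -ltr_pdivlMr//.
by move: wb; rewrite -[X in X < _]/(`|w - 0|) subr0.
Qed.

Definition speed (g : R -> M) (t : R) : R := F (g t) (velocity g t).

Lemma speed_ge0 g t : 0 <= speed g t.
Proof. by have [H _ _ _] := finsler_norm F (g t); exact: H. Qed.

Lemma speedE (g : R -> M) t c : chart_at (g t) c -> continuous_at t g ->
  derivable (phi c \o g) t 1 ->
  speed g t = Fc c (phi c (g t), 'D_1 (phi c \o g) t).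
Proof.
move=> pc cg dg; rewrite /speed (FcE _ pc.1 pc.2).
by rewrite (velocityE pc cg dg).
Qed.

End FinslerCharts.

(** * Curves and their lengths *)

Section Integrals.
Variable R : realType.
Implicit Types (a b c : R) (f g : R -> R).
Notation mu := (@lebesgue_measure R).

Definition itgb a b f := mu.-integrable `[a, b] (EFin \o f).
Definition itg a b f := \int[mu]_(t in `[a, b]) f t.

Lemma itgb_cat a c b f : a <= c -> c <= b -> itgb a c f -> itgb c b f -> itgb a b f.
Proof.
move=> ac cb If Ig.
have E : [set` `[a, b]] = [set` `[a, c]] `|` [set` `]c, b]].
  by apply: itv_bndbnd_setU; rewrite bnd_simp.
have Ig' : mu.-integrable [set` `]c, b]] (EFin \o f).
  by apply: integrableS Ig => //; apply: subset_itvr; rewrite bnd_simp.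
have /integrableP[m1 i1] := If; have /integrableP[m2 i2] := Ig'.
have mU : measurable_fun ([set` `[a, c]] `|` [set` `]c, b]]) (EFin \o f).
  by apply/measurable_funU.
rewrite /itgb E; apply/integrableP; split; first exact: mU.
rewrite ge0_integral_setU//.
- exact: lte_add_pinfty.
- exact: measurableT_comp mU.
- rewrite disj_set2E; apply/eqP/seteqP; split=> // x [/=].
  by rewrite !in_itv/= => /andP[_ xc] /andP[cx _]; have := lt_le_trans cx xc; rewrite ltxx.
Qed.

Lemma itg_cat a c b f : a <= c -> c <= b -> itgb a b f ->
  itg a b f = itg a c f + itg c b f.
Proof.
move=> ac cb If; have := @Rintegral_itvB R f (BLeft a) (BRight b) c If.
rewrite !bnd_simp => /(_ ac cb); rewrite /itg.
rewrite (@Rintegral_itv_obnd_cbnd R c (BRight b) f); last first.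
  by apply: integrableS If => //; apply: subset_itv; rewrite bnd_simp.
by move=> <-; rewrite addrC subrK.
Qed.

Lemma itg_oo a b f : a < b -> itgb a b f -> itg a b f = \int[mu]_(t in `]a, b[) f t.
Proof.
move=> ab If; rewrite /itg -(@Rintegral_itv_obnd_cbnd R a (BRight b) f); last first.
  by apply: integrableS If => //; apply: subset_itv; rewrite bnd_simp.
rewrite (@Rintegral_itv_bndo_bndc R (BRight a) b f)//.
by apply: integrableS If => //; apply: subset_itv; rewrite bnd_simp.
Qed.

(** Only the open interval counts: the speed of a piecewise C^1 curve is uncontrolled at the break
    points. *)
Lemma itgb_ext a b f g : a < b -> {in `]a, b[, f =1 g} -> itgb a b f -> itgb a b g.
Proof.
move=> ab fg If; have /integrableP[mf i_f] := If.
have mg : measurable_fun [set` `]a, b[] (EFin \o g).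
  apply: (eq_measurable_fun (EFin \o f)).
    by move=> x /set_mem/= xab; rewrite /= fg.
  by apply: measurable_funS mf => //; apply: subset_itv; rewrite bnd_simp.
have mg' : measurable_fun [set` `[a, b]] (EFin \o g).
  apply/emeasurable_fun_itv_bndo_bndcP.
  exact/emeasurable_fun_itv_obnd_cbndP.
apply/integrableP; split=> //.
have mag : measurable_fun [set` `]a, b[] (fun x => `|(EFin \o g) x|%E).
  exact: measurableT_comp.
rewrite (integral_itv_bndoo _ _ mag).
apply: le_lt_trans i_f.
have -> : (\int[mu]_(x in `]a, b[) `|(EFin \o g) x| =
    \int[mu]_(x in `]a, b[) `|(EFin \o f) x|)%E.
  by apply: eq_integral => x /set_mem/= xab; rewrite fg.
apply: ge0_subset_integral => //.
- exact: measurableT_comp.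
- by apply: subset_itv; rewrite bnd_simp.
Qed.

Lemma itg_ext a b f g : a < b -> {in `]a, b[, f =1 g} -> itgb a b f ->
  itg a b f = itg a b g.
Proof.
move=> ab fg If; have Ig := itgb_ext ab fg If.
rewrite !itg_oo//; apply: eq_Rintegral => x /set_mem/= xab.
exact: fg.
Qed.

Lemma itg_le a b f g : a < b -> itgb a b f -> itgb a b g ->
  (forall t, a < t < b -> f t <= g t) -> itg a b f <= itg a b g.
Proof.
move=> ab If Ig fg; rewrite !itg_oo//.
have sub : [set` `]a, b[] `<=` [set` `[a, b]] by apply: subset_itv; rewrite bnd_simp.
have If' : mu.-integrable [set` `]a, b[] (EFin \o f) by apply: integrableS If.
have Ig' : mu.-integrable [set` `]a, b[] (EFin \o g) by apply: integrableS Ig.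
by apply: le_Rintegral.
Qed.

Lemma itg_ge0 a b f : (forall t, 0 <= f t) -> 0 <= itg a b f.
Proof. by move=> f0; apply: Rintegral_ge0 => x _; exact: f0. Qed.

Lemma itgb_cts a b f : {within `[a, b], continuous f} -> itgb a b f.
Proof. by move=> cf; apply: continuous_compact_integrable => //; exact: segment_compact. Qed.

Lemma itgbD a b f g : itgb a b f -> itgb a b g -> itgb a b (fun t => f t + g t).
Proof.
move=> If Ig; rewrite /itgb.
have -> : EFin \o (fun t => f t + g t) = ((EFin \o f) \+ (EFin \o g))%E by [].
exact: integrableD.
Qed.

Lemma itgbZ a b k f : itgb a b f -> itgb a b (fun t => k * f t).
Proof.
move=> If; rewrite /itgb.
have -> : EFin \o (fun t => k * f t) = (fun t => k%:E * (EFin \o f) t)%E by [].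
exact: integrableZl.
Qed.

Lemma itgD a b f g : itgb a b f -> itgb a b g ->
  itg a b (fun t => f t + g t) = itg a b f + itg a b g.
Proof. by move=> If Ig; exact: RintegralD. Qed.

Lemma itgZ a b k f : itgb a b f -> itg a b (fun t => k * f t) = k * itg a b f.
Proof. by move=> If; exact: RintegralZl. Qed.

Lemma itgb_cst a b k : itgb a b (fun=> k).
Proof. by apply: itgb_cts; apply: continuous_subspaceT => x; exact: cvg_cst. Qed.

Lemma itg_cst a b k : a <= b -> itg a b (fun=> k) = k * (b - a).
Proof.
move=> ab; rewrite /itg Rintegral_cst//= lebesgue_measure_itv/= lte_fin.
have [ab'|ba] := ltP a b; first by rewrite -EFinB.
have -> : a = b by apply/le_anti; rewrite ab ba.
by rewrite subrr mulr0.
Qed.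

Lemma itg_FTC a b (f df : R -> R) : a < b ->
  {within `[a, b], continuous df} -> {within `[a, b], continuous f} ->
  (forall t, a < t < b -> is_derive t 1 f (df t)) ->
  itg a b df = f b - f a.
Proof.
move=> ab cdf cf Df.
have [cfo cfa cfb] := (continuous_within_itvP f ab).1 cf.
have Dlr : derivable_oo_LRcontinuous f a b.
  split=> // x; rewrite in_itv/= => /Df; by case.
have Ed : {in `]a, b[, (f^`())%classic =1 df}.
  by move=> x; rewrite in_itv/= => /Df H; rewrite derive1E; exact: derive_val.
have := continuous_FTC2 ab cdf Dlr Ed.
by rewrite /itg /Rintegral => ->.
Qed.

End Integrals.

(** * Piecewise C^1 curves in the manifold *)

Section Curves.
Variables (R : realType) (m : nat) (M : smoothManifold R m) (F : finsler M).
Implicit Types (c : chart R m M) (p q : M) (g h : R -> M) (a b e t : R).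

Definition C1M g t :=
  continuous_at t g /\
  forall c, atlas c -> dom c (g t) -> C1at (phi c \o g) t.

Lemma C1M_one g t c : continuous_at t g -> chart_at (g t) c ->
  C1at (phi c \o g) t -> C1M g t.
Proof.
move=> cg [Ac cp] Cg; split=> [|c' Ac' c'p]; first exact: cg.
have H : (phi c @` (dom c `&` dom c')) ((phi c \o g) t).
  by apply/trans_dom; rewrite /= phiKd//; split=> //; exact: cod_phi.
have [K _] := C1at_comp (@trans_open _ _ _ c c') (trans_Ck 1 Ac Ac') H Cg.
apply: (C1at_near _ K).1.
have : \forall s \near t, dom c (g s) by apply: cg; exact: near_dom.
by apply: filterS => s cs /=; rewrite phiKd.
Qed.

Lemma C1M_near g h t : (\forall s \near t, g s = h s) -> C1M g t -> C1M h t.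
Proof.
move=> gh [cg Cg]; have ght : g t = h t by exact: nbhs_singleton gh.
split; first exact: near_eq_cts cg.
move=> c Ac; rewrite -ght => ct.
have n : \forall s \near t, (phi c \o g) s = (phi c \o h) s.
  by apply: filterS gh => s /= ->.
exact: (C1at_near n (Cg c Ac ct)).1.
Qed.

Lemma exists_chart p : exists c, chart_at p c.
Proof. by have [c Ac cp] := atlas_cover p; exists c. Qed.

Lemma C1_curve_onP (O : set R) g : open O ->
  C1_curve_on O g <-> forall t, O t -> C1M g t.
Proof.
move=> oO; split=> [[cg Cg] t Ot|H].
  have cgt : continuous_at t g by exact: cg (mem_set Ot).
  split=> // c Ac ct.
  have oOc : open (O `&` g @^-1` dom c).
    rewrite openE => s [Os cs]; have n1 := open_nbhs_nbhs (conj oO Os).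
    have n2 : \forall u \near s, dom c (g u).
      by apply: (cg s (mem_set Os)); exact: near_dom.
    by apply: filterS2 n1 n2 => u.
  by apply: ((Ck1_curveP _ oOc).1 _ t); [exact: Cg|].
split=> [t /set_mem/H[]//|c Ac].
have oOc : open (O `&` g @^-1` dom c).
  rewrite openE => s [Os cs]; have n1 := open_nbhs_nbhs (conj oO Os).
  have n2 : \forall u \near s, dom c (g u).
    by apply: (H s Os).1; exact: near_dom.
  by apply: filterS2 n1 n2 => u.
by apply: ((Ck1_curveP _ oOc).2) => t [/H[_ K] ct]; exact: K.
Qed.

Lemma C1M_speedE g t c : C1M g t -> chart_at (g t) c ->
  speed F g t = Fc F c (phi c (g t), 'D_1 (phi c \o g) t).
Proof.
by move=> [cg Cg] pc; apply: speedE => //; apply: C1at_derivable; case: pc; exact: Cg.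
Qed.

Lemma speed_near g h t : C1M g t -> (\forall s \near t, g s = h s) ->
  speed F g t = speed F h t.
Proof.
move=> Cg gh; have Ch := C1M_near gh Cg.
have ght : g t = h t by exact: nbhs_singleton gh.
have [c pc] := exists_chart (g t).
have pc' : chart_at (h t) c by rewrite -ght.
rewrite (C1M_speedE Cg pc) (C1M_speedE Ch pc') ght.
congr (Fc F c (_, _)); apply: near_eq_derive.
by apply: filterS gh => s /= ->.
Qed.

Lemma speed_cts g t : (\forall s \near t, C1M g s) -> continuous_at t (speed F g).
Proof.
move=> nC; have [cg Cg] := nbhs_singleton nC.
have [c pc] := exists_chart (g t); have [Ac cp] := pc.
apply: (@near_eq_cts _ _ (fun s => Fc F c (phi c (g s), 'D_1 (phi c \o g) s))).
  have n2 : \forall s \near t, dom c (g s) by apply: cg; exact: near_dom.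
  by apply: filterS2 nC n2 => s Cs cs; rewrite (C1M_speedE Cs (conj Ac cs)).
have H : continuous_at t (fun s => (phi c (g s), 'D_1 (phi c \o g) s)).
  have H1 : continuous_at t (phi c \o g).
    by apply: (continuous_comp cg); exact: phi_cts.
  exact: (cvg_pair H1 (Cg c Ac cp).2).
apply: (continuous_comp H); apply: Fc_cts => //; exact: cod_phi.
Qed.

Definition seg a b g := exists h, (forall t, a <= t <= b -> C1M h t /\ h t = g t) /\
  exists2 O, open O & (forall t, a <= t <= b -> O t) /\ forall t, O t -> C1M h t.

Lemma segP a b g : seg a b g <-> C1_curve_segment a b g.
Proof.
split=> [[h [H1 [ O oO [abO OC]]]]|[ O [h [oO abO hO hg]]]].
  exists O, h; split=> //.
  - exact/(C1_curve_onP _ oO).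
  - by move=> t; rewrite in_itv/= => /H1[].
have OC := (C1_curve_onP h oO).1 hO.
have abO' t : a <= t <= b -> O t by move=> tab; apply: abO; rewrite /= in_itv.
exists h; split; last by exists O.
move=> t tab; split; first by apply/OC/abO'.
by apply: hg; rewrite in_itv.
Qed.

Lemma seg_sub a b a' b' g : a <= a' -> b' <= b -> seg a b g -> seg a' b' g.
Proof.
move=> aa bb [h [H [ O oO [abO OC]]]].
have sub t : a' <= t <= b' -> a <= t <= b.
  by move=> /andP[t1 t2]; rewrite (le_trans aa t1) (le_trans t2 bb).
by exists h; split=> [t /sub/H//|]; exists O => //; split=> // t /sub/abO.
Qed.

Lemma seg_ext a b g h : (forall t, a <= t <= b -> g t = h t) -> seg a b g -> seg a b h.
Proof.
move=> gh [k [H HO]]; exists k; split=> // t tab.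
by have [Ct kg] := H t tab; split; rewrite // kg gh.
Qed.

Lemma near_itv a b t : a < t < b -> \forall s \near t, a < s < b.
Proof.
move=> /andP[a_t tb]; have := @near_in_itvoo R a b t.
rewrite in_itv/= a_t tb => /(_ isT); apply: filterS => s.
by rewrite in_itv.
Qed.

Lemma seg_in a b g t : seg a b g -> a < t < b -> C1M g t.
Proof.
move=> [h [H _]] tab; have tab' : a <= t <= b by move/andP: tab => [/ltW-> /ltW->].
have [Ch _] := H t tab'; apply: C1M_near Ch.
apply: filterS (near_itv tab) => s /andP[/ltW sa /ltW sb].
by have [] := H s; rewrite ?sa ?sb.
Qed.

(** The C^1 extension [h] has continuous speed on the closed interval, equal to that of [g] in the
    interior. *)
Lemma seg_itgb a b g : a < b -> seg a b g -> itgb a b (speed F g).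
Proof.
move=> ab [h [H [ O oO [abO OC]]]].
apply: (@itgb_ext _ a b (speed F h)) => //.
  move=> t; rewrite in_itv/= => tab.
  have tab' : a <= t <= b by move/andP: tab => [/ltW-> /ltW->].
  apply: speed_near; first by have [] := H t tab'.
  apply: filterS (near_itv tab) => s /andP[/ltW sa /ltW sb].
  by have [] := H s; rewrite ?sa ?sb.
apply: itgb_cts; apply: continuous_in_subspaceT => t /set_mem/=.
rewrite in_itv/= => /abO Ot; apply: speed_cts.
have := open_nbhs_nbhs (conj oO Ot); apply: filterS; exact: OC.
Qed.

Lemma seg_cts a b g : seg a b g -> {within [set` `[a, b]], continuous g}.
Proof.
move=> [h [H _]]; apply/subspace_continuousP => t /=; rewrite in_itv/= => tab.
have [[ch _] ht] := H t tab.
change (g x @[x --> within [set` `[a, b]] (nbhs t)] --> g t); rewrite -ht.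
have ch' : h x @[x --> within [set` `[a, b]] (nbhs t)] --> h t.
  exact: cvg_within_filter.
apply: cvg_trans ch'.
apply: near_eq_cvg; rewrite /prop_near1 /within /=.
by apply: nearW => s /=; rewrite in_itv/= => sab; have [_ ->] := H s sab.
Qed.

(** An inductive form of [piecewise_C1]: additive statements about lengths are proved on one segment
    and propagated through concatenation. *)
Inductive pw : R -> R -> (R -> M) -> Prop :=
| pw_seg a b g : a < b -> seg a b g -> pw a b g
| pw_cat a e b g : pw a e g -> pw e b g -> pw a b g.

Lemma pw_lt a b g : pw a b g -> a < b.
Proof. by elim=> {a b g} // a e b g _ ac _ cb; exact: lt_trans ac cb. Qed.

Lemma pw_ext a b g h : pw a b g -> (forall t, a <= t <= b -> g t = h t) -> pw a b h.
Proof.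
move=> pg; elim: pg h => {a b g} [a b g ab gs h gh|a e b g p1 IH1 p2 IH2 h gh].
  by apply: pw_seg => //; exact: seg_ext gs.
have [ac cb] := (pw_lt p1, pw_lt p2).
apply: pw_cat (IH1 _ _) (IH2 _ _) => t /andP[t1 t2]; apply: gh.
  by rewrite t1 (le_trans t2)// ltW.
by rewrite t2 andbT (le_trans _ t1)// ltW.
Qed.

Lemma pw_left a b g t : pw a b g -> a < t <= b -> pw a t g.
Proof.
move=> pg; elim: pg t => {a b g} [a b g ab gs t /andP[a_t tb]|a e b g p1 IH1 p2 IH2 t].
  by apply: pw_seg => //; exact: seg_sub gs.
move=> /andP[a_t tb]; have [tc|ct] := leP t e; first by apply: IH1; rewrite a_t.
by apply: pw_cat p1 (IH2 _ _); rewrite ct.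
Qed.

Lemma pw_right a b g t : pw a b g -> a <= t < b -> pw t b g.
Proof.
move=> pg; elim: pg t => {a b g} [a b g ab gs t /andP[a_t tb]|a e b g p1 IH1 p2 IH2 t].
  by apply: pw_seg => //; exact: seg_sub gs.
move=> /andP[a_t tb]; have [ct|tc] := leP e t; first by apply: IH2; rewrite ct.
by apply: pw_cat (IH1 _ _) p2; rewrite a_t.
Qed.

Lemma pw_cts a b g : pw a b g -> {within [set` `[a, b]], continuous g}.
Proof.
elim=> {a b g} [a b g _|a e b g p1 c1 p2 c2]; first exact: seg_cts.
have [ac cb] := (ltW (pw_lt p1), ltW (pw_lt p2)).
have -> : [set` `[a, b]] = [set` `[a, e]] `|` [set` `[e, b]].
  apply/seteqP; split=> t /=; rewrite !in_itv/=.
    by move=> /andP[-> ->]; rewrite andbT/=; apply/orP; exact: le_total.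
  by case=> /andP[t1 t2]; rewrite ?t1 ?t2 ?andbT/=; [exact: le_trans cb|exact: le_trans t1].
by apply: withinU_continuous => //; exact: itv_closed.
Qed.

Lemma pw_itgb a b g : pw a b g -> itgb a b (speed F g).
Proof.
elim=> {a b g} [a b g ab|a e b g p1 c1 p2 c2]; first exact: seg_itgb.
by apply: itgb_cat c1 c2; apply/ltW/(@pw_lt _ _ g).
Qed.

Lemma length_cat a e b g : pw a e g -> pw e b g ->
  curve_length F a b g = curve_length F a e g + curve_length F e b g.
Proof.
move=> p1 p2; apply: itg_cat; [exact/ltW/(pw_lt p1)|exact/ltW/(pw_lt p2)|].
exact/pw_itgb/(pw_cat p1).
Qed.

Lemma length_ge0 a b g : 0 <= curve_length F a b g.
Proof. by apply: itg_ge0 => t; exact: speed_ge0. Qed.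

Lemma length_ext a b g h : pw a b g -> (forall t, a <= t <= b -> g t = h t) ->
  curve_length F a b g = curve_length F a b h.
Proof.
move=> pg; elim: pg h => {a b g} [a b g ab gs h gh|a e b g p1 IH1 p2 IH2 h gh].
  apply: itg_ext => //; last exact: seg_itgb.
  move=> t; rewrite in_itv/= => tab; apply: speed_near; first exact: seg_in gs tab.
  apply: filterS (near_itv tab) => s /andP[/ltW sa /ltW sb].
  by apply: gh; rewrite sa sb.
have [ac cb] := (pw_lt p1, pw_lt p2).
have g1 t : a <= t <= e -> g t = h t.
  by move=> /andP[t1 t2]; apply: gh; rewrite t1 (le_trans t2)// ltW.
have g2 t : e <= t <= b -> g t = h t.
  by move=> /andP[t1 t2]; apply: gh; rewrite t2 andbT (le_trans _ t1)// ltW.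
rewrite (length_cat p1 p2) (IH1 h g1) (IH2 h g2); symmetry.
by apply: length_cat; [exact: pw_ext p1 g1|exact: pw_ext p2 g2].
Qed.

Lemma pwP a b g : pw a b g <-> a < b /\ piecewise_C1 a b g.
Proof.
split=> [pg|[ab [s]]].
  split; first exact: pw_lt pg.
  elim: pg => {a b g} [a b g ab /segP gs|a e b g p1 [s1 [s1p /eqP s1l] H1] p2 [s2 [s2p s2l] H2]].
    by exists [:: b]; [split=> //=; rewrite ab|case].
  exists (s1 ++ s2).
    by split; rewrite ?cat_path ?last_cat s1l ?s1p ?s2p.
  move=> i; rewrite size_cat => i12.
  have [i1|i1] := ltnP i (size s1).
    have := H1 i i1; rewrite -!cat_cons !nth_cat /= ltnS (ltnW i1) ltnS i1.
    by rewrite !(set_nth_default b e)//= ltnS ltnW.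
  have -> : a :: s1 ++ s2 = belast a s1 ++ e :: s2.
    by rewrite -cat_cons lastI s1l cat_rcons.
  rewrite !nth_cat !size_belast ltnNge i1/= ltnNge (leqW i1)/= subSn//.
  by apply: H2; rewrite ltn_subLR.
elim: s a ab => [|x s IH] a ab [/= sp sl] H; first by move: ab; rewrite (eqP sl) ltxx.
have /andP[ax xs] := sp.
have s0 : seg a x g by apply/segP; exact: (H 0%N).
have [s_nil|s_nnil] := eqVneq s [::].
  by move: sl; rewrite s_nil/= => /eqP <-; exact: pw_seg.
apply: (pw_cat (pw_seg ax s0)); apply: IH.
- have : all (> x) s by apply: order_path_min xs; exact: lt_trans.
  move=> /allP; apply; rewrite -(eqP sl).
  by case: s s_nnil {sp sl H xs} => // y s _ /=; exact: mem_last.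
- by split.
- by move=> i i_s; exact: (H i.+1).
Qed.

End Curves.

(** * Concatenation of curves and the distance to N *)

Section Distance.
Variables (R : realType) (m : nat) (M : smoothManifold R m) (F : finsler M).
Implicit Types (c : chart R m M) (p q : M) (g h : R -> M) (a b e t : R).

Definition glue g h e t := if t <= e then g t else h t.

Lemma glue_left g h e t : t <= e -> glue g h e t = g t.
Proof. by rewrite /glue => ->. Qed.

Lemma glue_right g h e t : g e = h e -> e <= t -> glue g h e t = h t.
Proof.
rewrite /glue => ghe et; case: ifPn => // te.
by have -> : t = e by apply/le_anti; rewrite te et.
Qed.

Lemma pw_glue a e b g h : pw a e g -> pw e b h -> g e = h e ->
  [/\ pw a e (glue g h e), pw e b (glue g h e) & pw a b (glue g h e)].
Proof.
move=> pg ph ghe.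
have p1 : pw a e (glue g h e).
  by apply: pw_ext pg _ => t /andP[_ te]; rewrite glue_left.
have p2 : pw e b (glue g h e).
  by apply: pw_ext ph _ => t /andP[et _]; rewrite glue_right.
by split=> //; exact: pw_cat p1 p2.
Qed.

Lemma length_glue a e b g h : pw a e g -> pw e b h -> g e = h e ->
  curve_length F a b (glue g h e) = curve_length F a e g + curve_length F e b h.
Proof.
move=> pg ph ghe; have [p1 p2 _] := pw_glue pg ph ghe.
rewrite (length_cat F p1 p2); congr (_ + _); symmetry; apply: length_ext => //.
  by move=> t /andP[_ te]; rewrite glue_left.
by move=> t /andP[et _]; rewrite glue_right.
Qed.

(** Parametrized by [a, a + 1], so that it can be glued after any curve ending at time [a]. *)
Definition line c (x y : 'rV[R]_m) a t : M := psi c (x + (t - a) *: (y - x)).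

Lemma line_C1M c x y a t : atlas c -> cod c (x + (t - a) *: (y - x)) ->
  C1M (line c x y a) t /\ 'D_1 (phi c \o line c x y a) t = y - x.
Proof.
move=> Ac cx; pose l (s : R) : 'rV[R]_m := x + (s - a) *: (y - x).
have dl (s : R) : is_derive s (1 : R) l (y - x).
  have -> : l = (fun s : R => (x - a *: (y - x)) + s *: (y - x)).
    apply/funext => u; rewrite /l scalerBl -[RHS]addrA; congr (_ + _).
    by rewrite addrC.
  have dd z w : derivable (id : 'rV[R]_m -> 'rV[R]_m) z w by exact: derivable_id.
  have := is_derive_line (dd (x - a *: (y - x) + s *: (y - x)) (y - x)).
  by rewrite derive_id.
have cl : continuous_at t l.
  by apply: differentiable_continuous; apply/derivable1_diffP; case: (dl t).
have nl : \forall s \near t, cod c (l s) by apply: cl; exact: near_cod.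
have nE : \forall s \near t, l s = (phi c \o line c x y a) s.
  by apply: filterS nl => s cs; rewrite /line/= psiKd.
have Cl : C1at l t.
  have dl' (s : R) : derivable l s 1 by case: (dl s).
  split; first exact: (@filterE _ (nbhs t) _ (fun s => derivable l s 1) dl').
  have -> : 'D_1 l = cst (y - x) by apply/funext => s; rewrite derive_val.
  exact: cvg_cst.
have [C1 D1] := C1at_near nE Cl.
split; last by rewrite -D1 derive_val.
apply: (C1M_one _ _ C1); last by split=> //; exact: dom_psi.
by apply: (continuous_comp cl); exact: psi_cts.
Qed.

Lemma line_pw c x y a : atlas c ->
  (forall s, 0 <= s <= 1 -> cod c (x + s *: (y - x))) ->
  pw a (a + 1) (line c x y a).
Proof.
move=> Ac H; apply: pw_seg; first by rewrite ltrDl.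
have H' t : a <= t <= a + 1 -> cod c (x + (t - a) *: (y - x)).
  by move=> /andP[t1 t2]; apply: H; lra.
exists (line c x y a); split; first by move=> t /H' ct; have [] := line_C1M Ac ct.
pose l (s : R) : 'rV[R]_m := x + (s - a) *: (y - x).
exists (l @^-1` cod c); last by split=> // t ct; have [] := line_C1M Ac ct.
apply: open_comp; last exact: cod_open.
move=> s _; apply: cvgD; first exact: cvg_cst.
by apply: cvgZl; apply: cvgB; [exact: cvg_id|exact: cvg_cst].
Qed.

Lemma line_length c x y a K : atlas c ->
  (forall s, 0 <= s <= 1 -> cod c (x + s *: (y - x))) ->
  (forall s, 0 <= s <= 1 -> Fc F c (x + s *: (y - x), y - x) <= K) ->
  curve_length F a (a + 1) (line c x y a) <= K.
Proof.
move=> Ac H HK; have aa : a < a + 1 by rewrite ltrDl.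
have pl := line_pw a Ac H.
have <- : itg a (a + 1) (fun=> K) = K by rewrite itg_cst ?ltW// addrAC subrr add0r mulr1.
apply: itg_le => //; first exact: pw_itgb; first exact: itgb_cst.
move=> t /andP[t1 t2].
have t01 : 0 <= t - a <= 1 by lra.
have [C1 D1] := line_C1M Ac (H _ t01).
rewrite -/(speed F _ t) (C1M_speedE _ C1 (c := c)); last by split=> //; exact/dom_psi/H.
by rewrite D1 psiKd; [exact: HK|exact: H].
Qed.

Lemma line0 c x y a : line c x y a a = psi c x.
Proof. by rewrite /line subrr scale0r addr0. Qed.

Lemma line1 c x y a : line c x y a (a + 1) = psi c y.
Proof. by rewrite /line addrAC subrr add0r scale1r addrC subrK. Qed.

Definition joined q p := exists a b g, [/\ pw a b g, g a = q & g b = p].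

Lemma segment_ball (V : normedModType R) (x y z : V) r s : `|x - z| <= r -> `|y - z| <= r ->
  0 <= s <= 1 -> `|x + s *: (y - x) - z| <= r.
Proof.
move=> xr yr /andP[s0 s1].
have -> : x + s *: (y - x) - z = (1 - s) *: (x - z) + s *: (y - z).
  have -> : y - x = (y - z) - (x - z) by rewrite opprB addrA subrK.
  rewrite addrAC scalerBr scalerBl scale1r -[RHS]addrA; congr (_ + _).
  exact: addrC.
rewrite (le_trans (ler_normD _ _))// !normrZ (ger0_norm s0) ger0_norm ?subr_ge0//.
have : s * `|y - z| <= s * r by rewrite ler_wpM2l.
have : (1 - s) * `|x - z| <= (1 - s) * r by rewrite ler_wpM2l ?subr_ge0.
by lra.
Qed.

Lemma joined_refl p : joined p p.
Proof.
have [c [Ac cp]] := exists_chart p.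
exists 0, (0 + 1), (line c (phi c p) (phi c p) 0).
rewrite line0 line1 phiKd//; split=> //; apply: line_pw => // s _.
by rewrite subrr scaler0 addr0; exact: cod_phi.
Qed.

Lemma joined_chart q c x y r z : atlas c ->
  [set w | `|w - z| <= r] `<=` cod c -> `|x - z| <= r -> `|y - z| <= r ->
  joined q (psi c x) -> joined q (psi c y).
Proof.
move=> Ac rc xr yr [a [b [g [pg ga gb]]]].
have H s : 0 <= s <= 1 -> cod c (x + s *: (y - x)).
  by move=> s01; apply: rc; exact: segment_ball.
have pl := line_pw b Ac H.
have gl : g b = line c x y b b by rewrite line0.
have [_ _ p3] := pw_glue pg pl gl.
exists a, (b + 1), (glue g (line c x y b) b); split=> //.
  by rewrite glue_left// ltW// (pw_lt pg).
by rewrite glue_right ?lerDl// line1.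
Qed.

Lemma near_chart_ball p c r : chart_at p c -> 0 < r ->
  \forall q \near p, dom c q /\ `|phi c q - phi c p| <= r.
Proof.
move=> [Ac cp] r0.
have n1 := near_dom cp.
have n2 : \forall q \near p, `|phi c q - phi c p| <= r.
  have /cvgrPdist_le/(_ r r0) := phi_cts cp.
  by apply: filterS => q; rewrite distrC.
exact: filterS2 n1 n2.
Qed.

(** The points joined to [q] form an open and closed set, as the points of a chart ball are joined
    to its centre by segments. This makes the set of lengths defining [finsler_dist] nonempty. *)
Lemma connected_joined : connected [set: M] -> forall q p, joined q p.
Proof.
move=> hc q.
have key p p' c r : chart_at p c -> [set w | `|w - phi c p| <= r] `<=` cod c ->
    dom c p' -> `|phi c p' - phi c p| <= r -> joined q p <-> joined q p'.
  move=> [Ac cp] rc cp' pr.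
  have r0 : `|phi c p - phi c p| <= r by rewrite subrr normr0 (le_trans _ pr).
  by split=> J; rewrite -(phiKd cp) || rewrite -(phiKd cp');
    [apply: (joined_chart Ac rc r0 pr)|apply: (joined_chart Ac rc pr r0)];
    rewrite phiKd.
have loc p : \forall p' \near p, joined q p <-> joined q p'.
  have [c pc] := exists_chart p; have [r r0 rc] := cod_ball (cod_phi pc.2).
  by apply: filterS (near_chart_ball pc r0) => p' [cp' pr]; exact: key rc cp' pr.
have JT : [set p | joined q p] = [set: M].
  apply: hc.
  - by exists q; exact: joined_refl.
  - exists [set p | joined q p]; last by rewrite setTI.
    by rewrite openE => p /= J; apply: filterS (loc p) => p' [+ _]; exact.
  - exists [set p | joined q p]; last by rewrite setTI.
    rewrite -openC openE => p /= J; apply: filterS (loc p) => p' [_ K] J'.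
    by apply: J; exact: K.
by move=> p; have : [set: M] p by []; rewrite -JT.
Qed.

Variable N : set M.
Let u := dist_from F N.

Lemma dist_from_le q p a b g : N q -> pw a b g -> g a = q -> g b = p ->
  u p <= curve_length F a b g.
Proof.
move=> Nq pg ga gb.
have l0 (q' p' : M) : lbound [set l | exists (a b : R) (g : R -> M),
    [/\ a < b, piecewise_C1 a b g, g a = q', g b = p' &
        l = curve_length F a b g]] 0.
  by move=> l [a' [b' [g' [_ _ _ _ ->]]]]; exact: length_ge0.
have d0 q' p' : 0 <= finsler_dist F q' p'.
  rewrite /finsler_dist; set E := [set l | _].
  (* Connectedness is not assumed yet; the infimum of the empty set is 0. *)
  have [->|/set0P E0] := eqVneq E set0; first by rewrite inf0.
  by apply: lb_le_inf => //; exact: l0.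
apply: (le_trans (y := finsler_dist F q p)).
  apply: inf_lbound; last by exists q.
  by exists 0 => _ [q' _ <-].
apply: inf_lbound; first by exists 0; exact: l0.
by have [ab pc] := (pwP a b g).1 pg; exists a, b, g.
Qed.

Hypothesis hconn : connected [set: M].
Hypothesis N0 : N !=set0.

Lemma dist_from_approx p d : 0 < d -> exists q a b g,
  [/\ N q, pw a b g, g a = q, g b = p & curve_length F a b g < u p + d].
Proof.
move=> d0; have d2 : 0 < d / 2 by rewrite divr_gt0.
have [n Nn] := N0.
have l0 (q' p' : M) : lbound [set l | exists (a b : R) (g : R -> M),
    [/\ a < b, piecewise_C1 a b g, g a = q', g b = p' &
        l = curve_length F a b g]] 0.
  by move=> l [a' [b' [g' [_ _ _ _ ->]]]]; exact: length_ge0.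
have E0 q : [set l | exists (a b : R) (g : R -> M),
    [/\ a < b, piecewise_C1 a b g, g a = q, g b = p &
        l = curve_length F a b g]] !=set0.
  have [a [b [g [pg ga gb]]]] := connected_joined hconn q p.
  have [ab pc] := (pwP a b g).1 pg.
  by exists (curve_length F a b g), a, b, g.
have D0 : has_inf [set finsler_dist F q p | q in N].
  split; first by exists (finsler_dist F n p), n.
  by exists 0 => _ [q' _ <-]; apply: lb_le_inf => //; exact: l0.
have [_ [q Nq <-] dq] := inf_adherent d2 D0.
have LI : has_inf [set l | exists (a b : R) (g : R -> M),
    [/\ a < b, piecewise_C1 a b g, g a = q, g b = p &
        l = curve_length F a b g]].
  by split=> //; exists 0; exact: l0.
have [l [a [b [g [ab pc ga gb ->]]]] dl] := inf_adherent d2 LI.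
exists q, a, b, g; split=> //; first exact/pwP.
move: dl dq; rewrite -/(finsler_dist F q p) /u /dist_from; lra.
Qed.

Lemma dist_from_ge0 p : 0 <= u p.
Proof.
apply/ler_addgt0Pl => d d0; have [q [a [b [g [_ _ _ _ H]]]]] := dist_from_approx p d0.
by rewrite addrC (le_trans (length_ge0 F a b g))// ltW.
Qed.

Lemma dist_from_line c x y K : atlas c ->
  (forall s, 0 <= s <= 1 -> cod c (x + s *: (y - x))) ->
  (forall s, 0 <= s <= 1 -> Fc F c (x + s *: (y - x), y - x) <= K) ->
  u (psi c y) <= u (psi c x) + K.
Proof.
move=> Ac H HK; apply/ler_addgt0Pl => d d0.
have [q [a [b [g [Nq pg ga gb l1]]]]] := dist_from_approx (psi c x) d0.
have pl := line_pw b Ac H; have l2 := line_length b Ac H HK.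
have gl : g b = line c x y b b by rewrite line0.
have [_ _ p3] := pw_glue pg pl gl.
have := length_glue pg pl gl.
have := dist_from_le Nq p3; rewrite glue_left ?(ltW (pw_lt pg))// => /(_ (psi c y) ga).
rewrite glue_right ?lerDl// line1 => /(_ erefl); lra.
Qed.

End Distance.

(** * Deformations of curves *)

Section ContinuityRules.
Variable R : realType.

Lemma cts_add (T : topologicalType) (V : normedModType R) (f g : T -> V) x :
  continuous_at x f -> continuous_at x g -> continuous_at x (fun y => f y + g y).
Proof. exact: continuousD. Qed.

Lemma cts_opp (T : topologicalType) (V : normedModType R) (f : T -> V) x :
  continuous_at x f -> continuous_at x (fun y => - f y).
Proof. exact: continuousN. Qed.

Lemma cts_mul (T : topologicalType) (f g : T -> R) x :
  continuous_at x f -> continuous_at x g -> continuous_at x (fun y => f y * g y).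
Proof. by move=> cf cg; apply: cvgM. Qed.

Lemma cts_sub (T : topologicalType) (V : normedModType R) (f g : T -> V) x :
  continuous_at x f -> continuous_at x g -> continuous_at x (fun y => f y - g y).
Proof. exact: continuousB. Qed.

Lemma cts_scale (T : topologicalType) (V : normedModType R) (f : T -> R) (v : V) x :
  continuous_at x f -> continuous_at x (fun y => f y *: v).
Proof. by move=> cf; apply: cvgZl. Qed.

Lemma cts_subc (V : normedModType R) (z0 z : V) :
  continuous_at z (fun z => z - z0).
Proof. exact: cts_sub (@cts_id _ z) (@cts_cst _ _ z0 z). Qed.

End ContinuityRules.

(** * A C^1 bump function and the push maps built from it *)

Section Bump.
Variable R : realType.

(** Its C^1 regularity suffices: the second-order expansion of [push_ineq] is taken in the amplitude
    of the push, which enters affinely, and not in the space variable. *)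
Definition pos2 (x : R) : R := Num.max 0 x ^+ 2.

Lemma is_derive_pos2 (x : R) : is_derive x 1 pos2 (2 * Num.max 0 x).
Proof.
have [x0|x0|->] := ltgtP x 0.
- rewrite mulr0.
  apply: (@near_eq_is_derive _ _ _ (cst 0)).
    have x1 : 0 < - x by rewrite oppr_gt0.
    apply: (nbhsdP x1) => y /ltr_normlP[_ xy].
    by rewrite /pos2 max_l ?expr0n//; lra.
- apply: (@near_eq_is_derive R R R (fun y : R => y ^+ 2)).
    apply: (nbhsdP x0) => y /ltr_normlP[xy _].
    by rewrite /pos2 max_r//; lra.
  apply: is_derive_eq; have scE (a b : R) : a *: b = a * b by [].
  rewrite ?scE; ring.
rewrite mulr0.
have H : (fun h => h^-1 *: ((pos2 \o shift 0) (h *: 1) - pos2 0)) @ 0^' --> (0 : R).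
  apply/cvgrPdist_le => e e0; rewrite /dnbhs /within /prop_near1 /=.
  apply: (nbhsdP e0) => h; rewrite subr0 => he h0.
  rewrite sub0r normrN /pos2/= addr0 maxxx expr0n/= subr0 normrM normfV.
  rewrite [h *: 1]mulr1 normrX ler_pdivrMl ?normr_gt0//.
  have : `|Num.max 0 h| <= `|h|.
    by have [h1|h1] := leP 0 h; rewrite ?normr0.
  have := normr_ge0 (Num.max 0 h); rewrite expr2; nra.
by split; [apply: cvgP H|exact: cvg_lim H].
Qed.

Lemma pos2_ge0 x : 0 <= pos2 x.
Proof. exact: sqr_ge0. Qed.

Variable m : nat.
Variables (z0 : 'rV[R]_m) (r : R).

Definition bump (z : 'rV[R]_m) : R := pos2 (r ^+ 2 - sq (z - z0)).

Definition dbump (z v : 'rV[R]_m) : R :=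
  - (4 * Num.max 0 (r ^+ 2 - sq (z - z0)) * dot (z - z0) v).

Hypothesis r0 : 0 < r.

Lemma bump_ge0 z : 0 <= bump z.
Proof. exact: pos2_ge0. Qed.

Lemma bump_out z : r <= `|z - z0| -> bump z = 0 /\ forall v, dbump z v = 0.
Proof.
move=> rz; have H : Num.max 0 (r ^+ 2 - sq (z - z0)) = 0.
  apply: max_l; rewrite subr_le0 (le_trans _ (normr_sq _))//.
  by rewrite ler_sqr ?nnegrE ?(ltW r0)//.
by rewrite /bump /dbump /pos2 H expr0n; split=> // v; rewrite mulr0 mul0r oppr0.
Qed.

Lemma bump_center : bump z0 = r ^+ 4.
Proof.
rewrite /bump /pos2 subrr sq0 subr0 max_r ?sqr_ge0//.
by rewrite -exprM.
Qed.

Lemma max_bump_le z : Num.max 0 (r ^+ 2 - sq (z - z0)) <= r ^+ 2.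
Proof.
by rewrite ge_max sqr_ge0/= gerBl sq_ge0.
Qed.

Lemma bump_le z : bump z <= r ^+ 4.
Proof.
rewrite /bump /pos2 (_ : r ^+ 4 = (r ^+ 2) ^+ 2); last by rewrite -exprM.
rewrite ler_sqr ?nnegrE ?sqr_ge0 ?max_bump_le//.
by rewrite le_max lexx.
Qed.

Lemma dbump_le z v : `|dbump z v| <= 4 * r ^+ 2 * (m%:R * r) * `|v|.
Proof.
have [rz|zr] := leP r `|z - z0|.
  by have [_ ->] := bump_out rz; rewrite normr0 !mulr_ge0// ltW.
rewrite /dbump normrN normrM -mulrA ler_pM//.
  rewrite normrM ger0_norm// ler_pM2l// ger0_norm ?le_max ?lexx//.
  exact: max_bump_le.
rewrite (le_trans (dot_le _ _))// ler_wpM2r// ler_wpM2l//.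
exact: ltW.
Qed.

Lemma dbumpZ z a v : dbump z (a *: v) = a * dbump z v.
Proof. by rewrite /dbump dotZr; ring. Qed.

Lemma sq_bump_cts z : continuous_at z (fun z : 'rV[R]_m => r ^+ 2 - sq (z - z0)).
Proof.
have c2 : continuous_at z (fun z : 'rV[R]_m => z - z0).
  exact: cts_subc.
have c3 := cts_dot c2 c2.
exact: (cts_sub (@cts_cst _ R (r ^+ 2) z) c3).
Qed.

Lemma bump_cts z : continuous_at z bump.
Proof.
have H : continuous_at (r ^+ 2 - sq (z - z0)) pos2.
  apply: differentiable_continuous; apply/derivable1_diffP.
  by case: (is_derive_pos2 (r ^+ 2 - sq (z - z0))).
exact: (continuous_comp (@sq_bump_cts z) H).
Qed.

Lemma dbump_cts v z : continuous_at z (dbump^~ v).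
Proof.
have c2 : continuous_at z (fun z : 'rV[R]_m => z - z0).
  exact: cts_subc.
have c3 := cts_dot c2 (@cts_cst _ _ v z).
have c4 := @continuous_max _ _ (cst 0) _ z (@cts_cst _ R 0 z) (@sq_bump_cts z).
have c5 : continuous_at z (fun z : 'rV[R]_m =>
    4 * Num.max 0 (r ^+ 2 - sq (z - z0)) * dot (z - z0) v).
  exact: (cts_mul (cts_mul (@cts_cst _ R 4 z) c4) c3).
exact: (cts_opp c5).
Qed.

Lemma bump_derive z v : is_derive z v bump (dbump z v).
Proof.
pose s (h : R) : R := r ^+ 2 - sq (z + h *: v - z0).
have sE : s = (fun h => (r ^+ 2 - sq (z - z0)) + (- (2 * dot (z - z0) v)) * h -
    sq v * h ^+ 2).
  apply/funext => h; rewrite /s addrAC sqD sqZ dotZr; ring.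
have ds : is_derive (0 : R) 1 s (- (2 * dot (z - z0) v)).
  rewrite sE; apply: is_derive_eq.
  have scE (a b : R) : a *: b = a * b by [].
  by rewrite ?scE ?expr0n/=; ring.
have H : is_derive (0 : R) 1 (pos2 \o s)
    (2 * Num.max 0 (s 0) * - (2 * dot (z - z0) v)).
  by apply: is_derive1_comp; exact: is_derive_pos2.
have -> : dbump z v = 2 * Num.max 0 (s 0) * - (2 * dot (z - z0) v).
  by rewrite /dbump /s scale0r addr0; ring.
have E := derive_lineE bump z v 0; rewrite scale0r addr0 in E.
by case: H => H1 H2; split; [rewrite -E.1|rewrite -E.2].
Qed.

Definition push (k z : 'rV[R]_m) : 'rV[R]_m := z + bump z *: k.

Lemma push_derive k z v : is_derive z v (push k) (v + dbump z v *: k).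
Proof.
have D j : is_derive z v (fun z => push k z 0 j) (v 0 j + dbump z v * k 0 j).
  have D1 : is_derive z v (fun z : 'rV[R]_m => z 0 j) (v 0 j).
    have [d1 d2] := coordP (f := id) (v := v) j (@derivable_id _ _ z v).
    by split=> //; rewrite d2 derive_id.
  have H := is_deriveD D1 (is_deriveZ (k 0 j) (bump_derive z v)).
  rewrite mulrC; apply: near_eq_is_derive H.
  by apply: (@filterE _ (nbhs z)) => w; rewrite /push fctE !mxE [bump w * _]mulrC.
have d : derivable (push k) z v.
  by apply/derivable_mxP => i j; rewrite ord1; case: (D j).
split=> //; rewrite derive_mx//; apply/rowP => j; rewrite !mxE.
by case: (D j).
Qed.

Lemma push_Ck1 k : Ck 1 setT (push k).
Proof.
split.
  move=> z _; apply: (cts_add (@cts_id _ z)).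
  exact: (cts_scale (@bump_cts z)).
move=> v; split=> [z _|]; first by case: (push_derive k z v).
split=> // z _; have -> : 'D_v (push k) = (fun z => v + dbump z v *: k).
  by apply/funext => w; have H := push_derive k w v; rewrite derive_val.
apply: (cts_add (@cts_cst _ _ v z)).
exact: (cts_scale (@dbump_cts v z)).
Qed.

Lemma push_C1at k (g : R -> 'rV[R]_m) t : C1at g t ->
  C1at (push k \o g) t /\
  'D_1 (push k \o g) t = 'D_1 g t + dbump (g t) ('D_1 g t) *: k.
Proof.
move=> Cg; have [C D] := C1at_comp openT (push_Ck1 k) I Cg.
split=> //; rewrite D.
by have H := push_derive k (g t) ('D_1 g t); rewrite derive_val.
Qed.

Lemma push_out k z : r <= `|z - z0| -> push k z = z.
Proof. by move=> /bump_out[H _]; rewrite /push H scale0r addr0. Qed.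

Lemma push_ball k z : r ^+ 4 * `|k| <= r -> `|z - z0| <= r ->
  `|push k z - z0| <= 2 * r.
Proof.
move=> kr zr; rewrite /push addrAC (le_trans (ler_normD _ _))//.
rewrite normrZ (ger0_norm (bump_ge0 z)).
have : bump z * `|k| <= r ^+ 4 * `|k| by rewrite ler_wpM2r// bump_le.
by lra.
Qed.

End Bump.

(** * Push maps on the manifold and the lengths of pushed curves *)

Section Push.
Variables (R : realType) (m : nat) (M : smoothManifold R m) (F : finsler M).
Implicit Types (p q : M) (g h : R -> M) (a b t s : R) (k z v : 'rV[R]_m).

Lemma prod_basis n : exists (b : 'I_(n + n) -> 'rV[R]_n * 'rV[R]_n) e,
  basis_of_normed b e.
Proof.
exists (fun i => match fintype.split i with
  | inl j => (delta_mx 0 j, 0) | inr j => (0, delta_mx 0 j) end).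
exists (fun i (w : 'rV[R]_n * 'rV[R]_n) => match fintype.split i with inl j => w.1 0 j | inr j => w.2 0 j end).
move=> [w1 w2]; split.
  rewrite big_split_ord/=.
  under eq_bigr do rewrite -/(unsplit (inl _)) unsplitK.
  under [X in _ + X]eq_bigr do rewrite -/(unsplit (inr _)) unsplitK.
  rewrite [LHS](_ : _ = (w1, 0) + (0, w2)); last first.
    by congr (_, _); rewrite /= ?addr0 ?add0r.
  congr (_ + _).
    rewrite {1}(row_sum_delta w1).
    by elim/big_rec2: _ => // i y1 y2 _ <-; congr (_, _); rewrite /= scaler0 addr0.
  rewrite {1}(row_sum_delta w2).
  by elim/big_rec2: _ => // i y1 y2 _ <-; congr (_, _); rewrite /= scaler0 addr0.
move=> i; case: (fintype.split i) => j /=; rewrite [X in _ <= X]/Num.norm/= le_max normr_coord// orbT.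
by [].
Qed.

Variables (c : chart R m M) (z0 : 'rV[R]_m) (r : R).
Hypotheses (Ac : atlas c) (r0 : 0 < r).
Hypothesis ball_cod : [set z | `|z - z0| <= 2 * r] `<=` cod c.
Notation push := (push z0 r).
Notation bump := (bump z0 r).
Notation dbump := (dbump z0 r).

Lemma push_cod k z : r ^+ 4 * `|k| <= r -> cod c z -> cod c (push k z).
Proof.
move=> kr cz; have [zr|rz] := leP `|z - z0| r.
  by apply: ball_cod => /=; exact: push_ball.
by rewrite push_out// ltW.
Qed.

(** Pushed position and velocity are affine in the amplitude, so this is [taylor2] for [Fc] along a
    segment of the tangent bundle. Homogeneity reduces to |v| = 1, and the lower bound of F on unit
    vectors makes the error proportional to [Fc F c (z, v)], which is what can be integrated along a
    curve. *)
Lemma push_ineq : exists C d, [/\ 0 <= C, 0 < d, r ^+ 4 * d <= r &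
  forall z v k t, `|z - z0| <= r -> `|k| <= d -> 0 <= t <= 1 ->
  (1 - t) * Fc F c (push (- t *: k) z, v + dbump z v *: (- t *: k)) +
  t * Fc F c (push ((1 - t) *: k) z, v + dbump z v *: ((1 - t) *: k)) <=
  (1 + C * (t * (1 - t) * `|k| ^+ 2)) * Fc F c (z, v)].
Proof.
have r4 : 0 < r ^+ 4 by rewrite exprn_gt0.
pose Ldb : R := 4 * r ^+ 2 * (m%:R * r).
have Ldb0 : 0 <= Ldb by rewrite /Ldb !mulr_ge0// ?sqr_ge0// ltW.
(* The first term keeps the pushed points in the ball of radius 2 r; the second changes a unit
   velocity by at most 1/2. *)
pose d : R := Num.min (r / r ^+ 4) (1 / (2 * (Ldb + 1))).
have L1 : 0 < Ldb + 1 by rewrite ltr_wpDl.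
have d0 : 0 < d by rewrite lt_min !divr_gt0 ?mulr_gt0.
have d1 : r ^+ 4 * d <= r by rewrite mulrC -ler_pdivlMr// ge_min lexx.
have d2 : Ldb * d <= 1 / 2.
  have : d * (2 * (Ldb + 1)) <= 1 by rewrite -ler_pdivlMr ?mulr_gt0// ge_min lexx orbT.
  have := ltW d0; nra.
have Kc : [set z | `|z - z0| <= r] `<=` cod c.
  by move=> z /= zr; apply: ball_cod => /=; have := r0; lra.
have [a [b [a0 b0 ab]]] := Fc_bounds F Ac (@closed_ballP_compact _ _ z0 r) Kc.
have [bs [e be]] := prod_basis m.
pose A := [set xy : 'rV[R]_m * 'rV[R]_m | cod c xy.1 /\ xy.2 != 0].
have oA : open A by exact: Fc_open.
have C2 : Ck 2 A (Fc F c) by exact: Fc_Ck.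
(* A compact annulus containing all pushed unit velocities and avoiding 0, where F is not smooth. *)
pose S := [set v : 'rV[R]_m | `|v - 0| <= 3 / 2] `&` [set v | 1 / 2 <= `|v|].
have cS : compact S.
  apply: compact_closedI; first exact: closed_ballP_compact.
  have -> : [set v : 'rV[R]_m | 1 / 2 <= `|v|] = (fun v => `|v|) @^-1` [set y | 1 / 2 <= y] by [].
  apply: preimage_closed; last exact: closed_ge.
  by move=> y _; exact: norm_continuous.
have cK : compact ([set z | `|z - z0| <= 2 * r] `*` S).
  by apply: compact_setX => //; exact: closed_ballP_compact.
have KA : [set z | `|z - z0| <= 2 * r] `*` S `<=` A.
  move=> [z v] [/= zr [_ /= v1]]; split; first exact: ball_cod.
  by apply: contraTneq v1 => /= ->; rewrite normr0 -ltNge divr_gt0.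
have [M0 M00 HM] := hess_bound be oA C2 cK KA.
pose L : R := r ^+ 4 + Ldb.
have L0 : 0 <= L by rewrite addr_ge0// ltW.
exists (M0 * L ^+ 2 / a), d; split=> //.
  by rewrite !mulr_ge0 ?sqr_ge0 ?invr_ge0// ltW.
move=> z v k t zr kd /andP[t0 t1].
have kr s : -1 <= s <= 1 -> r ^+ 4 * `|s *: k| <= r.
  move=> s1; rewrite (le_trans _ d1)// ler_wpM2l ?(ltW r4)//.
  rewrite normrZ (le_trans _ kd)// ler_piMl//.
  by apply/ler_normlP; split; lra.
have cz : cod c z by exact: Kc.
have [->|v0] := eqVneq v 0.
  have H w : dbump z 0 *: w = 0 by rewrite /dbump dot0r mulr0 oppr0 scale0r.
  rewrite !H !addr0 !Fc0 ?mulr0 ?addr0//; apply: push_cod => //; apply: kr; lra.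
have nv : 0 < `|v| by rewrite normr_gt0.
have [v1 [nv1 vE]] : exists v1 : 'rV[R]_m, `|v1| = 1 /\ v = `|v| *: v1.
  exists (`|v|^-1 *: v); split; first exact: sphere_scale.
  by rewrite scalerA mulfV ?gt_eqF// scale1r.
have hom y w : cod c y -> Fc F c (y, v + dbump z v *: w) =
    `|v| * Fc F c (y, v1 + dbump z v1 *: w).
  by move=> cy; rewrite -Fc_hom// scalerDr scalerA -dbumpZ -vE.
rewrite !hom; [|by apply: push_cod => //; apply: kr; lra..].
have -> : Fc F c (z, v) = `|v| * Fc F c (z, v1) by rewrite -Fc_hom// -vE.
rewrite !(mulrCA _ `|v|) -mulrDr ler_pM2l//.
(* On the segment [X + s *: w], the values s = 0, t, 1 give the push by -t k, the unpushed pair, and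
   the push by (1 - t) k. *)
pose w : 'rV[R]_m * 'rV[R]_m := (bump z *: k, dbump z v1 *: k).
pose X : 'rV[R]_m * 'rV[R]_m := (push (- t *: k) z, v1 + dbump z v1 *: (- t *: k)).
have Xs s : X + s *: w = (push ((s - t) *: k) z, v1 + dbump z v1 *: ((s - t) *: k)).
  rewrite /X /w /push; congr (_, _) => /=.
    rewrite -addrA; congr (_ + _); rewrite !scalerA -scalerDl; congr (_ *: _); ring.
  rewrite -addrA; congr (_ + _); rewrite !scalerA -scalerDl; congr (_ *: _); ring.
have Lw : `|w| <= L * `|k|.
  have w1 : `|bump z *: k| <= L * `|k|.
    rewrite normrZ (ger0_norm (bump_ge0 _ _ _)) ler_wpM2r//.
    by rewrite (le_trans (bump_le _ _ _))// /L lerDl.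
  have w2 : `|dbump z v1 *: k| <= L * `|k|.
    rewrite normrZ ler_wpM2r// (le_trans (dbump_le _ r0 _ _))// nv1 mulr1.
    by rewrite /L lerDr ltW.
  by rewrite /Num.norm/= ge_max; apply/andP.
have dv s : -1 <= s <= 1 -> `|dbump z v1 *: (s *: k)| <= 1 / 2.
  move=> s1; rewrite !normrZ (le_trans _ d2)// ler_pM//.
    by rewrite (le_trans (dbump_le _ r0 _ _))// nv1 mulr1.
  by rewrite (le_trans _ kd)// ler_piMl//; apply/ler_normlP; split; lra.
have XK s : 0 <= s <= 1 -> ([set z | `|z - z0| <= 2 * r] `*` S) (X + s *: w).
  move=> /andP[s0 s1]; rewrite Xs; split=> /=.
    by apply: push_ball => //; apply: kr; lra.
  have st : -1 <= s - t <= 1 by lra.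
  have := dv _ st; set y := dbump _ _ *: _ => yn.
  split=> /=.
    by rewrite subr0 (le_trans (ler_normD _ _))// nv1; lra.
  have := lerB_normD v1 y; rewrite nv1; lra.
have t01 : 0 <= t <= 1 by rewrite t0.
have H1 s : 0 <= s <= 1 -> A (X + s *: w) by move=> /XK/KA.
have H2 s : 0 <= s <= 1 -> `|'D_w ('D_w (Fc F c)) (X + s *: w)| <= M0 * `|w| ^+ 2.
  by move=> /XK/HM; apply.
have /ler_normlP[_] := taylor2 C2 H1 H2 t01.
have -> : X + w = (push ((1 - t) *: k) z, v1 + dbump z v1 *: ((1 - t) *: k)).
  by rewrite -Xs scale1r.
have -> : X + t *: w = (z, v1).
  by rewrite Xs subrr !scale0r /push !scaler0 !addr0.
rewrite -/X => T.
have /andP[Fa _] := ab z v1 zr; rewrite nv1 mulr1 in Fa.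
have tt : 0 <= t * (1 - t) by rewrite mulr_ge0 ?subr_ge0.
rewrite [leRHS]mulrDl mul1r -lerBlDl (le_trans T)//.
apply: (le_trans (y := t * (1 - t) * (M0 * (L * `|k|) ^+ 2))).
  by rewrite ler_wpM2l// ler_wpM2l// lerXn2r ?nnegrE ?mulr_ge0.
have -> : t * (1 - t) * (M0 * (L * `|k|) ^+ 2) =
    M0 * L ^+ 2 / a * (t * (1 - t) * `|k| ^+ 2) * a by field; rewrite gt_eqF.
by rewrite ler_wpM2l// !mulr_ge0 ?sqr_ge0 ?invr_ge0// ?subr_ge0// ltW.
Qed.

Definition pushM k p : M :=
  if pselect (dom c p) then psi c (push k (phi c p)) else p.

Lemma pushM_in k p : dom c p -> pushM k p = psi c (push k (phi c p)).
Proof. by rewrite /pushM; case: pselect. Qed.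

Lemma pushM_notin k p : ~ dom c p -> pushM k p = p.
Proof. by rewrite /pushM; case: pselect. Qed.

Lemma pushM_out k p : (dom c p -> r <= `|phi c p - z0|) -> pushM k p = p.
Proof.
move=> H; have [cp|] := pselect (dom c p); last exact: pushM_notin.
by rewrite pushM_in// push_out ?phiKd//; exact: H.
Qed.

(** Hausdorff separation turns compactness into closedness; so [pushM] is the identity near every
    point outside the chart domain, and extending it by the identity keeps it C^1. *)
Lemma core_closed : closed (psi c @` [set z | `|z - z0| <= r]).
Proof.
apply: compact_closed; first exact: manifold_hausdorff.
apply: continuous_compact; last exact: closed_ballP_compact.
apply: continuous_in_subspaceT => z /set_mem/= zr; apply: psi_cts.
by apply: ball_cod => /=; have := r0; lra.
Qed.

Lemma pushM_near_notin k p : ~ dom c p -> \forall q \near p, pushM k q = q.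
Proof.
move=> ncp; have nK : (~` (psi c @` [set z | `|z - z0| <= r])) p.
  move=> [z /= zr zp]; apply: ncp; rewrite -zp; apply: dom_psi.
  by apply: ball_cod => /=; have := r0; lra.
have := open_nbhs_nbhs (conj (closed_openC core_closed) nK).
apply: filterS => q nKq; apply: pushM_out => cq; rewrite leNgt; apply/negP => qr.
by apply: nKq; exists (phi c q) => /=; [exact: ltW|exact: phiKd].
Qed.

Lemma pushM_C1M k g t : r ^+ 4 * `|k| <= r -> C1M g t ->
  C1M (pushM k \o g) t /\
  ((dom c (g t) -> let z := phi c (g t) in let v := 'D_1 (phi c \o g) t in
    speed F (pushM k \o g) t = Fc F c (push k z, v + dbump z v *: k)) /\
  (~ dom c (g t) -> speed F (pushM k \o g) t = speed F g t)).
Proof.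
move=> kr Cg; have [cg Cgc] := Cg.
have [cgt|ncgt] := pselect (dom c (g t)); last first.
  have n : \forall s \near t, g s = (pushM k \o g) s.
    have : \forall s \near t, pushM k (g s) = g s.
      exact: (cg _ (@pushM_near_notin k _ ncgt)).
    by apply: filterS => s /= ->.
  split; first exact: C1M_near n Cg.
  by split=> // _; symmetry; exact: speed_near.
have n1 : \forall s \near t, dom c (g s) by apply: cg; exact: near_dom.
have n2 : \forall s \near t, (push k \o (phi c \o g)) s = (phi c \o (pushM k \o g)) s.
  apply: filterS n1 => s cs /=; rewrite pushM_in// psiKd//.
  by apply: push_cod => //; exact: cod_phi.
have n3 : \forall s \near t, (psi c \o (push k \o (phi c \o g))) s = (pushM k \o g) s.
  by apply: filterS n1 => s cs /=; rewrite pushM_in.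
have [C1 D1] := @push_C1at _ _ z0 r k _ _ (Cgc c Ac cgt).
have [C2 D2] := C1at_near n2 C1.
have cp : cod c (push k (phi c (g t))) by apply: push_cod => //; exact: cod_phi.
have pc : chart_at ((pushM k \o g) t) c.
  by split=> //=; rewrite pushM_in//; exact: dom_psi.
have cM : continuous_at t (pushM k \o g).
  apply: near_eq_cts n3 _.
  have c1 : continuous_at t (push k \o (phi c \o g)).
    by apply: differentiable_continuous; apply/derivable1_diffP; exact: C1at_derivable.
  by apply: (continuous_comp c1); exact: psi_cts.
have CM := C1M_one cM pc C2.
split=> //; split=> // _; rewrite (C1M_speedE _ CM pc) -D2 D1.
by rewrite /= pushM_in// psiKd.
Qed.

Lemma pushM_seg k a b g : r ^+ 4 * `|k| <= r -> seg a b g -> seg a b (pushM k \o g).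
Proof.
move=> kr [h [H [ O oO [abO OC]]]].
exists (pushM k \o h); split.
  by move=> t /H[Ct ht]; split; [exact: (pushM_C1M kr Ct).1|rewrite /= ht].
by exists O => //; split=> // t /OC Ct; exact: (pushM_C1M kr Ct).1.
Qed.

Lemma pushM_pw k a b g : r ^+ 4 * `|k| <= r -> pw a b g -> pw a b (pushM k \o g).
Proof.
move=> kr; elim=> {a b g} [a b g ab gs|a e b g _ IH1 _ IH2].
  by apply: pw_seg => //; exact: pushM_seg.
exact: pw_cat IH1 IH2.
Qed.

(** [push_ineq] integrates because its error is proportional to the speed; outside the ball the
    three speeds coincide. [C] and [d] do not depend on the curve. *)
Lemma pushM_length : exists C d, [/\ 0 <= C, 0 < d, r ^+ 4 * d <= r &
  forall a b g k t, pw a b g -> `|k| <= d -> 0 <= t <= 1 ->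
  (1 - t) * curve_length F a b (pushM (- t *: k) \o g) +
  t * curve_length F a b (pushM ((1 - t) *: k) \o g) <=
  (1 + C * (t * (1 - t) * `|k| ^+ 2)) * curve_length F a b g].
Proof.
have [C [d [C0 d0 dr K]]] := push_ineq; exists C, d; split=> // a b g k t pg kd t01.
have kr s : -1 <= s <= 1 -> r ^+ 4 * `|s *: k| <= r.
  move=> s1; rewrite (le_trans _ dr)// ler_wpM2l ?exprn_ge0 ?(ltW r0)//.
  rewrite normrZ (le_trans _ kd)// ler_piMl//.
  by apply/ler_normlP; split; lra.
have k1 : r ^+ 4 * `|- t *: k| <= r by apply: kr; lra.
have k2 : r ^+ 4 * `|(1 - t) *: k| <= r by apply: kr; lra.
elim: pg => {a b g} [a b g ab gs|a e b g p1 IH1 p2 IH2]; last first.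
  rewrite (length_cat F (pushM_pw k1 p1) (pushM_pw k1 p2)).
  rewrite (length_cat F (pushM_pw k2 p1) (pushM_pw k2 p2)) (length_cat F p1 p2).
  move: IH1 IH2; move: (C * _) (curve_length F a e g) (curve_length F e b g).
  move: (curve_length F a e (pushM (- t *: k) \o g)).
  move: (curve_length F e b (pushM (- t *: k) \o g)).
  move: (curve_length F a e (pushM ((1 - t) *: k) \o g)).
  move: (curve_length F e b (pushM ((1 - t) *: k) \o g)).
  by move=> l1 l2 l3 l4 D l5 l6; lra.
have i1 := seg_itgb F ab (pushM_seg k1 gs).
have i2 := seg_itgb F ab (pushM_seg k2 gs).
have i0 := seg_itgb F ab gs.
change ((1 - t) * itg a b (speed F (pushM (- t *: k) \o g)) +
  t * itg a b (speed F (pushM ((1 - t) *: k) \o g)) <=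
  (1 + C * (t * (1 - t) * `|k| ^+ 2)) * itg a b (speed F g)).
rewrite -!itgZ// -itgD; [|exact: itgbZ..].
apply: itg_le => //; [by apply: itgbD; exact: itgbZ|exact: itgbZ|].
move=> s sab; have Cg := seg_in gs sab.
have [_ [d1 n1]] := pushM_C1M k1 Cg; have [_ [d2 n2]] := pushM_C1M k2 Cg.
have CC : 0 <= C * (t * (1 - t) * `|k| ^+ 2).
  by move/andP: t01 => [t0 t1]; rewrite !mulr_ge0 ?subr_ge0 ?sqr_ge0.
have s0 := speed_ge0 F g s.
have [cgs|ncgs] := pselect (dom c (g s)); last by rewrite n1// n2//; nra.
rewrite d1// d2//= (C1M_speedE _ Cg (conj Ac cgs)).
have [zr|rz] := leP `|phi c (g s) - z0| r; first exact: K.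
have [_ H] := bump_out r0 (ltW rz).
rewrite !push_out ?(ltW rz)// H !scale0r !addr0.
by rewrite -mulrDl subrK ler_wpM2r ?Fc_ge0// lerDl.
Qed.

End Push.

(** * Local estimates on the distance function *)

Section LocalEstimates.
Variables (R : realType) (m : nat) (M : smoothManifold R m) (F : finsler M).
Variable N : set M.
Hypotheses (hconn : connected [set: M]) (N0 : N !=set0) (Ncl : closed N).
Variable c : chart R m M.
Hypothesis Ac : atlas c.
Implicit Types (x y z v p : 'rV[R]_m) (a b t s : R).
Let uh (x : 'rV[R]_m) : R := dist_from F N (psi c x).

Lemma free_ball z0 : cod c z0 -> ~ N (psi c z0) -> exists2 r, 0 < r &
  [set z | `|z - z0| <= r] `<=` cod c `&` psi c @^-1` ~` N.
Proof.
move=> cz nz.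
have H : \forall z \near z0, cod c z /\ ~ N (psi c z).
  have n1 := near_cod cz.
  have n2 : \forall z \near z0, ~ N (psi c z).
    have nn : nbhs (psi c z0) (~` N).
      by apply: open_nbhs_nbhs; split=> //; exact: closed_openC.
    have pc := psi_cts cz; exact: (pc _ nn).
  exact: filterS2 n1 n2.
have [r r0 K] := nbhsPd H; exists (r / 2); first by rewrite divr_gt0.
by move=> z /= zr; apply: K; lra.
Qed.

Lemma uh_lip z0 r : 0 < r -> [set z | `|z - z0| <= r] `<=` cod c ->
  exists2 L, 0 < L & forall x y, `|x - z0| <= r -> `|y - z0| <= r ->
    `|uh x - uh y| <= L * `|x - y|.
Proof.
move=> r0 rc; have [a [b [a0 b0 ab]]] := Fc_bounds F Ac (@closed_ballP_compact _ _ z0 r) rc.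
exists b => // x y xr yr.
have half x' y' : `|x' - z0| <= r -> `|y' - z0| <= r ->
    uh y' <= uh x' + b * `|x' - y'|.
  move=> xr' yr'; apply: dist_from_line => // s s01.
    by apply: rc; exact: segment_ball.
  by rewrite distrC; have /andP[_] := ab _ (y' - x') (segment_ball xr' yr' s01).
have := half x y xr yr; have := half y x yr xr; rewrite (distrC y x).
by move=> h1 h2; apply/ler_normlP; split; lra.
Qed.

(* Moving all the curves from [N] to a point by the diffeomorphisms [pushM]
   compares the values of the distance at three aligned points. *)
Lemma uh_semiconcave z0 : cod c z0 -> ~ N (psi c z0) ->
  exists r C, [/\ 0 < r, 0 <= C,
    [set z | `|z - z0| <= r] `<=` cod c `&` psi c @^-1` ~` N &
    forall x y t, `|x - z0| < r -> `|y - z0| < r -> 0 <= t <= 1 ->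
      (1 - t) * uh x + t * uh y - uh ((1 - t) *: x + t *: y) <=
      C * (t * (1 - t) * sq (x - y))].
Proof.
move=> cz nz; have [r1 r10 free] := free_ball cz nz.
pose r : R := r1 / 2; have r0 : 0 < r by rewrite divr_gt0.
have r2 : 2 * r = r1 by rewrite /r; field.
have bc : [set z | `|z - z0| <= 2 * r] `<=` cod c.
  by rewrite r2 => z /free[].
have [C [d [C0 d0 dr K]]] := pushM_length F Ac r0 bc.
(* The pushed curves still start in [N], since the supporting ball avoids [N]; they compete for the
   distance to the pushed endpoints. *)
have raw q t k : dom c q -> `|k| <= d -> 0 <= t <= 1 ->
    (1 - t) * dist_from F N (pushM c z0 r (- t *: k) q) +
    t * dist_from F N (pushM c z0 r ((1 - t) *: k) q) <=
    (1 + C * (t * (1 - t) * `|k| ^+ 2)) * dist_from F N q.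
  move=> cq kd t01; apply/ler_addgt0Pl => e e0.
  have /andP[t0 t1] := t01.
  pose D : R := 1 + C * (t * (1 - t) * `|k| ^+ 2).
  have D0 : 0 < D.
    by rewrite ltr_pwDl// mulr_ge0// mulr_ge0 ?sqr_ge0// mulr_ge0 ?subr_ge0.
  have eD : 0 < e / D by rewrite divr_gt0.
  have [n [a [b [g [Nn pg ga gb lg]]]]] := dist_from_approx F hconn N0 q eD.
  have kr s : -1 <= s <= 1 -> r ^+ 4 * `|s *: k| <= r.
    move=> s1; rewrite (le_trans _ dr)// ler_wpM2l ?exprn_ge0 ?(ltW r0)//.
    rewrite normrZ (le_trans _ kd)// ler_piMl//.
    by apply/ler_normlP; split; lra.
  have le_push s : -1 <= s <= 1 -> dist_from F N (pushM c z0 r (s *: k) q) <=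
      curve_length F a b (pushM c z0 r (s *: k) \o g).
    move=> s1; have pp := pushM_pw F Ac r0 bc (kr _ s1) pg.
    apply: (dist_from_le F Nn pp) => /=; last by rewrite gb.
    rewrite ga; apply: pushM_out => // cn.
    rewrite leNgt; apply/negP => nr.
    have [_] : (cod c `&` psi c @^-1` ~` N) (phi c n).
      by apply: free; rewrite /= -r2; have := r0; lra.
    by rewrite /= phiKd.
  have t1' : -1 <= - t <= 1 by lra.
  have t2' : -1 <= 1 - t <= 1 by lra.
  have h4 : D * curve_length F a b g <= D * dist_from F N q + e.
    have -> : D * dist_from F N q + e = D * (dist_from F N q + e / D).
      by field; rewrite gt_eqF.
    by rewrite ler_pM2l// ltW.
  have comb (A1 A2 l1 l2 l3 u0 : R) : A1 <= l1 -> A2 <= l2 ->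
      (1 - t) * l1 + t * l2 <= D * l3 -> D * l3 <= D * u0 + e ->
      (1 - t) * A1 + t * A2 <= e + D * u0.
    have t1'' : 0 <= 1 - t by rewrite subr_ge0.
    move=> /(ler_wpM2l t1'') a1 /(ler_wpM2l t0) a2.
    by rewrite addrC; move: (D * l3) (D * u0) => w1 w2; lra.
  exact: comb (le_push _ t1') (le_push _ t2') (K _ _ _ _ _ pg kd t01) h4.
have bz0 : bump z0 r z0 = r ^+ 4 by exact: bump_center.
have r4 : 0 < r ^+ 4 by rewrite exprn_gt0.
(* Near [z0] the bump stays above half its maximum [r ^+ 4], so it can be divided by when
   prescribing the displacement of [w]. *)
have [e e0 be] := (ctsP _ _).1 (@bump_cts _ _ z0 r z0) _ (divr_gt0 r4 (ltr0Sn R 1)).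
have [L L0 HL] := uh_lip r10 (fun z zr => (free z zr).1).
pose r3 : R := Num.min (Num.min r e) (d * r ^+ 4 / 4).
have r30 : 0 < r3 by rewrite !lt_min r0 e0 !divr_gt0// mulr_gt0.
have [r3r r3e r3d] : [/\ r3 <= r, r3 <= e & r3 * 4 <= d * r ^+ 4].
  by split; rewrite -?ler_pdivlMr// /r3 !ge_min lexx ?orbT.
(* A bound of the distance on the ball, which turns the multiplicative error of [raw] into an
   additive one. *)
pose B : R := uh z0 + L * r.
have B0 : 0 <= B.
  apply: addr_ge0; first exact: (dist_from_ge0 F hconn N0).
  by rewrite mulr_ge0// ltW.
exists r3, (C * (2 / r ^+ 4) ^+ 2 * B); split=> //.
- by rewrite !mulr_ge0// ?invr_ge0 ltW.
- by move=> z /= zr; apply: free => /=; rewrite -r2; lra.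
move=> x y t xr yr t01; set w := (1 - t) *: x + t *: y.
have wr : `|w - z0| < r3 by exact: ball_avg.
have cw : cod c w by apply: bc => /=; lra.
have bw : r ^+ 4 / 2 < bump z0 r w.
  have := be w (lt_le_trans wr r3e); rewrite bz0 => /ltr_normlP[]; lra.
have bw0 : 0 < bump z0 r w by have := r4; lra.
(* With this normalization the two pushes take [w] exactly to [x] and to [y]. *)
pose k := (bump z0 r w)^-1 *: (y - x).
have kn : `|k| <= 2 / r ^+ 4 * `|y - x|.
  rewrite normrZ ler_wpM2r// ger0_norm ?invr_ge0 ?(ltW bw0)//.
  rewrite -[2 / _]invrK lef_pV2 ?posrE ?invr_gt0 ?divr_gt0// invf_div.
  exact: ltW.
have yx : `|y - x| <= 2 * r3.
  have -> : y - x = (y - z0) - (x - z0) by rewrite opprB addrA subrK.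
  rewrite (le_trans (ler_normB _ _))//; lra.
have kd : `|k| <= d.
  rewrite (le_trans kn)// mulrAC ler_pdivrMr//; lra.
have push_s s : pushM c z0 r (s *: k) (psi c w) = psi c (w + s *: (y - x)).
  rewrite pushM_in; last exact: dom_psi.
  rewrite psiKd// /push /k !scalerA; congr (psi c (_ + _ *: _)).
  by rewrite mulrAC mulfV ?mul1r// gt_eqF.
have := raw (psi c w) t k (dom_psi cw) kd t01.
rewrite !push_s.
have -> : w + - t *: (y - x) = x.
  by rewrite /w; apply/rowP => j; rewrite !mxE; ring.
have -> : w + (1 - t) *: (y - x) = y.
  by rewrite /w; apply/rowP => j; rewrite !mxE; ring.
rewrite -/(uh x) -/(uh y) -/(uh w) => H0.
have H : (1 - t) * uh x + t * uh y - uh w <= C * (t * (1 - t) * `|k| ^+ 2) * uh w by lra.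
have /andP[t0 t1] := t01.
have tt : 0 <= t * (1 - t) by rewrite mulr_ge0 ?subr_ge0.
have wB : uh w <= B.
  have z0r : `|z0 - z0| <= r1 by rewrite subrr normr0 ltW.
  have wr1 : `|w - z0| <= r1 by rewrite -r2; lra.
  have /ler_normlP[_ H1] := HL _ _ wr1 z0r.
  have : L * `|w - z0| <= L * r by rewrite ler_pM2l//; lra.
  rewrite /B; lra.
have uw0 : 0 <= uh w := dist_from_ge0 F hconn N0 (psi c w).
apply: (le_trans H).
have -> : C * (2 / r ^+ 4) ^+ 2 * B * (t * (1 - t) * sq (x - y)) =
    C * (t * (1 - t) * ((2 / r ^+ 4) ^+ 2 * sq (x - y))) * B by ring.
rewrite ler_pM// ?mulr_ge0 ?subr_ge0 ?sqr_ge0//.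
rewrite ler_wpM2l// ler_wpM2l//.
apply: (le_trans (y := (2 / r ^+ 4 * `|y - x|) ^+ 2)).
  by rewrite lerXn2r ?nnegrE// mulr_ge0// divr_ge0// ltW.
by rewrite exprMn ler_wpM2l ?sqr_ge0// distrC normr_sq.
Qed.

(** Compare with the point x - s v: returning to [x] along the segment costs about s F(x, v), while
    the paraboloid makes the distance smaller there by s p.v up to O(s^2). Divide by s. *)
Lemma supergradient_le x p C d : cod c x -> 0 < d ->
  (forall y, `|y - x| < d -> uh y <= uh x + dot p (y - x) + C * sq (y - x)) ->
  forall v, dot p v <= Fc F c (x, v).
Proof.
move=> cx d0 H v; apply/ler_addgt0Pl => e e0.
have e3 : 0 < e / 2 by rewrite divr_gt0.
have [r r0 rc] := cod_ball cx.
have [d1 d10 Fcx] := (ctsP _ _).1 (@Fc_cts _ _ _ F c x v Ac cx) _ e3.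
pose K : R := `|C| * sq v + 1.
have K0 : 0 < K by rewrite ltr_wpDl// mulr_ge0// sq_ge0.
pose V : R := `|v| + 1.
have V0 : 0 < V by rewrite ltr_wpDl.
pose s : R := Num.min (Num.min (d / V / 2) (r / V)) (Num.min (d1 / V / 2) (e / 2 / K)).
have s0 : 0 < s by rewrite !lt_min !divr_gt0.
have [s1 s2 s3 s4] : [/\ s * V < d, s * V <= r, s * V < d1 & s * K <= e / 2].
  have H0 a b : 0 < b -> s <= a / b -> s * b <= a by move=> b0; rewrite ler_pdivlMr.
  have sV : 0 < s * V by rewrite mulr_gt0.
  split.
  - have : s <= (d / 2) / V by rewrite /s !ge_min mulrAC lexx.
    by move=> /(H0 _ _ V0); lra.
  - by apply: H0 => //; rewrite /s !ge_min lexx ?orbT.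
  - have : s <= (d1 / 2) / V by rewrite /s !ge_min [d1 / 2 / V]mulrAC lexx ?orbT.
    by move=> /(H0 _ _ V0); lra.
  - by apply: H0 => //; rewrite /s !ge_min lexx ?orbT.
have sv : s * `|v| <= s * V by rewrite ler_pM2l// /V lerDl.
pose y := x - s *: v.
have yx : `|y - x| = s * `|v|.
  by rewrite /y addrAC subrr add0r normrN normrZ gtr0_norm.
have nb q : 0 <= q <= 1 -> `|y + q *: (x - y) - x| <= s * `|v|.
  move=> q01; apply: segment_ball => //; first by rewrite yx.
  by rewrite subrr normr0 mulr_ge0// ltW.
have xy : x - y = s *: v by rewrite /y opprB addrC subrK.
have Hl : uh x <= uh y + s * (Fc F c (x, v) + e / 2).
  apply: dist_from_line => // q q01.
    by apply: rc => /=; rewrite (le_trans (nb _ q01))// (le_trans sv).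
  have cq : cod c (y + q *: (x - y)).
    by apply: rc => /=; rewrite (le_trans (nb _ q01))// (le_trans sv).
  rewrite {2}xy Fc_hom ?(ltW s0)// ler_pM2l//.
  have : `|(y + q *: (x - y), v) - (x, v)| < d1.
    have vv : `|v - v| < d1 by rewrite subrr normr0.
    rewrite /Num.norm/= gt_max; apply/andP; split; last exact: vv.
    exact: le_lt_trans (nb _ q01) (le_lt_trans sv s3).
  by move=> /Fcx/ltr_normlP[]; lra.
have := H y; rewrite yx => /(_ (le_lt_trans sv s1)).
have -> : y - x = - (s *: v) by rewrite -xy opprB.
rewrite dotNr dotZr sqN sqZ => Hu.
rewrite -(ler_pM2l s0).
have C1 : C * (s ^+ 2 * sq v) <= s * (s * (`|C| * sq v)).
  rewrite expr2 !mulrA [C * s * s]mulrC -!mulrA ler_wpM2l ?(ltW s0)//.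
  by rewrite mulrCA !mulrA ler_wpM2r ?sq_ge0// ler_wpM2l ?(ltW s0)// ler_norm.
have : s * (s * (`|C| * sq v)) <= s * (e / 2).
  rewrite ler_pM2l// (le_trans _ s4)// ler_pM2l// /K lerDl; lra.
lra.
Qed.

(** A calibration argument: integrate the derivative of [W] along the curve, using dW <= F at the
    points of the region [B]. *)
Lemma pw_FTC (W : 'rV[R]_m -> R) (B : set 'rV[R]_m) a b g :
  Ck 1 setT W -> (forall z v, B z -> 'D_v W z <= Fc F c (z, v)) ->
  pw a b g -> (forall t, a <= t <= b -> dom c (g t) /\ B (phi c (g t))) ->
  W (phi c (g b)) - W (phi c (g a)) <= curve_length F a b g.
Proof.
move=> CW WF pg; elim: pg => {a b g} [a b g ab gs H|a e b g p1 IH1 p2 IH2 H].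
  have [h [Hh [ O oO [abO OC]]]] := gs.
  pose k t := W (phi c (h t)).
  have dh t : a <= t <= b -> dom c (h t) /\ B (phi c (h t)).
    by move=> tab; have [_ ->] := Hh t tab; exact: H.
  have Ck t : O t -> dom c (h t) -> C1at k t /\
      'D_1 k t = 'D_('D_1 (phi c \o h) t) W (phi c (h t)).
    move=> Ot ct; have [_ /(_ c Ac ct) Cp] := OC t Ot.
    exact: (C1at_compR openT CW _ Cp).
  have abi : [set` `[a, b]] `<=` [set t | a <= t <= b].
    by move=> t /=; rewrite in_itv.
  have K1 : itg a b ('D_1 k) = k b - k a.
    apply: itg_FTC => //.
    - apply: continuous_in_subspaceT => t /set_mem/abi/= tab.
      by have [[_ +] _] := Ck t (abO t tab) (dh t tab).1.
    - apply: continuous_in_subspaceT => t /set_mem/abi/= tab.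
      have [Ct _] := Ck t (abO t tab) (dh t tab).1.
      apply: differentiable_continuous; apply/derivable1_diffP.
      exact: C1at_derivable.
    - move=> t /andP[/ltW ta /ltW tb].
      have tab : a <= t <= b by rewrite ta.
      have [Ct _] := Ck t (abO t tab) (dh t tab).1.
      by split=> //; exact: C1at_derivable.
  have kE t : a <= t <= b -> W (phi c (g t)) = k t.
    by move=> tab; rewrite /k; have [_ ->] := Hh t tab.
  have ab' := ltW ab.
  rewrite (kE b) ?lexx ?andbT// (kE a) ?lexx// -K1; apply: itg_le => //.
  - apply: itgb_cts; apply: continuous_in_subspaceT => t /set_mem/abi/= tab.
    by have [[_ +] _] := Ck t (abO t tab) (dh t tab).1.
  - exact: seg_itgb.
  - move=> t tab; have tab' : a <= t <= b by move/andP: tab => [/ltW-> /ltW->].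
    have [ct Bt] := dh t tab'; have [_ ->] := Ck t (abO t tab') ct.
    have [Ch hg] := Hh t tab'.
    have Cg := seg_in gs tab.
    have -> : 'D_1 (phi c \o h) t = 'D_1 (phi c \o g) t.
      apply: near_eq_derive; apply: filterS (near_itv tab) => s /andP[/ltW sa /ltW sb].
      by rewrite /=; have [|_ ->//] := Hh s; rewrite sa.
    rewrite hg in ct Bt *.
    rewrite -[X in _ <= X]/(speed F g t) (C1M_speedE F Cg (conj Ac ct)).
    exact: WF.
have [ac cb] := (ltW (pw_lt p1), ltW (pw_lt p2)).
rewrite (length_cat F p1 p2).
have h1 : W (phi c (g e)) - W (phi c (g a)) <= curve_length F a e g.
  by apply: IH1 => t /andP[t1 t2]; apply: H; rewrite t1 (le_trans t2).
have h2 : W (phi c (g b)) - W (phi c (g e)) <= curve_length F e b g.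
  by apply: IH2 => t /andP[t1 t2]; apply: H; rewrite t2 (le_trans _ t1).
lra.
Qed.

(** [e] is the supremum of the times spent outside the open ball. That [g e] still lies in the chart
    domain, on the sphere, follows from the closed ball having a compact, hence closed, image in the
    Hausdorff manifold. *)
Lemma last_exit a b g x r : pw a b g -> 0 < r ->
  [set z | `|z - x| <= r] `<=` cod c -> g b = psi c x ->
  ~ (psi c @` [set z | `|z - x| <= r]) (g a) ->
  exists2 e, a < e < b & `|phi c (g e) - x| = r /\
    forall t, e <= t <= b -> dom c (g t) /\ `|phi c (g t) - x| <= r.
Proof.
move=> pg r0 rc gb nga; have ab := pw_lt pg.
pose A := dom c `&` [set q | `|phi c q - x| < r].
have oA : open A.
  rewrite openE => q [cq qr].
  have n2 : \forall q' \near q, `|phi c q' - x| < r.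
    have : \forall z \near phi c q, `|z - x| < r.
      have cz := @cts_subc _ _ x (phi c q).
      have H : continuous_at (phi c q) (fun z => `|z - x|).
        by apply: (continuous_comp cz); exact: norm_continuous.
      exact: (H _ (lt_nbhsl qr)).
    by move/(phi_cts cq).
  exact: filterS2 (near_dom cq) n2.
have cx : cod c x by apply: rc; rewrite /= subrr normr0 ltW.
have Ab : A (g b) by rewrite gb; split; [exact: dom_psi|rewrite /= psiKd// subrr normr0].
have AC q : A q -> (psi c @` [set z | `|z - x| <= r]) q.
  by move=> [cq /ltW qr]; exists (phi c q) => //; exact: phiKd.
have cg := pw_cts pg.
pose S := [set t | a <= t <= b /\ ~ A (g t)].
have Sa : S a by split; [rewrite lexx ltW|move=> /AC].
have supS : has_sup S by split; [exists a|exists b => t [/andP[]]].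
pose e := sup S.
have ae : a <= e by exact: (sup_upper_bound supS) Sa.
have eb' : e <= b by apply: ge_sup => //; [exists a|move=> t [/andP[]]].
have eab : [set` `[a, b]] e by rewrite /= in_itv/= ae.
have cge : g t @[t --> within [set` `[a, b]] (nbhs e)] --> g e.
  by move/subspace_continuousP: cg; apply.
have nAe : ~ A (g e).
  move=> Ae; have : \forall t \near within [set` `[a, b]] (nbhs e), A (g t).
    have oAe : nbhs (g e) A by exact: open_nbhs_nbhs.
    exact: (cge _ oAe).
  rewrite near_withinE => /nbhsPd[d d0 K].
  have [t St et] := sup_adherent d0 supS.
  have te : t <= e by exact: (sup_upper_bound supS) St.
  have [tab nt] := St; apply: nt; apply: K; last by rewrite /= in_itv.
  by rewrite ler0_norm ?subr_le0//; move: et; rewrite -/e; lra.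
have eb : e < b.
  by rewrite lt_neqAle eb' andbT; apply: contra_notN nAe => /eqP ->.
have At t : e < t -> t <= b -> A (g t).
  move=> et tb; apply: contrapT => nt.
  suff : t <= e by rewrite leNgt et.
  by apply: (sup_upper_bound supS); split=> //; rewrite tb andbT (le_trans ae)// ltW.
have Ce : (psi c @` [set z | `|z - x| <= r]) (g e).
  apply: contrapT => nCe.
  have clC : closed (psi c @` [set z | `|z - x| <= r]).
    apply: compact_closed; first exact: manifold_hausdorff.
    apply: continuous_compact; last exact: closed_ballP_compact.
    by apply: continuous_in_subspaceT => z /set_mem/= zr; apply: psi_cts; exact: rc.
  have : \forall t \near within [set` `[a, b]] (nbhs e),
      ~ (psi c @` [set z | `|z - x| <= r]) (g t).
    have oC : nbhs (g e) (~` (psi c @` [set z | `|z - x| <= r])).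
      by apply: open_nbhs_nbhs; split=> //; exact: closed_openC.
    exact: (cge _ oC).
  rewrite near_withinE => /nbhsPd[d d0 K].
  pose t := Num.min b (e + d / 2).
  have et : e < t by rewrite lt_min eb/= ltrDl divr_gt0.
  have tb : t <= b by rewrite /t ge_min lexx.
  have td : t <= e + d / 2 by rewrite /t ge_min lexx orbT.
  have : ~ (psi c @` [set z | `|z - x| <= r]) (g t).
    apply: K; last by rewrite /= in_itv/= tb andbT (le_trans ae)// ltW.
    by rewrite gtr0_norm ?subr_gt0//; lra.
  by apply; apply: AC; exact: At.
have [z zr zge] := Ce.
have cz : cod c z by exact: rc.
have ce : dom c (g e) by rewrite -zge; exact: dom_psi.
have ze : phi c (g e) = z by rewrite -zge psiKd.
exists e.
  rewrite eb andbT lt_neqAle ae andbT; apply: contra_notN nga => /eqP ->.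
  exact: Ce.
split.
  apply/le_anti; rewrite ze zr/= leNgt; apply/negP => zr'.
  by apply: nAe; split=> //; rewrite /= ze.
move=> t /andP[]; rewrite le_eqVlt => /predU1P[<- _|et tb]; first by rewrite ze.
by have [? /ltW] := At t et tb.
Qed.

Lemma paraboloid_Ck1 x p k : Ck 1 setT (fun z => dot p (z - x) - k * sq (z - x)) /\
  forall z v, 'D_v (fun z => dot p (z - x) - k * sq (z - x)) z =
    dot p v - 2 * k * dot (z - x) v.
Proof.
set W := fun z => _.
have D z v : is_derive z v W (dot p v - 2 * k * dot (z - x) v).
  pose s (h : R) : R := W (z + h *: v).
  have sE : s = (fun h => W z + (dot p v - 2 * k * dot (z - x) v) * h -
      (k * sq v) * h ^+ 2).
    apply/funext => h; rewrite /s /W [z + h *: v - x]addrAC (sqD (z - x)) sqZ (dotDr _ (z - x)) !dotZr; ring.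
  have ds : is_derive (0 : R) 1 s (dot p v - 2 * k * dot (z - x) v).
    rewrite sE; move: (W z) (dot p v - _) (k * sq v) => w0 w1 w2.
    apply: is_derive_eq; have scE (a b : R) : a *: b = a * b by [].
    by rewrite ?scE ?expr0n/=; ring.
  have [E1 E2] := derive_lineE W z v 0; rewrite scale0r addr0 in E1 E2.
  by case: ds => ds1 ds2; split; rewrite -?E1 -?E2.
have DE v : 'D_v W = fun z => dot p v - 2 * k * dot (z - x) v.
  by apply/funext => z; case: (D z v).
split=> [|z v]; last exact: (congr1 (fun h => h z) (DE v)).
have cW z : continuous_at z W.
  have c2 := @cts_subc _ _ x z.
  exact: (cts_sub (cts_dot (@cts_cst _ _ p z) c2) (cts_mul (@cts_cst _ R k z) (cts_dot c2 c2))).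
split=> [z _|v]; first exact: cW.
split=> [z _|]; first by case: (D z v).
split=> // z _; rewrite DE; have c2 := @cts_subc _ _ x z.
exact: (cts_sub (@cts_cst _ R _ z) (cts_mul (@cts_cst _ R (2 * k) z) (cts_dot c2 (@cts_cst _ _ v z)))).
Qed.

(* Near [x], the distance to the last point at which an almost minimizing
   curve crosses a small sphere is controlled from below by the fundamental
   theorem of calculus. *)
Lemma touching x p K d : cod c x -> ~ N (psi c x) -> 0 < d ->
  (forall y, `|y - x| < d -> uh x + dot p (y - x) - K * sq (y - x) <= uh y) ->
  exists2 v, sphere v & Fc F c (x, v) <= dot p v.
Proof.
move=> cx nx d0 H; apply: contrapT => nv.
have lt_v v : sphere v -> dot p v < Fc F c (x, v).
  by move=> sv; rewrite ltNge; apply: contra_notN nv => Hv; exists v.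
(* Compactness of the sphere makes the strict inequality at [x] a uniform gap, valid at nearby
   points too; the gap absorbs the gradient of the quadratic part of [W]. *)
have [e e0 He] : exists2 e, 0 < e & forall z v, `|z - x| <= e -> sphere v ->
    dot p v + e <= Fc F c (z, v).
  have /compact_near_coveringP cS := @sphere_compact R m.
  have : \forall e \near (0 : R)^'+, @sphere R m `<=`
      [set v | forall z, `|z - x| <= e -> dot p v + e <= Fc F c (z, v)].
    apply: cS => v sv.
    pose q := (Fc F c (x, v) - dot p v) / 3.
    have q0 : 0 < q by rewrite divr_gt0// subr_gt0 lt_v.
    have [d1 d10 K1] := (ctsP _ _).1 (Fc_cts (F := F) (v := v) Ac cx) _ q0.
    have [d2 d20 K2] := (ctsP _ _).1 (@dot_continuous _ _ p v) _ q0.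
    pose d3 := Num.min q d1.
    have d30 : 0 < d3 by rewrite lt_min q0.
    exists ([set w | `|w - v| < Num.min d1 d2], [set e | 0 < e < d3]).
      split=> /=.
        have d120 : 0 < Num.min d1 d2 by rewrite lt_min d10.
        exact: (nbhsdP d120).
      have n1 : \forall e \near (0 : R)^'+, 0 < e by exact: nbhs_right_gt.
      have n2 : \forall e \near (0 : R)^'+, e < d3 by exact: nbhs_right_lt.
      by apply: filterS2 n1 n2 => q' /= -> ->.
    move=> [w e] /= [wd /andP[e0 ed]] z ze.
    move: wd ed; rewrite !lt_min => /andP[wd1 wd2] /andP[eq ed1].
    have /K1/ltr_normlP[k1 _] : `|(z, w) - (x, v)| < d1.
      by rewrite /Num.norm/= gt_max wd1 andbT (le_lt_trans ze).
    have /ltr_normlP[_ k2] := K2 w wd2.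
    have q3 : q * 3 = Fc F c (x, v) - dot p v by rewrite /q mulfVK.
    lra.
  have n1 : \forall e \near (0 : R)^'+, 0 < e by exact: nbhs_right_gt.
  move=> n2; have [e [e0 He]] := filter_ex (filterI n1 n2).
  by exists e => // z v ze sv; exact: He sv z ze.
have [r1 r10 free] := free_ball cx nx.
(* One unit more than |K|: on the sphere |z - x| = r, the calibration by [W] then yields a length of
   at least [uh x + r ^+ 2], against a curve chosen shorter than that. *)
pose k := `|K| + 1.
have k0 : 0 < k by rewrite ltr_wpDl.
pose n : R := m%:R + 1.
have n0 : 0 < n by rewrite ltr_wpDl.
pose r := Num.min (Num.min r1 (d / 2)) (Num.min e (e / (2 * k * n))).
have r0 : 0 < r by rewrite !lt_min r10 e0 !divr_gt0// !mulr_gt0.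
have [rr1 rd re rk] : [/\ r <= r1, r <= d / 2, r <= e & r * (2 * k * n) <= e].
  by split; rewrite -?ler_pdivlMr ?mulr_gt0// /r !ge_min lexx ?orbT.
have rc : [set z | `|z - x| <= r] `<=` cod c.
  by move=> z /= zr; have [] := free z (le_trans zr rr1).
have [CW DW] := paraboloid_Ck1 x p k.
set W := fun z => dot p (z - x) - k * sq (z - x) in CW DW.
have WF z v : `|z - x| <= r -> 'D_v W z <= Fc F c (z, v).
  move=> zr; rewrite DW.
  have [->|v0] := eqVneq v 0.
    by rewrite !dot0r mulr0 subrr; exact: Fc_ge0.
  have zc := rc z zr.
  have nv0 : 0 < `|v| by rewrite normr_gt0.
  have := He z _ (le_trans zr re) (sphere_scale v0).
  rewrite dotZr Fc_hom ?invr_ge0 ?(ltW nv0)//.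
  rewrite -(ler_pM2l nv0) mulrDr !mulVKf ?gt_eqF// => h1.
  have h2 := dot_le (z - x) v.
  have h3 : 2 * k * `|dot (z - x) v| <= `|v| * e.
    apply: (le_trans (y := `|v| * (r * (2 * k * n)))); last by rewrite ler_pM2l.
    have -> : `|v| * (r * (2 * k * n)) = 2 * k * (n * r * `|v|) by ring.
    rewrite ler_pM2l ?mulr_gt0//; apply: (le_trans h2).
    by rewrite ler_wpM2r ?(ltW nv0)// ler_pM// /n lerDl.
  have h4 : - (2 * k * dot (z - x) v) <= 2 * k * `|dot (z - x) v|.
    by rewrite -mulrN ler_pM2l ?mulr_gt0// -normrN ler_norm.
  lra.
have r20 : 0 < r ^+ 2 by rewrite exprn_gt0.
have [q [a [b [g [Nq pg ga gb lg]]]]] := dist_from_approx F hconn N0 (psi c x) r20.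
have nga : ~ (psi c @` [set z | `|z - x| <= r]) (g a).
  rewrite ga => -[z /= zr zq]; have [_] := free z (le_trans zr rr1).
  by rewrite /= zq.
have [t /andP[at_ tb] [tr tI]] := last_exit pg r0 rc gb nga.
have p1 : pw a t g by apply: pw_left pg _; rewrite at_ ltW.
have p2 : pw t b g by apply: pw_right pg _; rewrite tb ltW.
have [ct _] : dom c (g t) /\ `|phi c (g t) - x| <= r.
  by apply: tI; rewrite lexx ltW.
set z := phi c (g t) in tr.
have L1 : uh z <= curve_length F a t g.
  by apply: (dist_from_le F Nq p1) => //; rewrite /z phiKd.
have := @pw_FTC W [set z | `|z - x| <= r] t b g CW (fun z v zr => WF z v zr) p2 tI.
rewrite gb psiKd// -/z {1}/W subrr dot0r sq0 mulr0 subrr sub0r => L2.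
have zd : `|z - x| < d by rewrite tr; lra.
have := H z zd; have := normr_sq (z - x); rewrite tr => rs Hz.
move: lg; rewrite (length_cat F p1 p2) -/(uh x) => lg.
have Kk : K * sq (z - x) <= k * sq (z - x) - r ^+ 2.
  have : 0 <= (k - 1 - K) * sq (z - x).
    by rewrite mulr_ge0 ?sq_ge0// /k addrK subr_ge0 ler_norm.
  lra.
by move: L2; rewrite /W; lra.
Qed.

End LocalEstimates.

(** * Supergradients *)

Section Supergradients.
Variables (R : realType) (m : nat) (u : 'rV[R]_m -> R).
Variables (G : 'rV[R]_m * 'rV[R]_m -> R) (x0 : 'rV[R]_m) (r0 C b L : R).
Implicit Types (x y z v p q : 'rV[R]_m).

(** The quadratic inequality is imposed on a fixed set with a fixed constant, not just near [x], so
    that it passes to limits in (x, p). *)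
Definition supg (A : set 'rV[R]_m) (n : R) x p :=
  forall y, A y -> u y <= u x + dot p (y - x) + n * sq (y - x).

Let B : set 'rV[R]_m := [set x | `|x - x0| < r0].
Hypotheses (C0 : 0 <= C) (L0 : 0 < L).
Hypothesis u_lip : forall x y, B x -> B y -> `|u x - u y| <= L * `|x - y|.
Hypothesis u_sc : forall x y t, B x -> B y -> 0 <= t <= 1 ->
  (1 - t) * u x + t * u y - u ((1 - t) *: x + t *: y) <= C * (t * (1 - t) * sq (x - y)).
Hypothesis G_cts : forall x v, B x -> continuous_at (x, v) G.
Hypothesis G_bnd : forall x v, B x -> G (x, v) <= b * `|v|.
Hypothesis u_above : forall x p d n, B x -> 0 < d ->
  (forall y, `|y - x| < d -> u y <= u x + dot p (y - x) + n * sq (y - x)) ->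
  forall v, dot p v <= G (x, v).
Hypothesis u_below : forall x p d n, B x -> 0 < d ->
  (forall y, `|y - x| < d -> u x + dot p (y - x) - n * sq (y - x) <= u y) ->
  exists2 v, sphere v & G (x, v) <= dot p v.

(* The second clause, that [G] is reached in some direction, is what excludes
   three collinear elements. *)
Definition dstar x p := supg B C x p /\ exists2 v, sphere v & G (x, v) <= dot p v.

Lemma B_open x : B x -> exists2 d, 0 < d & forall y, `|y - x| < d -> B y.
Proof.
move=> Bx; exists (r0 - `|x - x0|); first by rewrite subr_gt0.
move=> y yx; rewrite /B/=.
have -> : y - x0 = (y - x) + (x - x0) by rewrite addrA subrK.
by rewrite (le_lt_trans (ler_normD _ _))//; lra.
Qed.

Lemma u_cts x : B x -> continuous_at x u.
Proof.
move=> Bx; have [d d0 dB] := B_open Bx.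
apply/ctsP => e e0; exists (Num.min d (e / L)); first by rewrite lt_min d0 divr_gt0.
move=> y; rewrite lt_min ltr_pdivlMr// => /andP[yd ye].
by rewrite (le_lt_trans (u_lip (dB y yd) Bx))// mulrC.
Qed.

(** Reflect [y] to w = x - t (y - x). The lower paraboloid bounds [u w] from below, and
    semiconcavity at [x], which lies between [w] and [y], bounds [u y] from above; divide by t and
    let it tend to 0. *)
Lemma below_supg x p d n : B x -> 0 < d ->
  (forall y, `|y - x| < d -> u x + dot p (y - x) - n * sq (y - x) <= u y) ->
  supg B C x p.
Proof.
move=> Bx d0 H y By; apply/ler_addgt0Pl => e e0.
have [d1 d10 dB] := B_open Bx.
pose V := `|y - x| + 1.
have V0 : 0 < V by rewrite ltr_wpDl.
pose k := (`|n| + C) * sq (y - x) + 1.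
have k0 : 0 < k by rewrite ltr_wpDl// mulr_ge0 ?sq_ge0// addr_ge0.
pose t := Num.min (Num.min d d1 / V) (e / k).
have t0 : 0 < t by rewrite lt_min !divr_gt0// lt_min d0.
have [t1 t2] : t * V <= Num.min d d1 /\ t * k <= e.
  by rewrite -!ler_pdivlMr// /t !ge_min !lexx ?orbT.
pose w := x - t *: (y - x).
have wx : w - x = - (t *: (y - x)) by rewrite /w addrAC subrr add0r.
have : `|w - x| < Num.min d d1.
  by rewrite wx normrN normrZ gtr0_norm// (lt_le_trans _ t1)// ltr_pM2l// /V ltrDl.
rewrite lt_min => /andP[wd /dB Bw].
have := H w wd; rewrite wx dotNr dotZr sqN sqZ => H1.
pose s := t / (1 + t).
have t10 : 0 < 1 + t by rewrite addr_gt0.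
have s01 : 0 <= s <= 1.
  by rewrite divr_ge0 ?(ltW t0) ?(ltW t10)//= ler_pdivrMr// mul1r lerDr.
have := u_sc Bw By s01.
have -> : (1 - s) *: w + s *: y = x.
  have s1 : s * (1 + t) = t by rewrite /s mulfVK ?gt_eqF.
  apply/rowP => j; rewrite !mxE.
  have -> : (1 - s) * (x 0 j - t * (y 0 j - x 0 j)) + s * y 0 j =
    x 0 j + (s * (1 + t) - t) * (y 0 j - x 0 j) by ring.
  by rewrite s1 subrr mul0r addr0.
have -> : w - y = - ((1 + t) *: (y - x)).
  by rewrite /w; apply/rowP => j; rewrite !mxE; ring.
rewrite sqN sqZ => /(ler_wpM2l (ltW t10)).
have -> : (1 + t) * ((1 - s) * u w + s * u y - u x) = u w + t * u y - (1 + t) * u x.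
  by rewrite /s; field; rewrite gt_eqF.
have -> : (1 + t) * (C * (s * (1 - s) * ((1 + t) ^+ 2 * sq (y - x)))) =
    t * ((1 + t) * (C * sq (y - x))).
  by rewrite /s; field; rewrite gt_eqF.
move=> H2; rewrite -(ler_pM2l t0).
have h3 : t * (t * ((`|n| + C) * sq (y - x))) <= t * e.
  rewrite ler_pM2l// (le_trans _ t2)// ler_pM2l// /k; lra.
have h4 : t * (t * (n * sq (y - x))) <= t * (t * (`|n| * sq (y - x))).
  by rewrite !ler_pM2l// ler_wpM2r ?sq_ge0// ler_norm.
lra.
Qed.

Lemma dstar_le x p v : B x -> dstar x p -> dot p v <= G (x, v).
Proof.
move=> Bx [H _]; have [d d0 dB] := B_open Bx.
by apply: (u_above Bx d0 (n := C)) => y yd; apply: H; exact: dB.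
Qed.

Lemma dstar_bound x p : B x -> dstar x p -> `|p| <= `|b|.
Proof.
move=> Bx Dp; apply: rV_norm_le => // j.
have K v : dot p v <= `|b| * `|v|.
  rewrite (le_trans (dstar_le v Bx Dp))// (le_trans (G_bnd v Bx))//.
  by rewrite ler_wpM2r// ler_norm.
have nd : `|delta_mx 0 j : 'rV[R]_m| <= 1.
  apply: rV_norm_le => // i; rewrite mxE eqxx/=.
  by case: eqP => _; rewrite ?normr1 ?normr0.
have pE : dot p (delta_mx 0 j) = p 0 j by exact: dot_delta.
have := K (delta_mx 0 j); have := K (- delta_mx 0 j); rewrite dotNr normrN pE.
have : `|b| * `|delta_mx 0 j : 'rV[R]_m| <= `|b| by rewrite ler_piMr.
by move=> h1 h2 h3; apply/ler_normlP; split; lra.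
Qed.

(** Compactness is applied to pairs (p, v), the direction attaining [G] included: for a fixed pair
    every condition is closed, while the existential over v is not visibly so. *)
Lemma dstar_usc x (Q : set 'rV[R]_m) : B x -> closed Q ->
  (forall p, Q p -> ~ dstar x p) ->
  exists2 d, 0 < d & forall y p, `|y - x| < d -> Q p -> ~ dstar y p.
Proof.
move=> Bx cQ H.
pose K := [set p : 'rV[R]_m | `|p - 0| <= `|b|] `*` @sphere R m.
have /compact_near_coveringP cK : compact K.
  by apply: compact_setX; [exact: closed_ballP_compact|exact: sphere_compact].
pose bad y (pv : 'rV[R]_m * 'rV[R]_m) :=
  ~ (Q pv.1 /\ supg B C y pv.1 /\ G (y, pv.2) <= dot pv.1 pv.2).
have : \forall y \near x, K `<=` bad y.
  apply: (cK _ (nbhs x) bad) => -[p v] [/= _ sv].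
  have c1 : continuous_at ((p, v), x) (fun s : ('rV[R]_m * 'rV[R]_m) * 'rV[R]_m => s.1.1).
    by apply: (continuous_comp (f := fst) (g := fst)); exact: cvg_fst.
  have c2 : continuous_at ((p, v), x) (fun s : ('rV[R]_m * 'rV[R]_m) * 'rV[R]_m => s.1.2).
    by apply: (continuous_comp (f := fst) (g := snd)); [exact: cvg_fst|exact: cvg_snd].
  have c3 : continuous_at ((p, v), x) (fun s : ('rV[R]_m * 'rV[R]_m) * 'rV[R]_m => s.2).
    exact: cvg_snd.
  suff : \forall s \near ((p, v), x), ~ (Q s.1.1 /\ supg B C s.2 s.1.1 /\
      G (s.2, s.1.2) <= dot s.1.1 s.1.2) by [].
  have [Qp|nQp] := pselect (Q p); last first.
    have : \forall s \near ((p, v), x), (~` Q) s.1.1.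
      by apply: c1; apply: open_nbhs_nbhs; split=> //; exact: closed_openC.
    by apply: filterS => s nQ [].
  have [Sp|nSp] := pselect (supg B C x p); last first.
    have [y [By yS]] : exists y, B y /\ u x + dot p (y - x) + C * sq (y - x) < u y.
      apply: contrapT => nE; apply: nSp => y By; rewrite leNgt; apply/negP => yS.
      by apply: nE; exists y.
    pose f (s : ('rV[R]_m * 'rV[R]_m) * 'rV[R]_m) :=
      u s.2 + dot s.1.1 (y - s.2) + C * sq (y - s.2).
    have cf : continuous_at ((p, v), x) f.
      have c4 := cts_sub (@cts_cst _ _ y _) c3.
      have c5 : continuous_at ((p, v), x)
          (fun s : ('rV[R]_m * 'rV[R]_m) * 'rV[R]_m => u s.2).
        by apply: (continuous_comp c3); exact: u_cts.
      exact: cts_add (cts_add c5 (cts_dot c1 c4)) (cts_mul (@cts_cst _ R C _) (cts_dot c4 c4)).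
    have : \forall s \near ((p, v), x), f s < u y.
      exact: (cf _ (lt_nbhsl yS)).
    by apply: filterS => s fs [_ [/(_ y By)]]; rewrite leNgt fs.
  have Gp : dot p v < G (x, v).
    rewrite ltNge; apply/negP => Gp; apply: (H p Qp); split=> //.
    by exists v.
  have c4 : continuous_at ((p, v), x) (fun s : ('rV[R]_m * 'rV[R]_m) * 'rV[R]_m =>
      dot s.1.1 s.1.2 - G (s.2, s.1.2)).
    apply: cts_sub; first exact: cts_dot.
    have c5 : continuous_at ((p, v), x)
        (fun s : ('rV[R]_m * 'rV[R]_m) * 'rV[R]_m => (s.2, s.1.2)).
      exact: (cvg_pair c3 c2).
    by apply: (continuous_comp c5); exact: G_cts.
  have Gp' : dot p v - G (x, v) < 0 by rewrite subr_lt0.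
  have : \forall s \near ((p, v), x), dot s.1.1 s.1.2 - G (s.2, s.1.2) < 0.
    exact: (c4 _ (lt_nbhsl Gp')).
  by apply: filterS => s fs [_ [_]]; rewrite -subr_le0 leNgt; move: fs; lra.
move=> /nbhsPd[d d0 HK]; have [d1 d10 dB] := B_open Bx.
exists (Num.min d d1); first by rewrite lt_min d0.
move=> y p; rewrite lt_min => /andP[yd yd1] Qp Dp.
have [Sp [v sv Gv]] := Dp.
apply: (HK y yd (p, v)); last by split.
by split=> //=; rewrite subr0; exact: dstar_bound (dB y yd1) Dp.
Qed.

(** If there were none, [dstar_usc] with the full set would leave none near [x]. But u + K |. - x|^2
    has a minimum inside a small ball, where a paraboloid touches u from below. *)
Lemma dstar_ex x : B x -> exists p, dstar x p.
Proof.
move=> Bx; apply: contrapT => nD.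
have [|d d0 Hd] := @dstar_usc x setT Bx closedT.
  by move=> p _ Dp; apply: nD; exists p.
have [d1 d10 dB] := B_open Bx.
pose r := Num.min d d1 / 2.
have r1 : r < d.
  have : Num.min d d1 <= d by rewrite ge_min lexx.
  by rewrite /r; lra.
have r2 : r < d1.
  have : Num.min d d1 <= d1 by rewrite ge_min lexx orbT.
  by rewrite /r; lra.
have rp : 0 < r by rewrite divr_gt0// lt_min d0.
(* The Lipschitz bound gives K |z - x| <= L = K r / 2 at the minimizer, which is therefore
   interior. *)
pose K := 2 * L / r.
have K0 : 0 < K by rewrite divr_gt0// mulr_gt0.
pose A := [set z : 'rV[R]_m | `|z - x| <= r].
have AB z : A z -> B z by rewrite /A/= => zr; apply: dB; lra.
have Ax : A x by rewrite /A/= subrr normr0 ltW.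
have cA : {within A, continuous (fun z => u z + K * sq (z - x))}.
  apply: continuous_in_subspaceT => z /set_mem/AB/u_cts cz.
  have c2 := @cts_subc _ _ x z.
  exact: cts_add cz (cts_mul (@cts_cst _ R K z) (cts_dot c2 c2)).
have A0 : A !=set0 by exists x.
have [z /set_mem Az zmin] := compact_EVT_min A0 (@closed_ballP_compact _ _ x r) cA.
have zx : `|z - x| < r.
  have := zmin x (mem_set Ax); rewrite subrr sq0 mulr0 addr0 => h1.
  have /ler_normlP[h2 h3] := u_lip (AB _ Az) Bx.
  have h4 : K * `|z - x| ^+ 2 <= K * sq (z - x) by rewrite ler_pM2l// normr_sq.
  have [->|zx] := eqVneq (z - x) 0; first by rewrite normr0.
  have nz : 0 < `|z - x| by rewrite normr_gt0.
  have : K * `|z - x| <= L.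
    rewrite -(ler_pM2r nz) -mulrA -expr2; lra.
  have Kr : K * r = 2 * L by rewrite /K mulfVK ?gt_eqF.
  move=> h5; suff : K * `|z - x| < K * r by rewrite ltr_pM2l.
  rewrite Kr; apply: (le_lt_trans h5); have := L0; lra.
pose p := - (2 * K) *: (z - x).
have d20 : 0 < r - `|z - x| by rewrite subr_gt0.
have below y : `|y - z| < r - `|z - x| -> u z + dot p (y - z) - K * sq (y - z) <= u y.
  move=> yz; have yA : A y.
    rewrite /A/=; have -> : y - x = (y - z) + (z - x) by rewrite addrA subrK.
    by rewrite (le_trans (ler_normD _ _))//; lra.
  have := zmin y (mem_set yA).
  have -> : y - x = (z - x) + (y - z) by rewrite [RHS]addrC addrA subrK.
  by rewrite (sqD (z - x)) /p dotZl; lra.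
have Bz := AB z Az.
apply: (Hd z p) => //; first by rewrite (lt_trans zx).
by split; [exact: below_supg Bz d20 below|exact: u_below Bz d20 below].
Qed.

(** The upper estimate is the supergradient inequality at [x]. For the lower one, take a
    supergradient at [y], close to [p] by semicontinuity, and evaluate its inequality at [x]. *)
Lemma dstar_diff x p : B x -> (forall q, dstar x q -> q = p) -> differentiable u x.
Proof.
move=> Bx H; have [q Dq] := dstar_ex Bx.
have Dp : dstar x p by rewrite -(H q Dq).
suff K : forall e, 0 < e -> exists2 d, 0 < d & forall y, `|y - x| < d ->
    `|u y - u x - dot p (y - x)| <= e * `|y - x| by case: (differentiable_dot K).
move=> e e0.
pose n : R := m%:R + 1.
have n0 : 0 < n by rewrite ltr_wpDl.
have n1 : m%:R <= n by rewrite /n lerDl.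
pose e1 := e / (2 * n); have e10 : 0 < e1 by rewrite divr_gt0// mulr_gt0.
have e1E : e1 * n * 2 = e by rewrite /e1; field; rewrite gt_eqF.
have [|q' Qq' Dq'|d d0 Hd] := @dstar_usc x [set q | e1 <= `|q - p|] Bx.
- exact: closed_ge_norm.
- by move: Qq'; rewrite /= (H q' Dq') subrr normr0 leNgt e10.
have [d1 d10 dB] := B_open Bx.
pose C1 := C * n + 1; have C10 : 0 < C1 by rewrite ltr_wpDl// mulr_ge0// ltW.
exists (Num.min (Num.min d d1) (e / 2 / C1)); first by rewrite !lt_min d0 d10 !divr_gt0.
move=> y; rewrite !lt_min ltr_pdivlMr// => /andP[/andP[yd /dB By] ye].
have sqn : C * sq (y - x) <= e / 2 * `|y - x|.
  apply: (le_trans (y := C * (n * `|y - x| ^+ 2))).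
    rewrite ler_wpM2l// (le_trans (sq_le _))// ler_wpM2r ?sqr_ge0//.
  apply: (le_trans (y := (`|y - x| * C1) * `|y - x|)).
    have : 0 <= `|y - x| ^+ 2 by rewrite sqr_ge0.
    by rewrite /C1 expr2; nra.
  by rewrite ler_wpM2r// ltW.
have e2 : e / 2 * `|y - x| <= e * `|y - x| by rewrite ler_wpM2r// ler_pdivrMr//; lra.
have up := Dp.1 y By.
have [q1 Dq1] := dstar_ex By.
have q1p : `|q1 - p| < e1.
  by rewrite ltNge; apply/negP => qe; exact: (Hd y q1 yd qe Dq1).
have dn := Dq1.1 x Bx.
have xy : x - y = - (y - x) by rewrite opprB.
rewrite xy dotNr sqN in dn.
have dq : `|dot (q1 - p) (y - x)| <= e / 2 * `|y - x|.
  rewrite (le_trans (dot_le _ _))// ler_wpM2r//.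
  have -> : e / 2 = n * e1 by rewrite -e1E; lra.
  by rewrite ler_pM// ltW.
move: dq; rewrite dotBl => /ler_normlP[q1l q1r].
by apply/ler_normlP; split; lra.
Qed.

(** A covector below G(x, .) that touches it at [v] must be its derivative there. *)
Lemma dual_unique x v p q : (forall w, derivable (fun w => G (x, w)) v w) ->
  (forall w, dot p w <= G (x, w)) -> (forall w, dot q w <= G (x, w)) ->
  dot p v = G (x, v) -> dot q v = G (x, v) -> p = q.
Proof.
move=> dG.
have key p' w : (forall w, dot p' w <= G (x, w)) -> dot p' v = G (x, v) ->
    dot p' w = 'D_w (fun w => G (x, w)) v.
  move=> Hp pv.
  apply/eqP; rewrite -subr_eq0 -normr_le0; apply/ler_addgt0Pl => e e0.
  rewrite addr0; have [d d0 Hd] := derive_epsR (dG w) e0.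
  have d2 : 0 < d / 2 by rewrite divr_gt0.
  have half (t : R) : `|t| = d / 2 -> t * (dot p' w - 'D_w (fun w => G (x, w)) v) <= e * (d / 2).
    move=> td; have tl : `|t| < d by rewrite td; lra.
    have := Hp (v + t *: w); rewrite dotDr dotZr pv.
    by have := Hd t tl; rewrite td => /ler_normlP[_]; lra.
  have h1 := half (d / 2) (gtr0_norm d2).
  have h2 : `|- (d / 2)| = d / 2 by rewrite normrN gtr0_norm.
  have {}h2 := half _ h2.
  by apply/ler_normlP; split; rewrite -(ler_pM2l d2); lra.
move=> Hp Hq pv qv; apply/rowP => j.
by rewrite -!dot_delta (key p)// (key q).
Qed.

(* [p1 = (1 - s) p0 + s p2] with [0 < s < 1] would make the three covectors
   agree on the direction where [p1] is maximal. *)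
Lemma dstar_convex x p0 p1 p2 s : B x ->
  (forall v w, v != 0 -> derivable (fun w => G (x, w)) v w) ->
  dstar x p0 -> dstar x p1 -> dstar x p2 -> 0 < s < 1 ->
  p1 = (1 - s) *: p0 + s *: p2 -> p0 = p1.
Proof.
move=> Bx dG D0 D1 D2 /andP[s0 s1] E.
have [_ [v sv Gv]] := D1.
have h0 := dstar_le v Bx D0; have h1 := dstar_le v Bx D1; have h2 := dstar_le v Bx D2.
have E' : dot p1 v = (1 - s) * dot p0 v + s * dot p2 v by rewrite E dotDl !dotZl.
have e1 : dot p1 v = G (x, v) by apply/le_anti; rewrite h1.
have e0 : dot p0 v = G (x, v).
  apply/le_anti; rewrite h0/= leNgt; apply/negP => lt0.
  have : (1 - s) * dot p0 v < (1 - s) * G (x, v) by rewrite ltr_pM2l// subr_gt0.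
  have : s * dot p2 v <= s * G (x, v) by rewrite ler_pM2l.
  by move: E'; rewrite e1; lra.
apply: (dual_unique (x := x) (v := v)) => //.
- by move=> w; apply: dG; exact: sphere_neq0.
- by move=> w; exact: dstar_le.
- by move=> w; exact: dstar_le.
Qed.

End Supergradients.

(** * Changes of coordinates and envelopes *)

Lemma bigmin_ord (R : realType) n (F : 'I_n -> R) : (forall i, 0 < F i) ->
  exists2 d, 0 < d & forall i, d <= F i.
Proof.
move=> F0; exists (\big[Num.min/1]_i F i); last by move=> i; exact: bigmin_le.
by apply/bigmin_gtP.
Qed.

Lemma bigmax_ord (R : realType) n (F : 'I_n -> R) :
  exists2 d, 0 <= d & forall i, F i <= d.
Proof.
exists (\big[Num.max/0]_i F i); first exact: bigmax_ge_id.
by move=> i; exact: le_bigmax.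
Qed.

Lemma Ck1_strict (R : realType) n k (f : 'rV[R]_n -> 'rV[R]_k) A x :
  open A -> Ck 1 A f -> A x -> exists J : 'M[R]_(n, k), forall e, 0 < e ->
    exists2 d, 0 < d & forall y z, `|y - x| < d -> `|z - x| < d ->
    `|f z - f y - (z - y) *m J| <= e * `|z - y|.
Proof.
move=> oA Cf Ax.
have /choice[p Hp] := fun j => Ck1_strictR oA (Ck_coord j oA Cf) Ax.
exists (\matrix_(i, j) p j 0 i) => e e0.
have /choice[d Hd] : forall j, exists d, 0 < d /\ forall y z, `|y - x| < d ->
    `|z - x| < d -> `|f z 0 j - f y 0 j - dot (p j) (z - y)| <= e * `|z - y|.
  by move=> j; have [d d0 H] := Hp j e e0; exists d.
have [|d' d'0 dd] := @bigmin_ord R k d; first by move=> j; case: (Hd j).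
exists d' => // y z yx zx; apply: rV_norm_le => [|j].
  by rewrite mulr_ge0// ltW.
have [_ H] := Hd j.
have := H y z (lt_le_trans yx (dd j)) (lt_le_trans zx (dd j)).
rewrite !mxE; congr (`|_ - _| <= _); apply: eq_bigr => i _.
by rewrite !mxE mulrC.
Qed.

Lemma Ck2_avg (R : realType) n k (f : 'rV[R]_n -> 'rV[R]_k) A x :
  open A -> Ck 2 A f -> A x -> exists d K, [/\ 0 < d, 0 <= K &
    forall y z t, `|y - x| < d -> `|z - x| < d -> 0 <= t <= 1 ->
    `|(1 - t) *: f y + t *: f z - f ((1 - t) *: y + t *: z)| <=
      t * (1 - t) * (K * `|z - y| ^+ 2)].
Proof.
move=> oA Cf Ax; have [r r0 Ar] := openP oA Ax.
pose d := r / 2; have d0 : 0 < d by rewrite divr_gt0.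
pose B := [set z : 'rV[R]_n | `|z - x| <= d].
have BA : B `<=` A by move=> z /= zd; apply: Ar; rewrite (le_lt_trans zd)// /d; lra.
have /choice[K HK] : forall j, exists K, forall z w, B z ->
    `|'D_w ('D_w (fun y => f y 0 j)) z| <= K * `|w| ^+ 2.
  move=> j; have [K _ HK] := hess_bound (@row_basis R n) oA (Ck_coord j oA Cf)
    (@closed_ballP_compact R n x d) BA.
  by exists K.
have [K' K'0 KK] := bigmax_ord K.
exists d, K'; split=> // y z t yx zx t01; have /andP[t0 t1] := t01.
have tt : 0 <= t * (1 - t) by rewrite mulr_ge0 ?subr_ge0.
apply: rV_norm_le => [|j]; first by rewrite mulr_ge0// mulr_ge0// sqr_ge0.
have yz s : y + s *: (z - y) = (1 - s) *: y + s *: z.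
  by apply/rowP => i; rewrite !mxE; ring.
have Bs s : 0 <= s <= 1 -> B (y + s *: (z - y)).
  by move=> s01; rewrite yz; apply/ltW/ball_avg.
have := @taylor2 R _ A (fun y => f y 0 j) y (z - y) (K' * `|z - y| ^+ 2) t
  (Ck_coord j oA Cf) (fun s s01 => BA _ (Bs s s01)).
have zz : y + (z - y) = z by rewrite addrC subrK.
rewrite zz (yz t) => H; rewrite !mxE; apply: H => // s s01.
by rewrite (le_trans (HK j _ _ (Bs s s01)))// ler_wpM2r ?sqr_ge0.
Qed.

Section LevelTransport.
Variables (R : realType) (d k : nat).
Notation m := (d + k)%N.
Variables (f : 'I_k.+1 -> 'rV[R]_m -> R) (c0 : 'rV[R]_m) (r C th K : R).
Variables (E : 'M[R]_(k, m)) (p : 'I_k.+1 -> 'rV[R]_m).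
Hypotheses (C0 : 0 <= C) (th0 : 0 < th) (K0 : 0 < K).
Hypothesis f_sc : forall i x y t, `|x - c0| < r -> `|y - c0| < r ->
  0 <= t <= 1 -> (1 - t) * f i x + t * f i y - f i ((1 - t) *: x + t *: y) <=
  C * (t * (1 - t) * sq (x - y)).
Hypothesis f_aff : forall i x y, `|x - c0| < r -> `|y - c0| < r ->
  `|f i y - f i x - dot (p i) (y - x)| <= th * `|y - x|.
Hypothesis p_dual : forall (y : 'rV[R]_k) j,
  dot (p ord0 - p (lift ord0 j)) (y *m E) = y 0 j.
Hypothesis E_le : forall y : 'rV[R]_k, `|y *m E| <= K * `|y|.
Hypothesis th_small : 16 * (k.+1%:R * (th * K)) <= 1.

Lemma dot_mulmx n (q v : 'rV[R]_n) (J : 'M[R]_n) : dot (q *m J^T) v = dot q (v *m J).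
Proof.
have H (a b : 'rV[R]_n) : dot a b = (a *m b^T) 0 0 by rewrite mulmx_tr mxE mulr1n.
by rewrite !H trmx_mul mulmxA.
Qed.

(* The hypotheses are stable under a [C^2] change of coordinates [T], because
   they only compare the functions with affine ones up to small Lipschitz
   errors. *)
Lemma level_dc_at (T : 'rV[R]_m -> 'rV[R]_m) (D S : set 'rV[R]_m) (J J' : 'M[R]_m) z0 :
  open D -> D z0 -> Ck 2 D T -> J' *m J = 1%:M ->
  (forall e, 0 < e -> exists2 d, 0 < d & forall y z, `|y - z0| < d -> `|z - z0| < d ->
    `|T z - T y - (z - y) *m J| <= e * `|z - y|) ->
  `|T z0 - c0| < r -> S z0 ->
  (\forall x \near z0, S x <-> forall j, f ord0 (T x) = f (lift ord0 j) (T x)) ->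
  dc_at d S z0.
Proof.
move=> oD Dz CT JJ strict Tz Sz nS.
have m0 : 0 < m%:R + 1 :> R by rewrite ltr_wpDl.
pose mm : R := m%:R + 1.
have mle : m%:R <= mm by rewrite /mm lerDl.
have [P P0 HP] := bigmax_ord (fun i => `|p i|).
have [KJ KJ0 HJ] := mulmx_bound J.
have [KJ' KJ'0 HJ'] := mulmx_bound J'.
pose Lf := th + mm * P.
have Lf0 : 0 <= Lf by rewrite addr_ge0 ?(ltW th0)// mulr_ge0// ltW.
have f_lip i x y : `|x - c0| < r -> `|y - c0| < r -> `|f i y - f i x| <= Lf * `|y - x|.
  move=> xr yr; have := f_aff i xr yr.
  have : `|dot (p i) (y - x)| <= mm * P * `|y - x|.
    by rewrite (le_trans (dot_le _ _))// ler_wpM2r// ler_pM.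
  have := ler_normD (f i y - f i x - dot (p i) (y - x)) (dot (p i) (y - x)).
  rewrite subrK /Lf mulrDl; lra.
(* Makes the nonlinearity of [T] cost at most another [th * K] in the vertical estimate: this is the
   2 in [2 * (th * K)], and why 16 replaces the 8 of [dc_level]. *)
pose eta := Num.min 1 (th / (Lf + 1) / KJ').
have Lf1 : 0 < Lf + 1 by rewrite ltr_wpDl.
have eta0 : 0 < eta by rewrite lt_min ltr01/= !divr_gt0.
have eta1 : eta <= 1 by rewrite ge_min lexx.
have eta2 : eta * KJ' * (Lf + 1) <= th.
  have : eta <= th / (Lf + 1) / KJ' by rewrite ge_min lexx orbT.
  rewrite -(ler_pM2r KJ'0) -(ler_pM2r Lf1) => /le_trans; apply.
  by rewrite le_eqVlt; apply/orP; left; apply/eqP; field; rewrite !gt_eqF.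
have [d1 d10 H1] := strict eta eta0.
have [d2 [M2 [d20 M20 H2]]] := Ck2_avg oD CT Dz.
have cT : continuous_at z0 T by exact: CkW CT Dz.
have rT : 0 < r - `|T z0 - c0| by rewrite subr_gt0.
have [d3 d30 H3] := (ctsP _ _).1 cT _ rT.
have [d4 d40 H4] := nbhsPd nS.
pose r' := Num.min (Num.min d1 d2) (Num.min d3 d4).
have r'0 : 0 < r' by rewrite !lt_min d10 d20 d30.
have lt4 x : `|x - z0| < r' -> [/\ `|x - z0| < d1, `|x - z0| < d2, `|x - z0| < d3 & `|x - z0| < d4].
  by rewrite !lt_min => /andP[/andP[-> ->] /andP[-> ->]].
have TB x : `|x - z0| < r' -> `|T x - c0| < r.
  move=> /lt4[_ _ /H3 Tx _].
  have -> : T x - c0 = (T x - T z0) + (T z0 - c0) by rewrite addrA subrK.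
  by rewrite (le_lt_trans (ler_normD _ _))//; lra.
pose LT := KJ + 1; have LT0 : 0 < LT by rewrite addr_gt0.
have T_lip x y : `|x - z0| < r' -> `|y - z0| < r' -> `|T y - T x| <= LT * `|y - x|.
  move=> /lt4[xd _ _ _] /lt4[yd _ _ _].
  have := H1 x y xd yd; have := HJ (y - x).
  have := ler_normD (T y - T x - (y - x) *m J) ((y - x) *m J); rewrite subrK.
  have : eta * `|y - x| <= 1 * `|y - x| by rewrite ler_wpM2r.
  rewrite /LT; lra.
pose C' := C * (mm * LT ^+ 2) + Lf * M2.
have C'0 : 0 <= C' by rewrite addr_ge0// mulr_ge0// mulr_ge0 ?sqr_ge0// ltW.
pose f' i x := f i (T x).
(* Vertical directions are pulled back by the inverse differential and covectors by the transpose,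
   so their pairings are unchanged. *)
pose E' := E *m J'.
pose p' i := p i *m J^T.
have pE i (y : 'rV[R]_k) : dot (p' i) (y *m E') = dot (p i) (y *m E).
  by rewrite /p' /E' dot_mulmx -!mulmxA JJ mulmx1.
apply: (@dc_level R d k f' z0 r' C' (Lf * LT) (2 * (th * K)) E' p') => //.
- by rewrite mulr_ge0// ltW.
- by rewrite !mulr_ge0// ltW.
- move=> i x y t xr yr t01; have /andP[t0 t1] := t01.
  have tt : 0 <= t * (1 - t) by rewrite mulr_ge0 ?subr_ge0.
  have wr := ball_avg t01 xr yr.
  have h1 := f_sc i (TB x xr) (TB y yr) t01.
  have h2 := f_lip i _ _ (TB _ wr) (ball_avg t01 (TB x xr) (TB y yr)).
  have [_ xd _ _] := lt4 x xr; have [_ yd _ _] := lt4 y yr.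
  have h3 := H2 x y t xd yd t01.
  have h4 : sq (T x - T y) <= mm * LT ^+ 2 * sq (x - y).
    rewrite (le_trans (sq_le _))// -mulrA ler_pM ?sqr_ge0//.
    rewrite (le_trans (y := (LT * `|x - y|) ^+ 2))//.
      rewrite lerXn2r ?nnegrE ?mulr_ge0 ?(ltW LT0)//; exact: T_lip.
    by rewrite exprMn ler_wpM2l ?sqr_ge0// normr_sq.
  have h5 : `|y - x| ^+ 2 <= sq (x - y) by rewrite distrC normr_sq.
  have h6 : C * (t * (1 - t) * sq (T x - T y)) <=
      C * (t * (1 - t) * (mm * LT ^+ 2 * sq (x - y))) by rewrite !ler_wpM2l.
  have h7 : Lf * `|(1 - t) *: T x + t *: T y - T ((1 - t) *: x + t *: y)| <=
      Lf * (t * (1 - t) * (M2 * sq (x - y))).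
    rewrite ler_wpM2l// (le_trans h3)// ler_wpM2l// ler_wpM2l//.
  move: h2 => /ler_normlP[_ h2]; rewrite /f' /C'.
  have -> : (C * (mm * LT ^+ 2) + Lf * M2) * (t * (1 - t) * sq (x - y)) =
     C * (t * (1 - t) * (mm * LT ^+ 2 * sq (x - y))) +
     Lf * (t * (1 - t) * (M2 * sq (x - y))) by ring.
  lra.
- move=> i x y xr yr; rewrite /f' (le_trans (f_lip _ _ _ (TB _ yr) (TB _ xr)))//.
  by rewrite -mulrA ler_wpM2l//; exact: T_lip.
- move=> i x y xr xyr; rewrite pE /f'.
  have E1 : (x + y *m E') - x = y *m E' by rewrite addrC addKr.
  have E2 : y *m E' *m J = y *m E by rewrite /E' -!mulmxA JJ mulmx1.
  have [xd _ _ _] := lt4 x xr; have [yd _ _ _] := lt4 _ xyr.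
  have h0 := H1 x _ xd yd; rewrite E1 E2 in h0.
  have h1 := f_aff i (TB x xr) (TB _ xyr).
  set w := T (x + y *m E') - T x in h0 h1 *.
  have nE' : `|y *m E'| <= KJ' * (K * `|y|).
    by rewrite /E' mulmxA (le_trans (HJ' _))// ler_pM2l.
  have Ky : 0 <= K * `|y| by rewrite mulr_ge0// ltW.
  have h2 : Lf * (eta * `|y *m E'|) <= th * (K * `|y|).
    apply: (le_trans (y := eta * KJ' * (Lf + 1) * (K * `|y|))); last by rewrite ler_wpM2r.
    have -> : eta * KJ' * (Lf + 1) * (K * `|y|) = (Lf + 1) * (eta * (KJ' * (K * `|y|))).
      by ring.
    by rewrite ler_pM ?mulr_ge0 ?(ltW eta0)// ?lerDl// ler_pM2l.
  have h3 : `|w| <= K * `|y| + eta * `|y *m E'|.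
    have := ler_normD (w - y *m E) (y *m E); rewrite subrK.
    have := E_le y; lra.
  have h4 : th * `|w| <= th * (K * `|y|) + th * (eta * `|y *m E'|).
    by rewrite -mulrDr ler_pM2l.
  have h5 : `|dot (p i) (w - y *m E)| <= mm * P * (eta * `|y *m E'|).
    by rewrite (le_trans (dot_le _ _))// ler_pM ?mulr_ge0// ler_pM.
  have -> : f i (T (x + y *m E')) - f i (T x) - dot (p i) (y *m E) =
      (f i (T (x + y *m E')) - f i (T x) - dot (p i) w) + dot (p i) (w - y *m E).
    by rewrite [dot (p i) (w - _)]dotBr; ring.
  rewrite (le_trans (ler_normD _ _))//.
  have -> : 2 * (th * K) * `|y| = 2 * (th * (K * `|y|)) by ring.
  move: h1 h2 h4 h5; rewrite /Lf mulrDl.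
  move: (`|w|) (`|dot (p i) (w - _)|) (eta * _) (K * `|y|) => a1 a2 a3 a4.
  move: `|_ - dot (p i) w| (mm * P * a3) (th * a3) (th * a4) (th * a1) => a5 b1 b2 b3 b4.
  lra.
- by move=> y j; rewrite dotBl !pE -dotBl.
- have -> : 8 * (k.+1%:R * (2 * (th * K))) = 16 * (k.+1%:R * (th * K)) by ring.
  exact: th_small.
- move=> x /lt4[_ _ _ xd]; exact: H4.
Qed.

End LevelTransport.

(** * Independence of covectors and rational approximation *)

Lemma dual_basis (R : realType) k m (A : 'M[R]_(k, m)) : row_free A ->
  exists E : 'M[R]_(k, m), forall (y : 'rV[R]_k) j, dot (row j A) (y *m E) = y 0 j.
Proof.
move=> rA; exists (pinvmx A)^T => y j.
have H v : dot (row j A) v = (v *m A^T) 0 j.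
  by rewrite /dot mxE; apply: eq_bigr => i _; rewrite !mxE mulrC.
by rewrite H -mulmxA -trmx_mul mulmxVp// trmx1 mulmx1.
Qed.

Lemma pair_row_free (R : realType) m (p : 'I_2 -> 'rV[R]_m) : p ord0 != p ord_max ->
  row_free (\matrix_(j < 1) (p ord0 - p (lift ord0 j))).
Proof.
move=> p01; apply: inj_row_free => v; rewrite mulmx_sum_row big_ord1 rowK => /eqP.
have -> : lift ord0 ord0 = ord_max :> 'I_2 by exact: val_inj.
rewrite scaler_eq0 subr_eq0 (negPf p01) orbF => /eqP v0.
by apply/rowP => j; rewrite ord1 v0 mxE.
Qed.

(** A linear relation either identifies two of the points or puts the three on a line; the position
    of [s] with respect to 0 and 1 then tells which one is strictly between the others. *)
Lemma triple_row_free (R : realType) m (D : set 'rV[R]_m) (p : 'I_3 -> 'rV[R]_m) :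
  (forall x y z s, D x -> D y -> D z -> 0 < s < 1 ->
    y = (1 - s) *: x + s *: z -> x = y) ->
  (forall i, D (p i)) -> injective p ->
  row_free (\matrix_(j < 2) (p ord0 - p (lift ord0 j))).
Proof.
move=> nb Dp pI; apply: inj_row_free => v; rewrite mulmx_sum_row !big_ord_recl big_ord0 addr0.
rewrite !rowK; set p0 := p ord0; set p1 := p _; set p2 := p _.
have [n01 n02 n12] : [/\ p0 <> p1, p0 <> p2 & p1 <> p2] by split=> /pI.
have [D0 D1 D2] : [/\ D p0, D p1 & D p2] by split; exact: Dp.
set a := v 0 _; set b := v 0 _ => ab.
suff [a0 b0] : a = 0 /\ b = 0.
  by apply/rowP => j; rewrite mxE; case: (unliftP ord0 j) => [j' ->|->//]; rewrite ord1.
have E : (a + b) *: p0 = a *: p1 + b *: p2.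
  by apply/eqP; rewrite -subr_eq0 -{}ab; apply/eqP/rowP => j; rewrite !mxE; ring.
have [ab0|abn] := eqVneq (a + b) 0.
  have ba : b = - a by apply/eqP; rewrite -addr_eq0 addrC ab0.
  move: E; rewrite ab0 scale0r ba scaleNr => /esym/eqP.
  rewrite subr_eq0 => /eqP E; suff -> : a = 0 by rewrite oppr0.
  by apply: contrapT => /eqP a0; apply: n12; exact: (scalerI a0).
exfalso; pose s := b / (a + b).
have E' : p0 = (1 - s) *: p1 + s *: p2.
  apply: (scalerI abn); rewrite E scalerDr !scalerA; congr (_ *: _ + _ *: _).
    by rewrite /s; field.
  by rewrite /s; field.
have [s0|s0|s0] := ltgtP s 0.
- pose t := 1 / (1 - s); have s1 : 0 < 1 - s by lra.
  have t01 : 0 < t < 1 by rewrite divr_gt0//= ltr_pdivrMr//; lra.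
  apply: n12; symmetry; apply: (nb p2 p1 p0 t) => //.
  by rewrite E'; apply/rowP => j; rewrite !mxE /t; field; rewrite gt_eqF.
- have [s1|s1|s1] := ltgtP s 1.
  + by apply: n01; symmetry; apply: (nb p1 p0 p2 s) => //; rewrite s0.
  + pose t := 1 / s.
    have t01 : 0 < t < 1 by rewrite divr_gt0//= ltr_pdivrMr// mul1r.
    apply: n12; apply: (nb p1 p2 p0 t) => //.
    by rewrite E'; apply/rowP => j; rewrite !mxE /t; field; rewrite gt_eqF.
  + by apply: n02; rewrite E' s1 subrr scale0r add0r scale1r.
- by apply: n01; rewrite E' s0 subr0 scale0r addr0 scale1r.
Qed.

Lemma rat_small (R : realType) (e : R) : 0 < e -> exists q : rat, 0 < (ratr q : R) < e.
Proof.
move=> e0; have [q] := rat_in_itvoo e0; rewrite in_itv/= => qe.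
by exists q.
Qed.

Lemma rat_approx (R : realType) m (x : 'rV[R]_m) e : 0 < e ->
  exists q : 'rV[rat]_m, `|map_mx (ratr : rat -> R) q - x| < e.
Proof.
move=> e0.
have /choice[q Hq] : forall j, exists q : rat, `|(ratr q : R) - x 0 j| < e.
  move=> j; have lt : x 0 j - e < x 0 j + e by lra.
  have [q] := rat_in_itvoo lt; rewrite in_itv/= => /andP[q1 q2].
  by exists q; apply/ltr_normlP; split; lra.
exists (\row_j q j); apply: rV_norm_lt => // j.
by rewrite !mxE.
Qed.

(** * Envelopes of paraboloids above u *)

Section Envelope.
Variables (R : realType) (m : nat) (u : 'rV[R]_m -> R) (c0 : 'rV[R]_m) (r n rho : R).
Implicit Types (x y z V p q : 'rV[R]_m).
Hypotheses (r0 : 0 < r) (n0 : 0 <= n) (rho0 : 0 < rho).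

Definition cone_fun y q x := u y + dot q (x - y) + n * sq (x - y).

Definition active V y q :=
  [/\ `|y - c0| < r, supg u [set z | `|z - c0| < r] n y q & `|q - V| < rho].

(* The part of [u] whose supergradients are close to [V]: semiconcave, and
   close to an affine function of gradient [V]. *)
Definition env V x := inf [set cone_fun yq.1 yq.2 x | yq in [set yq | active V yq.1 yq.2]].

Lemma env_le V x y q : `|x - c0| < r -> active V y q -> env V x <= cone_fun y q x.
Proof.
move=> xr aq; apply: ge_inf; last by exists (y, q).
by exists (u x) => _ [[z p] [/= zr zp _] <-]; exact: zp.
Qed.

Lemma env_glb V x l : (exists y q, active V y q) ->
  (forall y q, active V y q -> l <= cone_fun y q x) -> l <= env V x.
Proof.
move=> [y [q aq]] H; apply: lb_le_inf; first by exists (cone_fun y q x), (y, q).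
by move=> _ [[z p] /= zp <-]; exact: H.
Qed.

Lemma env_ge V x : (exists y q, active V y q) -> `|x - c0| < r -> u x <= env V x.
Proof. by move=> ne xr; apply: env_glb => // y q [_ H _]; exact: H. Qed.

Lemma env_eq V x q : active V x q -> env V x = u x.
Proof.
move=> aq; have [xr _ _] := aq; apply/le_anti; rewrite env_ge ?andbT//; last by exists x, q.
have := env_le xr aq.
by rewrite /cone_fun subrr dot0r sq0 mulr0 !addr0.
Qed.

(** Each paraboloid satisfies this with equality and the same [n], so the inequality passes to the
    infimum. *)
Lemma env_sc V x y t : (exists y q, active V y q) -> `|x - c0| < r -> `|y - c0| < r ->
  0 <= t <= 1 -> (1 - t) * env V x + t * env V y - env V ((1 - t) *: x + t *: y) <=
  n * (t * (1 - t) * sq (x - y)).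
Proof.
move=> ne xr yr /andP[t0 t1]; rewrite lerBlDr -lerBlDl; apply: env_glb => // z q aq.
have t1' : 0 <= 1 - t by lra.
have h1 := ler_wpM2l t1' (env_le xr aq).
have h2 := ler_wpM2l t0 (env_le yr aq).
suff <- : (1 - t) * cone_fun z q x + t * cone_fun z q y - n * (t * (1 - t) * sq (x - y)) =
    cone_fun z q ((1 - t) *: x + t *: y) by lra.
rewrite /cone_fun.
have -> : x - y = (x - z) - (y - z) by rewrite opprB addrA subrK.
have -> : (1 - t) *: x + t *: y - z = (1 - t) *: (x - z) + t *: (y - z).
  by apply/rowP => j; rewrite !mxE; ring.
move: (x - z) (y - z) => a b.
rewrite sqB sqD !sqZ dotDr !dotZr dotZl; ring.
Qed.

(** [2 * rho] bounds the distance from [p] to an active covector, [4 * n * r] the change of slope of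
    a paraboloid across the ball, and m + 1 comes from [dot_le]. *)
Lemma env_aff V p x y : (exists y q, active V y q) -> `|p - V| < rho ->
  `|x - c0| < r -> `|y - c0| < r ->
  `|env V y - env V x - dot p (y - x)| <= (m%:R + 1) * (2 * rho + 4 * n * r) * `|y - x|.
Proof.
move=> ne pV.
pose K := (m%:R + 1) * (2 * rho + 4 * n * r).
have K0 : 0 <= K by rewrite mulr_ge0 ?addr_ge0 ?mulr_ge0// ltW.
have half x' y' : `|x' - c0| < r -> `|y' - c0| < r ->
    env V y' - dot p (y' - x') - K * `|y' - x'| <= env V x'.
  move=> xr yr; apply: env_glb => // z q aq; have [zr _ qV] := aq.
  have := env_le yr aq; rewrite /cone_fun.
  have E1 : y' - z = (x' - z) + (y' - x') by rewrite [RHS]addrC addrA subrK.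
  rewrite E1 (sqD (x' - z)) (dotDr _ (x' - z)).
  have qp : `|q - p| < 2 * rho.
    have -> : q - p = (q - V) - (p - V) by rewrite opprB addrA subrK.
    by rewrite (le_lt_trans (ler_normB _ _))//; lra.
  have bd a : `|a - c0| < r -> `|a - z| <= 2 * r.
    move=> ar; have -> : a - z = (a - c0) - (z - c0) by rewrite opprB addrA subrK.
    by rewrite (le_trans (ler_normB _ _))//; lra.
  have E2 : 2 * dot (x' - z) (y' - x') + sq (y' - x') = dot ((x' - z) + (y' - z)) (y' - x').
    by rewrite E1 /sq !dotDl; ring.
  have h1 : `|dot ((x' - z) + (y' - z)) (y' - x')| <= (m%:R + 1) * (4 * r) * `|y' - x'|.
    rewrite (le_trans (dot_le _ _))// ler_wpM2r// ler_pM ?lerDl//.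
    by rewrite (le_trans (ler_normD _ _))//; have := bd _ xr; have := bd _ yr; lra.
  have h2 : `|dot (q - p) (y' - x')| <= (m%:R + 1) * (2 * rho) * `|y' - x'|.
    by rewrite (le_trans (dot_le _ _))// ler_wpM2r// ler_pM ?lerDl// ltW.
  have {}h1 := ler_wpM2l n0 (le_trans (ler_norm _) h1).
  have {}h2 := le_trans (ler_norm _) h2; rewrite dotBl in h2.
  have -> : K * `|y' - x'| = n * ((m%:R + 1) * (4 * r) * `|y' - x'|) +
     (m%:R + 1) * (2 * rho) * `|y' - x'| by rewrite /K; ring.
  move: h1 h2; rewrite -E2; lra.
move=> xr yr; have := half x y xr yr; have := half y x yr xr.
have -> : x - y = - (y - x) by rewrite opprB.
by rewrite dotNr normrN -/K => h1 h2; apply/ler_normlP; split; lra.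
Qed.

End Envelope.

(** * The singular set *)

Lemma near_differentiable (R : realType) n (f g : 'rV[R]_n -> R) x :
  (\forall y \near x, f y = g y) -> differentiable f x -> differentiable g x.
Proof.
move=> nfg /differentiable_eps[p Hp].
have fgx := nbhs_singleton nfg; have [d d0 Hd] := nbhsPd nfg.
suff H : forall e, 0 < e -> exists2 d, 0 < d & forall y, `|y - x| < d ->
    `|g y - g x - dot p (y - x)| <= e * `|y - x| by case: (differentiable_dot H).
move=> e /Hp[d' d'0 H]; exists (Num.min d d'); first by rewrite lt_min d0.
move=> y; rewrite lt_min => /andP[/Hd <- /H]; by rewrite fgx.
Qed.

Lemma differentiable_chart (R : realType) m (M : smoothManifold R m) (f : M -> R) p c c' :
  chart_at p c -> chart_at p c' -> differentiable (f \o psi c) (phi c p) ->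
  differentiable (f \o psi c') (phi c' p).
Proof.
move=> [Ac cp] [Ac' c'p] df.
have dT := trans_diff Ac' Ac c'p cp.
have E : phi c p = (phi c \o psi c') (phi c' p) by rewrite /= phiKd.
rewrite E in df.
apply: near_differentiable (differentiable_comp dT df).
have n1 : \forall y \near phi c' p, dom c (psi c' y).
  by apply: (psi_cts (cod_phi c'p)); rewrite phiKd//; exact: near_dom.
by apply: filterS n1 => y cy /=; rewrite phiKd.
Qed.

(** The chain rule for f (g y) = y, tested on small multiples of each vector; each of the two
    approximations contributes half of the error. *)
Lemma strict_inverse (R : realType) n (f g : 'rV[R]_n -> 'rV[R]_n) (J J' : 'M[R]_n) x :
  (forall e, 0 < e -> exists2 d, 0 < d & forall y z, `|y - g x| < d -> `|z - g x| < d ->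
    `|f z - f y - (z - y) *m J| <= e * `|z - y|) ->
  (forall e, 0 < e -> exists2 d, 0 < d & forall y z, `|y - x| < d -> `|z - x| < d ->
    `|g z - g y - (z - y) *m J'| <= e * `|z - y|) ->
  (\forall y \near x, f (g y) = y) -> J' *m J = 1%:M.
Proof.
move=> Hf Hg /nbhsPd[r r0 fg].
have [K K0 HK] := mulmx_bound J; have [K' K'0 HK'] := mulmx_bound J'.
suff H : forall (v : 'rV[R]_n) (e : R), 0 < e -> `|v - v *m (J' *m J)| <= e * `|v|.
  apply/row_matrixP => i; rewrite !rowE mulmx1; symmetry; apply/eqP.
  rewrite -subr_eq0 -normr_le0; apply/ler_addgt0Pl => e e0; rewrite addr0.
  set w := delta_mx 0 i; have w1 : 0 < `|w| + 1 by rewrite ltr_wpDl.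
  rewrite (le_trans (H w (e / (`|w| + 1)) _)) ?divr_gt0//.
  by rewrite mulrAC ler_pdivrMr// ler_pM2l// lerDl.
move=> v e e0.
pose e1 := Num.min 1 (e / 2 / K); have e10 : 0 < e1 by rewrite lt_min ltr01/= !divr_gt0.
have e11 : e1 <= 1 by rewrite ge_min lexx.
have e1K : K * e1 <= e / 2 by rewrite mulrC -ler_pdivlMr// ge_min lexx orbT.
pose e2 := e / 2 / (K' + 1); have K'1 : 0 < K' + 1 by rewrite addr_gt0.
have e20 : 0 < e2 by rewrite !divr_gt0.
have e2K : e2 * (K' + 1) = e / 2 by rewrite /e2 mulfVK ?gt_eqF.
have [d2 d20 H2] := Hf e2 e20; have [d1 d10 H1] := Hg e1 e10.
have v1 : 0 < `|v| + 1 by rewrite ltr_wpDl.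
pose d := Num.min (Num.min d1 r) (d2 / (K' + 1)).
have d0 : 0 < d by rewrite !lt_min d10 r0 divr_gt0.
have [dd1 dr dd2] : [/\ d <= d1, d <= r & d * (K' + 1) <= d2].
  by rewrite -ler_pdivlMr// /d !ge_min !lexx ?orbT.
pose s := d / 2 / (`|v| + 1); have s0 : 0 < s by rewrite !divr_gt0.
have sv : `|s *: v| < d.
  rewrite normrZ gtr0_norm// (@lt_le_trans _ _ (s * (`|v| + 1)))//.
    by rewrite ltr_pM2l// ltrDl.
  by rewrite /s mulfVK ?gt_eqF//; lra.
set w := s *: v in sv.
have xw : x + w - x = w by rewrite addrC addKr.
have xd q : 0 < q -> `|x - x| < q by rewrite subrr normr0.
have wd1 : `|x + w - x| < d1 by rewrite xw; exact: lt_le_trans dd1.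
have wr : `|x + w - x| < r by rewrite xw; exact: lt_le_trans dr.
have G1 := H1 x (x + w) (xd _ d10) wd1; rewrite xw in G1.
set a := g (x + w) - g x in G1.
have na : `|a| <= (K' + 1) * `|w|.
  have := ler_normD (a - w *m J') (w *m J'); rewrite subrK.
  have : e1 * `|w| <= 1 * `|w| by rewrite ler_wpM2r.
  have := HK' w; lra.
have ad : `|a| < d2.
  by rewrite (le_lt_trans na)// mulrC (lt_le_trans _ dd2)// ltr_pM2r.
have gd : `|g x - g x| < d2 by rewrite subrr normr0.
have G2 := H2 (g x) (g (x + w)) gd ad.
rewrite (fg _ wr) (fg x (xd _ r0)) xw -/a in G2.
have G3 : `|(a - w *m J') *m J| <= K * (e1 * `|w|).
  by rewrite (le_trans (HK _))// ler_pM2l.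
have : `|w - w *m (J' *m J)| <= e * `|w|.
  have -> : w - w *m (J' *m J) = (w - a *m J) + (a - w *m J') *m J.
    by rewrite (mulmxBl a) mulmxA addrA subrK.
  have h1 : K * (e1 * `|w|) <= e / 2 * `|w| by rewrite mulrA ler_wpM2r.
  have h2 : e2 * `|a| <= e / 2 * `|w|.
    by rewrite -e2K -mulrA ler_pM2l.
  rewrite (le_trans (ler_normD _ _))//.
  have -> : e * `|w| = e / 2 * `|w| + e / 2 * `|w| by field.
  by move: (e / 2 * `|w|) h1 h2 G2 G3 => q; lra.
by rewrite /w -scalemxAl -scalerBr !(normrZ s) (gtr0_norm s0) mulrCA ler_pM2l.
Qed.

(** * Level sets of envelopes as DC submanifolds *)

Section LevelSets.
Variables (R : realType).

Definition level_set m (M : smoothManifold R m) k (u : 'rV[R]_m -> R) (c : chart R m M)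
    (c0 : 'rV[R]_m) (r n rho : R) (V : 'I_k.+1 -> 'rV[R]_m) : set M :=
  [set q | dom c q /\ `|phi c q - c0| < r /\ forall j,
    env u c0 r n rho (V ord0) (phi c q) = env u c0 r n rho (V (lift ord0 j)) (phi c q)].

Lemma slope_gt0 m (r n rho : R) : 0 < r -> 0 <= n -> 0 < rho ->
  0 < (m%:R + 1) * (2 * rho + 4 * n * r).
Proof.
move=> r0 n0 rho0; apply: mulr_gt0; first by rewrite ltr_wpDl.
by apply: ltr_pwDl; rewrite ?mulr_gt0// mulr_ge0 ?mulr_ge0// ltW.
Qed.

Lemma level_set_dc d k (M : smoothManifold R (d + k)) (u : 'rV[R]_(d + k) -> R)
    (c c' : chart R (d + k) M) c0 r n rho (V p : 'I_k.+1 -> 'rV[R]_(d + k))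
    (E : 'M[R]_(k, d + k)) K :
  atlas c -> atlas c' -> 0 < r -> 0 <= n -> 0 < rho -> 0 < K ->
  (forall i, exists y q, active u c0 r n rho (V i) y q) ->
  (forall i, `|p i - V i| < rho) ->
  (forall (y : 'rV[R]_k) j, dot (p ord0 - p (lift ord0 j)) (y *m E) = y 0 j) ->
  (forall y : 'rV[R]_k, `|y *m E| <= K * `|y|) ->
  16 * (k.+1%:R * (((d + k)%:R + 1) * (2 * rho + 4 * n * r) * K)) <= 1 ->
  DC_submanifold_Rm d (phi c' @` (level_set u c c0 r n rho V `&` dom c')).
Proof.
move=> Ac Ac' r0 n0 rho0 K0 ne pV dual EK small z0 Sz0.
have [q [[cq [qr lq]] c'q] qz] := Sz0.
pose T := phi c \o psi c'; pose T' := phi c' \o psi c.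
have Dz : (phi c' @` (dom c' `&` dom c)) z0 by exists q.
have [cz cz'] := (trans_dom c' c z0).1 Dz.
have oD := @trans_open _ _ _ c' c.
have Tz : T z0 = phi c q by rewrite /T/= -qz phiKd.
have D'z : (phi c @` (dom c `&` dom c')) (T z0) by exists q; [split|].
have [J HJ] := Ck1_strict oD (trans_Ck 1 Ac' Ac) Dz.
have [J' HJ'] := Ck1_strict (@trans_open _ _ _ c c') (trans_Ck 1 Ac Ac') D'z.
have T'T : T' (T z0) = z0 by rewrite /T' /T/= phiKd// psiKd.
have JJ : J' *m J = 1%:M.
  apply: (@strict_inverse R _ T T' J J' (T z0)) => //; first by rewrite T'T.
  have n1 := open_nbhs_nbhs (conj (@trans_open _ _ _ c c') D'z).
  apply: filterS n1 => y /trans_dom[cy c'y].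
  by rewrite /T' /T/= phiKd// psiKd.
apply: (@level_dc_at R d k (fun i => env u c0 r n rho (V i)) c0 r n
  (((d + k)%:R + 1) * (2 * rho + 4 * n * r)) K E p _ _ _ _ _ _ _ _ T
  (phi c' @` (dom c' `&` dom c)) _ J J') => //.
- exact: slope_gt0.
- by move=> i x y t xr yr t01; exact: env_sc.
- by move=> i x y xr yr; exact: env_aff.
- exact: trans_Ck.
- by rewrite Tz.
have n1 := open_nbhs_nbhs (conj oD Dz).
have n2 : \forall x \near z0, `|T x - c0| < r.
  have cT : continuous_at z0 T by exact: CkW (trans_Ck 0 Ac' Ac) Dz.
  have cN : continuous_at z0 (fun x => `|T x - c0|).
    have c1 := cts_sub cT (@cts_cst _ _ c0 z0).
    by apply: (continuous_comp c1); exact: norm_continuous.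
  have lt0 : `|T z0 - c0| < r by rewrite Tz.
  exact: (cN _ (lt_nbhsl lt0)).
apply: filterS2 n1 n2 => x /trans_dom[c'x cx] xr; split.
  by move=> [q' [[_ [_ lq']] c'q'] <-] j; have := lq' j; rewrite /T/= phiKd.
move=> H; exists (psi c' x); last exact: psiKd.
by split; [split; [|split]|exact: dom_psi].
Qed.

(** For d = 0 the level set must be exactly one point. Then [E] is invertible, and almost affinity
    on the whole ball gives |y| <= |y| / 2 for the difference of two solutions; [q0] provides
    existence. *)
Lemma level_set_submanifold m d k (Em : m = (d + k)%N) (M : smoothManifold R m)
    (u : 'rV[R]_m -> R) (c : chart R m M) c0 r n rho (V p : 'I_k.+1 -> 'rV[R]_m)
    (E : 'M[R]_(k, m)) K q0 :
  atlas c -> 0 < r -> 0 <= n -> 0 < rho -> 0 < K ->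
  (forall i, exists y q, active u c0 r n rho (V i) y q) ->
  (forall i, `|p i - V i| < rho) ->
  (forall (y : 'rV[R]_k) j, dot (p ord0 - p (lift ord0 j)) (y *m E) = y 0 j) ->
  (forall y : 'rV[R]_k, `|y *m E| <= K * `|y|) ->
  16 * (k.+1%:R * ((m%:R + 1) * (2 * rho + 4 * n * r) * K)) <= 1 ->
  level_set u c c0 r n rho V q0 ->
  DC_submanifold d (level_set u c c0 r n rho V).
Proof.
move: M u c c0 V p E q0; rewrite {}Em => M u c c0 V p E q0 Ac r0 n0 rho0 K0 ne pV dual EK small lq0.
case: d => [|d] in M u c c0 V p E q0 Ac ne pV dual EK small lq0 *; last first.
  by move=> c' Ac'; exact: level_set_dc K0 ne pV dual EK small.
exists q0; apply/seteqP; split=> [q lq|_ ->//].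
have [cq [qr eq]] := lq; have [cq0 [q0r eq0]] := lq0.
set th := (_ + 1) * _ in small.
have th0 : 0 < th by exact: slope_gt0.
have rE : row_free E.
  by apply: inj_row_free => y yE; apply/rowP => j; rewrite -(dual y j) yE dot0r mxE.
have uE : E \in unitmx by rewrite -row_free_unit.
pose y := (phi c q - phi c q0) *m invmx E.
have yE : y *m E = phi c q - phi c q0 by rewrite mulmxKV.
have aff i := env_aff r0 n0 rho0 (ne i) (pV i) q0r qr.
suff y0 : y = 0.
  have /eqP : phi c q - phi c q0 = 0 by rewrite -yE y0 mul0mx.
  by rewrite subr_eq0 => /eqP pq; rewrite /= -(phiKd cq) pq phiKd.
have thK : 2 * (th * K) <= 2^-1.
  have : th * K <= k.+1%:R * (th * K).
    by rewrite ler_peMl ?ler1n// mulr_ge0// ltW.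
  lra.
have half : `|y| <= 2^-1 * `|y|.
  apply: (le_trans (y := 2 * (th * K) * `|y|)); last by rewrite ler_wpM2r.
  apply: rV_norm_le => [|j]; first by rewrite mulr_ge0// mulr_ge0// mulr_ge0// ltW.
  rewrite -(dual y j) dotBl yE.
  have := aff ord0; have := aff (lift ord0 j); rewrite (eq j) (eq0 j) -/th.
  have := EK y; rewrite yE -(ler_pM2l th0).
  move: (th * `|_|) => a h0 /ler_normlP[h1 h2] /ler_normlP[h3 h4].
  by apply/ler_normlP; split; lra.
by apply/eqP; rewrite -normr_le0; have := normr_ge0 y; lra.
Qed.

End LevelSets.

(** The radius [d] is quantified after [rho] because it will depend on it through semicontinuity.
    Approximating within rho / 2 leaves room for supergradients within rho / 2 of [p i]. The choices
    rho < 1 / (4 A) and r < 1 / B each take half of the final bound. *)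
Lemma exists_data (R : realType) m k (p : 'I_k.+1 -> 'rV[R]_m) (x0 : 'rV[R]_m) (C K : R) :
  0 < K -> exists (n : nat) (rho : rat) (V : {ffun 'I_k.+1 -> 'rV[rat]_m}),
  [/\ C <= n%:R, 0 < (ratr rho : R),
    forall i, `|p i - map_mx (ratr : rat -> R) (V i)| < ratr rho / 2 &
    forall d, 0 < d -> exists (c0 : 'rV[rat]_m) (r : rat),
    [/\ 0 < (ratr r : R), `|x0 - map_mx (ratr : rat -> R) c0| < ratr r,
      forall x, `|x - map_mx (ratr : rat -> R) c0| < ratr r -> `|x - x0| < d &
      16 * (k.+1%:R * ((m%:R + 1) * (2 * ratr rho + 4 * n%:R * ratr r) * K)) <= 1]].
Proof.
move=> K0; pose A : R := 16 * (k.+1%:R * ((m%:R + 1) * K)).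
have A0 : 0 < A by rewrite !mulr_gt0 ?ltr_wpDl.
pose n := (Num.truncn C).+1; have Cn : C <= n%:R by exact/ltW/truncnS_gt.
have [rho /andP[rho0 rhoA]] := rat_small (divr_gt0 (ltr0Sn R 0) (mulr_gt0 (ltr0Sn R 3) A0)).
have rho2 : 0 < ratr rho / 2 :> R by rewrite divr_gt0.
have /choice[V HV] : forall i, exists V : 'rV[rat]_m,
    `|p i - map_mx (ratr : rat -> R) V| < ratr rho / 2.
  by move=> i; have [V HV] := rat_approx (p i) rho2; exists V; rewrite distrC.
exists n, rho, [ffun i => V i]; split=> // [i|d d0]; first by rewrite ffunE.
have n1 : 0 < n%:R + 1 :> R by rewrite ltr_wpDl.
pose B : R := 8 * (n%:R + 1) * A.
have B0 : 0 < B by rewrite !mulr_gt0.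
have e0 : 0 < Num.min (d / 2) (1 / B) by rewrite lt_min !divr_gt0.
have [r /andP[r0]] := rat_small e0; rewrite lt_min => /andP[rd rB].
have [c0 Hc0] := rat_approx x0 r0.
exists c0, r; split=> //; first by rewrite distrC.
- move=> x xr; have -> : x - x0 = (x - map_mx ratr c0) + (map_mx ratr c0 - x0).
    by rewrite addrA subrK.
  by rewrite (le_lt_trans (ler_normD _ _))//; lra.
have -> : 16 * (k.+1%:R * ((m%:R + 1) * (2 * ratr rho + 4 * n%:R * ratr r) * K)) =
    2 * (ratr rho * A) + 4 * n%:R * (ratr r * A) by rewrite /A; ring.
have h1 : ratr rho * (4 * A) < 1 by rewrite -ltr_pdivlMr// mulr_gt0.
have h2 : ratr r * B < 1 by rewrite -ltr_pdivlMr.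
have h3 : 0 <= ratr r * A :> R by rewrite mulr_ge0// ltW.
move: h2; rewrite /B.
have -> : ratr r * (8 * (n%:R + 1) * A) = 8 * n%:R * (ratr r * A) + 8 * (ratr r * A) by ring.
have : 0 <= n%:R * (ratr r * A) :> R by rewrite mulr_ge0.
lra.
Qed.

(** Lindelof's argument: a chart is chosen for the code of each basic open set that fits in some
    chart domain; other indices receive a default chart. *)
Lemma countable_charts (R : realType) m (M : smoothManifold R m) : [set: M] !=set0 ->
  exists ch : nat -> chart R m M, (forall i, atlas (ch i)) /\ forall q, exists i, dom (ch i) q.
Proof.
move=> [q0 _]; have [c0 [Ac0 _]] := exists_chart q0.
have [B /countable_injP[f finj] [Bo Bb]] := manifold_second_countable M.
have /choice[ch Hch] : forall i : nat, exists c : chart R m M, atlas c /\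
    forall U, B U -> f U = i -> (exists2 c', atlas c' & U `<=` dom c') -> U `<=` dom c.
  move=> i; have [[U [BU [fU [c' Ac' Uc']]]]|nU] := pselect (exists U, B U /\ f U = i /\
      exists2 c' : chart R m M, atlas c' & U `<=` dom c').
    exists c'; split=> // U' BU' fU' _.
    by have -> : U' = U by apply: finj; rewrite ?inE// fU.
  exists c0; split=> // U BU fU HU; exfalso; apply: nU.
  by exists U.
exists ch; split=> [i|q]; first by case: (Hch i).
have [c [Ac cq]] := exists_chart q.
have [U [BU Uq] Uc] := Bb q _ (near_dom cq).
exists (f U); have [_ H] := Hch (f U).
by apply: (H U BU erefl); first by exists c.
Qed.

(** * Structure of the singular set near a point *)

Section Structure.
Variables (R : realType) (m : nat) (M : smoothManifold R m) (F : finsler M).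
Variable N : set M.
Hypotheses (hconn : connected [set: M]) (N0 : N !=set0) (Ncl : closed N).
Implicit Types (c : chart R m M) (x y v : 'rV[R]_m).
Let uh c (x : 'rV[R]_m) : R := dist_from F N (psi c x).
Notation ratv := (map_mx (ratr : rat -> R)).

(** The Finsler norm enters the remaining argument only through these properties of the
    supergradients. *)
Lemma local_supergradients c z0 : atlas c -> cod c z0 -> ~ N (psi c z0) ->
  exists r0 C (D : 'rV[R]_m -> set 'rV[R]_m), [/\ 0 < r0, 0 <= C,
   [set z | `|z - z0| < r0] `<=` cod c `&` psi c @^-1` ~` N,
   forall x p, `|x - z0| < r0 -> D x p ->
     supg (uh c) [set z | `|z - z0| < r0] C x p &
   [/\ forall x, `|x - z0| < r0 -> exists p, D x p,
     forall x p, `|x - z0| < r0 -> (forall q, D x q -> q = p) -> differentiable (uh c) x,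
     forall Q, closed Q -> (forall p, Q p -> ~ D z0 p) ->
       exists2 d, 0 < d & forall y p, `|y - z0| < d -> Q p -> ~ D y p &
     forall p0 p1 p2 s, D z0 p0 -> D z0 p1 -> D z0 p2 -> 0 < s < 1 ->
       p1 = (1 - s) *: p0 + s *: p2 -> p0 = p1]].
Proof.
move=> Ac cz nz.
have [r [C [r0 C0 free sc]]] := uh_semiconcave F hconn N0 Ncl Ac cz nz.
have rc : [set z | `|z - z0| <= r] `<=` cod c by move=> z /free[].
have [L L0 lip] := uh_lip F hconn N0 Ac r0 rc.
have [a [b [a0 b0 ab]]] := Fc_bounds F Ac (@closed_ballP_compact _ _ z0 r) rc.
have zz : `|z0 - z0| < r by rewrite subrr normr0.
have Bc x : `|x - z0| < r -> cod c x by move=> /ltW/rc.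
have Bn x : `|x - z0| < r -> ~ N (psi c x) by move=> /ltW/free[].
have lip' x y : `|x - z0| < r -> `|y - z0| < r -> `|uh c x - uh c y| <= L * `|x - y|.
  by move=> /ltW xr /ltW yr; exact: lip.
have cts x v : `|x - z0| < r -> continuous_at (x, v) (Fc F c).
  by move=> /Bc; exact: Fc_cts.
have bnd x v : `|x - z0| < r -> Fc F c (x, v) <= b * `|v|.
  by move=> /ltW xr; have /andP[] := ab x v xr.
have above x p d n : `|x - z0| < r -> 0 < d ->
    (forall y, `|y - x| < d -> uh c y <= uh c x + dot p (y - x) + n * sq (y - x)) ->
    forall v, dot p v <= Fc F c (x, v).
  by move=> /Bc cx d0; exact: (supergradient_le hconn N0 Ac cx d0).
have below x p d n : `|x - z0| < r -> 0 < d ->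
    (forall y, `|y - x| < d -> uh c x + dot p (y - x) - n * sq (y - x) <= uh c y) ->
    exists2 v, sphere v & Fc F c (x, v) <= dot p v.
  by move=> xr d0; exact: (touching hconn N0 Ncl Ac (Bc _ xr) (Bn _ xr) d0).
exists r, C, (dstar (uh c) (Fc F c) z0 r C); split=> //.
- by move=> z /ltW/free.
- by move=> x p _ [].
split.
- by move=> x xr; exact: (dstar_ex C0 L0 lip' sc cts bnd above below xr).
- by move=> x p xr; exact: (dstar_diff C0 L0 lip' sc cts bnd above below xr).
- by move=> Q cQ; exact: (dstar_usc L0 lip' cts bnd above zz cQ).
- move=> p0 p1 p2 s D0 D1 D2 s01; apply: (dstar_convex above zz _ D0 D1 D2 s01).
  move=> v w v0; have H : [set xy : 'rV[R]_m * 'rV[R]_m | cod c xy.1 /\ xy.2 != 0] (z0, v).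
    by [].
  have D : derivable (Fc F c) (z0, v) (0, w) by exact: Ck_derivable (Fc_Ck F 1 Ac) H.
  have Eq : (fun h : R => h^-1 *: ((Fc F c \o shift (z0, v)) (h *: ((0 : 'rV[R]_m), w)) -
      Fc F c (z0, v))) = (fun h : R => h^-1 *: (((fun w => Fc F c (z0, w)) \o shift v) (h *: w) -
      Fc F c (z0, v))).
    apply/funext => h /=; congr (_ *: (Fc F c (_, _) - _)).
    change (h *: (0 : 'rV[R]_m) + z0 = z0); by rewrite scaler0 add0r.
  by move: D; rewrite /derivable Eq.
Qed.

(* Rational parameters: chart, ball, semiconcavity constant, and the radius and
   centres of the neighbourhoods of the supergradients. *)
Definition datum k := (nat * 'rV[rat]_m * rat * nat * rat * {ffun 'I_k.+1 -> 'rV[rat]_m})%type.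

Definition datum_set (ch : nat -> chart R m M) k (a : datum k) : set M :=
  let: (i, c0, r, n, rho, V) := a in
  level_set (uh (ch i)) (ch i) (ratv c0) (ratr r) n%:R (ratr rho) (fun j => ratv (V j)).

Lemma not_differentiable_chart p c : singular_set F N p -> chart_at p c ->
  ~ differentiable (uh c) (phi c p).
Proof.
move=> [_ nd] pc d; apply: nd => c' pc'; exact: differentiable_chart pc pc' d.
Qed.

Lemma datum_exists ch i p k (P : 'I_k.+1 -> 'rV[R]_m) r0 C d :
  (forall i, atlas (ch i)) -> dom (ch i) p -> 0 < r0 -> m = (d + k)%N ->
  (forall j, supg (uh (ch i)) [set z | `|z - phi (ch i) p| < r0] C (phi (ch i) p) (P j)) ->
  row_free (\matrix_(j < k) (P ord0 - P (lift ord0 j))) ->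
  exists (E : 'M[R]_(k, m)) K (n : nat) (rho : rat) (V : {ffun 'I_k.+1 -> 'rV[rat]_m}),
  [/\ 0 < K, 0 < (ratr rho : R), C <= n%:R,
    (forall (y : 'rV[R]_k) j, dot (P ord0 - P (lift ord0 j)) (y *m E) = y 0 j) /\
    (forall y : 'rV[R]_k, `|y *m E| <= K * `|y|) &
   (forall j, `|P j - ratv (V j)| < ratr rho / 2) /\
   forall d', 0 < d' -> exists (c0 : 'rV[rat]_m) (r : rat),
   [/\ 0 < (ratr r : R), `|phi (ch i) p - ratv c0| < ratr r,
     (forall x, `|x - ratv c0| < ratr r -> `|x - phi (ch i) p| < d'),
     (forall j, active (uh (ch i)) (ratv c0) (ratr r) n%:R (ratr rho) (ratv (V j))
       (phi (ch i) p) (P j)) /\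
     16 * (k.+1%:R * ((m%:R + 1) * (2 * ratr rho + 4 * n%:R * ratr r) * K)) <= 1 &
     datum_set ch (i, c0, r, n, rho, V) p /\
     DC_submanifold d (datum_set ch (i, c0, r, n, rho, V))]].
Proof.
move=> Ach cp r00 Em sg rf; set c := ch i in cp sg *; set x0 := phi c p in sg *.
have [E HE] := dual_basis rf; have [K K0 HK] := mulmx_bound E.
have dual (y : 'rV[R]_k) j : dot (P ord0 - P (lift ord0 j)) (y *m E) = y 0 j.
  by rewrite -[RHS](HE y j) rowK.
have [n [rho [V [Cn rho0 HV Hd]]]] := exists_data P x0 C K0.
exists E, K, n, rho, V; split=> //; split=> // d' d'0.
have d2 : 0 < Num.min d' r0 by rewrite lt_min d'0.
have [c0 [r [rr0 xr sub small]]] := Hd _ d2.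
have rhoh : ratr rho / 2 < ratr rho :> R by rewrite ltr_pdivrMr//; lra.
have act j : active (uh c) (ratv c0) (ratr r) n%:R (ratr rho) (ratv (V j)) x0 (P j).
  split=> //; last by rewrite (lt_trans (HV j)).
  move=> y /= yr; have := sub y yr; rewrite lt_min => /andP[_ /(sg j y) H].
  by rewrite (le_trans H)// lerD2l ler_wpM2r// sq_ge0.
exists c0, r; split=> //; first by move=> x /sub; rewrite lt_min => /andP[].
have lp : datum_set ch (i, c0, r, n, rho, V) p.
  split; [exact: cp|split=> [|j]; first exact: xr].
  by rewrite (env_eq (act ord0)) ?(env_eq (act (lift ord0 j))).
split=> //; have n0 : 0 <= n%:R :> R by [].
apply: (level_set_submanifold Em (Ach i) rr0 n0 rho0 K0 _ _ dual HK small lp).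
- by move=> j; exists x0, (P j).
- by move=> j; rewrite (lt_trans (HV j)).
Qed.

Lemma pair_structure ch i p : (forall i, atlas (ch i)) -> (2 <= m)%N -> dom (ch i) p ->
  singular_set F N p ->
  (exists a : datum 1, [/\ datum_set ch a p, DC_hypersurface (datum_set ch a) &
     datum_set ch a `<=` singular_set F N]) \/
  (exists a : datum 2, datum_set ch a p /\ DC_submanifold (m - 2) (datum_set ch a)).
Proof.
move=> Ach hm cp Sp; set c := ch i in cp *; set x0 := phi c p.
have nd := not_differentiable_chart Sp (conj (Ach i) cp).
have cx : cod c x0 by exact: cod_phi.
have nx : ~ N (psi c x0) by rewrite phiKd//; case: Sp.
have [r0 [C [D [r00 C0 free sg [Dex Ddiff Dusc Dconv]]]]] := local_supergradients (Ach i) cx nx.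
have xx : `|x0 - x0| < r0 by rewrite subrr normr0.
have [p0 Dp0] := Dex x0 xx.
have [p1 [Dp1 p10]] : exists p1, D x0 p1 /\ p1 <> p0.
  apply: contrapT => nE; apply: nd; apply: (Ddiff x0 p0 xx) => q Dq.
  by apply: contrapT => qp; apply: nE; exists q.
have [H2|[p2 [Dp2 p20 p21]]] : (forall q, D x0 q -> q = p0 \/ q = p1) \/
    (exists p2, [/\ D x0 p2, p2 <> p0 & p2 <> p1]).
- have [H|nH] := pselect (exists p2, [/\ D x0 p2, p2 <> p0 & p2 <> p1]); first by right.
  left=> q Dq; have [->|/eqP q0] := eqVneq q p0; first by left.
  have [->|/eqP q1] := eqVneq q p1; first by right.
  by exfalso; apply: nH; exists q.
- left; pose P (j : 'I_2) := if j == ord0 then p0 else p1.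
  have DP j : D x0 (P j) by rewrite /P; case: ifP.
  have rf : row_free (\matrix_(j < 1) (P ord0 - P (lift ord0 j))).
    by apply: pair_row_free; rewrite /P/=; apply/eqP => /esym.
  have Em : m = (m.-1 + 1)%N by rewrite addn1 prednK// (leq_trans _ hm).
  have [E [K [n [rho [V [K0 rho0 Cn [dual HK] [HV Hd]]]]]]] :=
    datum_exists Ach cp r00 Em (fun j => sg x0 _ xx (DP j)) rf.
  (* Semicontinuity applied to the complement of the two balls: near [x0], every element of D is
     within rho / 2 of [p0] or of [p1]. *)
  pose Q := [set q | ratr rho / 2 <= `|q - p0|] `&` [set q | ratr rho / 2 <= `|q - p1|].
  have cQ : closed Q by apply: closedI; exact: closed_ge_norm.
  have rho2 : 0 < ratr rho / 2 :> R by rewrite divr_gt0.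
  have [|d1 d10 usc] := Dusc Q cQ.
    move=> q [/= q0 q1] /H2[E'|E'].
      by move: q0; rewrite E' subrr normr0 leNgt rho2.
    by move: q1; rewrite E' subrr normr0 leNgt rho2.
  have dd : 0 < Num.min d1 r0 by rewrite lt_min d10.
  have [c0 [r [rr xr sub [act small] [ip DCp]]]] := Hd _ dd.
  exists (i, c0, r, n, rho, V); split=> // q [cq [qr eq]].
  set x := phi c q in qr eq.
  have := sub x qr; rewrite lt_min => /andP[xd1 xr0].
  have n0 : 0 <= n%:R :> R by [].
  have ne j : exists y q, active (uh c) (ratv c0) (ratr r) n%:R (ratr rho) (ratv (V j)) y q.
    by exists x0, (P j).
  have PV j : `|P j - ratv (V j)| < ratr rho.
    by rewrite (lt_trans (HV j))// ltr_pdivrMr//; lra.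
  (* Some element of D at [x] is active for one of the two centres, so that envelope equals u at
     [x]; the level equation carries this over to the other. *)
  have eqx : uh c x = env (uh c) (ratv c0) (ratr r) n%:R (ratr rho) (ratv (V ord0)) x.
    have [q1 Dq1] := Dex x xr0.
    have act1 j : `|q1 - P j| < ratr rho / 2 ->
        active (uh c) (ratv c0) (ratr r) n%:R (ratr rho) (ratv (V j)) x q1.
      move=> qP; split=> //.
        move=> y /= yr; have := sub y yr; rewrite lt_min => /andP[_ yr0].
        by rewrite (le_trans (sg x q1 xr0 Dq1 y yr0))// lerD2l ler_wpM2r// sq_ge0.
      have -> : q1 - ratv (V j) = (q1 - P j) + (P j - ratv (V j)) by rewrite addrA subrK.
      by rewrite (le_lt_trans (ler_normD _ _))//; have := HV j; lra.
    have [q0|q0] := ltP `|q1 - p0| (ratr rho / 2).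
      by rewrite (env_eq (act1 ord0 _)).
    have [q2|q2] := ltP `|q1 - p1| (ratr rho / 2).
      rewrite (eq ord0) (env_eq (act1 (lift ord0 ord0) _))//.
    by exfalso; apply: (usc x q1 xd1 _ Dq1).
  split.
    by have [_] := free x xr0; rewrite /= /x phiKd.
  move=> /(_ c (conj (Ach i) cq)) df; have [g Hg] := differentiable_eps df.
  set th : R := (m%:R + 1) * (2 * ratr rho + 4 * n%:R * ratr r) in small.
  have th0 : 0 < th := slope_gt0 m rr n0 rho0.
  have tK : th * K <= 1 / 32.
    rewrite -(ler_pM2l (ltr0Sn R 31)) mulrA; move: small; rewrite -/th; lra.
  (* With [tK], the total slope error times K is at most 1/32 + 1/8; two such errors stay below 1,
     the pairing of [P ord0 - P (lift ord0 ord0)] with [y *m E]. *)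
  pose e := 1 / 8 / K; have e0 : 0 < e by rewrite !divr_gt0.
  have eK : e * K = 1 / 8 by rewrite /e mulfVK ?gt_eqF.
  have [d2 d20 {}Hg] := Hg e e0.
  have [d3 d30 Hd3] : exists2 d3, 0 < d3 & forall y, `|y - x| < d3 -> `|y - ratv c0| < ratr r.
    exists (ratr r - `|x - ratv c0|); first by rewrite subr_gt0.
    move=> y yx; have -> : y - ratv c0 = (y - x) + (x - ratv c0) by rewrite addrA subrK.
    by rewrite (le_lt_trans (ler_normD _ _))//; lra.
  (* Both envelopes lie above u and equal it at [x], so the gradient [g] must almost agree with each
     [P j]. Opposite directions for the two indices then give the contradiction. *)
  have key j w : dot g w - dot (P j) w <= (th + e) * `|w|.
    pose V0 := `|w| + 1; have V00 : 0 < V0 by rewrite ltr_wpDl.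
    have d230 : 0 < Num.min d2 d3 by rewrite lt_min d20.
    pose s := Num.min d2 d3 / 2 / V0; have s0 : 0 < s by rewrite !divr_gt0.
    have : `|s *: w| < Num.min d2 d3.
      rewrite normrZ gtr0_norm// (@le_lt_trans _ _ (s * V0))//.
        by rewrite ler_pM2l// lerDl.
      by rewrite /s mulfVK ?gt_eqF//; lra.
    rewrite lt_min => /andP[sw2 sw3].
    have xw : (x + s *: w) - x = s *: w by rewrite addrC addKr.
    have xs2 : `|(x + s *: w) - x| < d2 by rewrite xw.
    have xs3 : `|(x + s *: w) - x| < d3 by rewrite xw.
    have /ler_normlP[+ _] := Hg _ xs2; have /Hd3 xr3 := xs3.
    have /ler_normlP[_] := env_aff rr n0 rho0 (ne j) (PV j) qr xr3.
    have ge := env_ge (ne j) xr3.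
    have ej : env (uh c) (ratv c0) (ratr r) n%:R (ratr rho) (ratv (V j)) x = uh c x.
      rewrite eqx; case: (unliftP ord0 j) => [j' ->|->//].
      by rewrite -(eq j').
    rewrite ej /= -/x -/(uh c _) -/(uh c x) xw !dotZr normrZ (gtr0_norm s0) => h1 h2.
    rewrite -(ler_pM2l s0) mulrBr; move: ge h1 h2.
    rewrite -/th; have -> : s * ((th + e) * `|w|) = th * (s * `|w|) + e * (s * `|w|) by ring.
    move: (th * _) (e * (s * `|w|)) (s * dot g w) (s * dot (P j) w) => a1 a2 a3 a4.
    move: (env _ _ _ _ _ _ _) (uh c (x + _)) (uh c x) => a5 a6 a7; lra.
  have [y [y1 yn]] : exists y : 'rV[R]_1, y 0 ord0 = 1 /\ `|y| <= 1.
    exists (const_mx 1); rewrite mxE; split=> //.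
    by apply: rV_norm_le => // j; rewrite mxE normr1.
  have h0 := key ord0 (- (y *m E)); have h1 := key (lift ord0 ord0) (y *m E).
  have := dual y ord0; rewrite y1 dotBl.
  have Ey : (th + e) * `|y *m E| <= 1 / 32 + 1 / 8.
    rewrite (le_trans (y := (th + e) * K))//; last by rewrite mulrDl eK lerD2r.
    by rewrite ler_pM2l ?addr_gt0// (le_trans (HK y))// ler_piMr// ltW.
  move: h0 h1 Ey; rewrite !dotNr normrN; move: (_ * `|_|) => a; lra.
(* Further elements may exist: three of them are enough to place [p] in a codimension 2 set. *)
- right; pose P (j : 'I_3) := if j == ord0 then p0 else if j == ord_max then p2 else p1.
  have DP j : D x0 (P j) by rewrite /P; case: ifP => // _; case: ifP.
  have rf : row_free (\matrix_(j < 2) (P ord0 - P (lift ord0 j))).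
    apply: (@triple_row_free R m (D x0)) => //.
    move=> [[|[|[|//]]] h] [[|[|[|//]]] h']; rewrite /P/= => E;
      try (exact: val_inj); exfalso; congruence.
  have Em : m = (m - 2 + 2)%N by rewrite subnK.
  have [E [K [n [rho [V [K0 rho0 Cn [dual HK] [HV Hd]]]]]]] :=
    datum_exists Ach cp r00 Em (fun j => sg x0 _ xx (DP j)) rf.
  have [c0 [r [rr xr sub _ H]]] := Hd 1 ltr01.
  by exists (i, c0, r, n, rho, V).
Qed.

End Structure.

Local Close Scope ring_scope.

Theorem theorem1p2 (R : realType) (m : nat) (hm : (2 <= m)%N)
  (M : smoothManifold R m) (F : finsler M)
  (hconn : connected [set: M]) (hcomplete : finsler_complete F)
  (N : set M) (hN0 : N !=set0) (hNclosed : closed N) :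
  exists (S : nat -> set M) (Rem : set M),
    [/\ forall j, DC_hypersurface (S j),
        exists T : nat -> set M,
          (forall j, DC_submanifold (m - 2) (T j)) /\
          Rem `<=` \bigcup_j T j &
        singular_set F N = (\bigcup_j S j) `|` Rem].
Proof.
have [q0 _] := hN0.
have [|ch [Ach cov]] := @countable_charts R m M; first by exists q0.
pose fam k (j : nat) : set M := if unpickle j is Some a then datum_set F N ch (k := k) a else set0.
have DC0 d : (0 < d)%N -> DC_submanifold d (set0 : set M).
  by case: d => // d _ c _ x [? [[]]].
(* Rational data not arising from a singular point may give arbitrary sets; these are discarded by
   case analysis. *)
pose good j := DC_hypersurface (fam 1 j) /\ fam 1 j `<=` singular_set F N.
pose S j := if pselect (good j) is left _ then fam 1 j else set0.
(* For m = 2 the padding cannot be empty, since a DC submanifold of dimension 0 is a single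
   point. *)
have [dummy Hdummy] : exists X : set M, DC_submanifold (m - 2) X.
  have [m2|m2] := posnP (m - 2); first by rewrite m2; exists [set q0], q0.
  by exists set0; exact: DC0.
pose T j := if pselect (DC_submanifold (m - 2) (fam 2 j)) is left _ then fam 2 j else dummy.
exists S, (singular_set F N `\` \bigcup_j S j); split.
- move=> j; rewrite /S; case: pselect => [[]//|_].
  by apply: DC0; rewrite -ltnS prednK// (leq_trans _ hm).
- exists T; split=> [j|p [Sp nS]]; first by rewrite /T; case: pselect.
  have [i cp] := cov p.
  have [[a [ap DCa aS]]|[a [ap DCa]]] := pair_structure hconn hN0 hNclosed Ach hm cp Sp.
    exfalso; apply: nS; exists (pickle a) => //.
    have fa : fam 1 (pickle a) = datum_set F N ch a by rewrite /fam pickleK.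
    by rewrite /S; case: pselect => [_|[]]; rewrite /good fa.
  exists (pickle a) => //.
  have fa : fam 2 (pickle a) = datum_set F N ch a by rewrite /fam pickleK.
  by rewrite /T; case: pselect => [_|[]]; rewrite fa.
rewrite setDUK// => p [j _]; rewrite /S; case: pselect => // -[_].
exact.
Qed.
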